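(* Ideal arrangements are accurate. That is, let $W$ be a Weyl group acting as a reflection group on $V=\mathbb{R}^\ell$, let $\Phi\subseteq V^*$ be a (reduced) root system for $W$ with positive system $\Phi^+$, and let $\mathcal{I}\subseteq\Phi^+$ be an ideal. Then the ideal arrangement $\mathscr{A}_{\mathcal{I}}=\{\ker\beta\mid\beta\in\mathcal{I}\}$ in $V$ is accurate.
   Context: Let $\Delta\subseteq\Phi^+$ be the simple roots. The partial order on $\Phi^+$ is $\beta\le\gamma$ iff $\gamma-\beta\in\sum_{\alpha\in\Delta}\mathbb{Z}_{\ge0}\alpha$. An ideal $\mathcal{I}\subseteq\Phi^+$ is a lower order ideal: $\alpha\in\mathcal{I}$, $\beta\in\Phi^+$, $\beta\le\alpha$ imply $\beta\in\mathcal{I}$. For an arrangement $\mathscr{A}$ (finite set of linear hyperplanes) in $V\cong\mathbb{K}^\ell$ ($\mathbb{K}=\mathbb{R}$ or $\mathbb{C}$) and an intersection $X$ of hyperplanes from $\mathscr{A}$ (the empty intersection is $V$), the restriction is $\mathscr{A}^X=\{H\cap X\mid H\in\mathscr{A},H\not\supseteq X\}$, an arrangement in $X$. Let $S=\mathrm{Sym}(V^* )\cong\mathbb{K}[x_1,\dots,x_\ell]$ and $H=\ker\alpha_H$ with $\alpha_H\in V^*$. $D(\mathscr{A})=\{\theta\in\mathrm{Der}_{\mathbb{K}}(S)\mid\theta(\alpha_H)\in\alpha_HS\text{ for all }H\in\mathscr{A}\}$. $\theta=\sum f_i\,\partial/\partial x_i$ is homogeneous of degree $p$ if all $f_i$ are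 homogeneous of degree $p$ (or zero). $\mathscr{A}$ is free if $D(\mathscr{A})$ is a free $S$-module; its exponents are the degrees of a homogeneous basis of $D(\mathscr{A})$. Accurate: $\mathscr{A}$ is free with exponents $e_1\le e_2\le\dots\le e_\ell$, and for every $1\le d\le\ell$ there is an intersection $X$ of hyperplanes from $\mathscr{A}$ with $\dim X=d$ such that $\mathscr{A}^X$ is free with exponents $e_1\le e_2\le\dots\le e_d$.
   Formalization: In ''accurate'', d ranges only over dimensions at least that of the intersection of all hyperplanes; as literally stated the claim fails (empty ideal with ℓ ≥ 2: the only intersection is V, so no X has dimension 1). *)

(* Defs.v *)
From HB Require Import structures.
From mathcomp Require Import all_boot all_order all_algebra.
From mathcomp Require Import finmap mpoly.
From mathcomp Require Import reals.

Set Implicit Arguments.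
Unset Strict Implicit.
Unset Printing Implicit Defensive.

Import GRing.Theory Num.Theory.

Local Open Scope fset_scope.
Local Open Scope ring_scope.

Section Arrangements.
Variables (K : fieldType) (V : vectType K).

Local Notation n := (\dim {:V}).
(* Sym(V^* ), where 'X_i is the i-th coordinate in the basis [vbasis {:V}]. *)
Local Notation S := {mpoly K[n]}.

Definition form_poly (a : 'Hom(V, K^o)) : S :=
  \sum_(i < n) (a (vbasis {:V})`_i : K) *: 'X_i.

(* The derivation \sum_i f_i d/dx_i of S is encoded by the row (f_i)_i. *)
Definition der_apply (theta : 'rV[S]_n) (p : S) : S :=
  \sum_(i < n) theta 0 i * p^`M(i).

Definition der_homog (p : nat) (theta : 'rV[S]_n) : Prop :=
  forall i, theta 0 i \is p.-homog.

(* Arrangements are finite sets of subspaces, all of them hyperplanes in the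
   intended uses. A form with kernel a hyperplane H is unique up to a nonzero
   scalar, so the condition does not depend on which alpha_H is chosen. *)
Definition logder (A : {fset {vspace V}}) (theta : 'rV[S]_n) : Prop :=
  forall a : 'Hom(V, K^o), lker a \in A ->
    exists g : S, der_apply theta (form_poly a) = form_poly a * g.

Definition is_basis (D : 'rV[S]_n -> Prop) (m : nat) (b : 'I_m -> 'rV[S]_n) :
    Prop :=
  [/\ forall i, D (b i),
      forall theta, D theta ->
        exists c : 'I_m -> S, theta = \sum_(i < m) c i *: b i
    & forall c : 'I_m -> S,
        \sum_(i < m) c i *: b i = 0 -> forall i, c i = 0].

Definition free_arrangement (A : {fset {vspace V}}) : Prop :=
  exists (m : nat) (b : 'I_m -> 'rV[S]_n), is_basis (logder A) b.

Definition has_exponents (A : {fset {vspace V}}) (e : seq nat) : Prop :=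
  exists b : 'I_(size e) -> 'rV[S]_n,
    is_basis (logder A) b /\
    forall i : 'I_(size e), der_homog (nth 0%N e i) (b i).

Definition free_with_exponents (A : {fset {vspace V}}) (e : seq nat) : Prop :=
  free_arrangement A /\ has_exponents A e.

Definition is_flat (A : {fset {vspace V}}) (X : {vspace V}) : Prop :=
  exists2 B : {fset {vspace V}}, B `<=` A & X = (\bigcap_(H <- B) H)%VS.

Definition arr_center (A : {fset {vspace V}}) : {vspace V} :=
  (\bigcap_(H <- A) H)%VS.

(* H :&: X, as a subspace of X, is the preimage of H under the inclusion. *)
Definition restriction (A : {fset {vspace V}}) (X : {vspace V}) :
    {fset {vspace subvs_of X}} :=
  [fset (linfun (@vsval K V X) @^-1: H)%VS | H in A & ~~ (X <= H)%VS].

End Arrangements.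

(* Every flat contains the center, so there is no flat of dimension less than
   [\dim (arr_center A)]; such d are left out. Without the bound, no arrangement
   whose center has dimension at least 2 would be accurate, not even the empty
   arrangement in the plane. For an essential arrangement, whose center is 0,
   the bound is void and d ranges over 1, ..., \dim {:V}: see [accurateE]. *)
Definition accurate (K : fieldType) (V : vectType K) (A : {fset {vspace V}}) :
    Prop :=
  exists e : seq nat,
    [/\ size e = \dim {:V}, sorted leq e, free_with_exponents A e
      & forall d : nat,
          (1 <= d <= \dim {:V})%N -> (\dim (arr_center A) <= d)%N ->
          exists X : {vspace V},
            [/\ is_flat A X, \dim X = d
              & free_with_exponents (restriction A X) (take d e)]].

Lemma accurateE (K : fieldType) (V : vectType K) (A : {fset {vspace V}}) :
  (\dim (arr_center A) <= 1)%N ->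
  accurate A <->
  exists e : seq nat,
    [/\ size e = \dim {:V}, sorted leq e, free_with_exponents A e
      & forall d : nat, (1 <= d <= \dim {:V})%N ->
          exists X : {vspace V},
            [/\ is_flat A X, \dim X = d
              & free_with_exponents (restriction A X) (take d e)]].
Proof.
move=> cA; split=> -[e [sz_e srt_e free_e He]]; exists e; split=> //.
  move=> d dP; apply: He => //; case/andP: dP => d_gt0 _.
  exact: leq_trans cA d_gt0.
by move=> d dP _; apply: He.
Qed.

Section RootSystems.
Variables (R : realType) (V : vectType R).

Local Notation dual := 'Hom(V, R^o).

(* The reflection b |-> b - <b, c> a of V^* (dual to v |-> v - <a, v> c). *)
Definition reflection (a : dual) (c : V) (b : dual) : dual :=
  b - (b c : R) *: a.

(* Reduced crystallographic root system in its span; Phi need not span V^*, that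
   is, the Weyl group may act on V with nonzero fixed vectors. *)
Definition root_system (Phi : {fset dual}) : Prop :=
  [/\ 0 \notin Phi,
      forall a, a \in Phi -> exists c : V,
        [/\ (a c : R) = 2,
            forall b, b \in Phi -> reflection a c b \in Phi
          & forall b, b \in Phi -> (b c : R) \is a Num.int]
    & forall (a : dual) (t : R),
        a \in Phi -> t *: a \in Phi -> t = 1 \/ t = -1].

Definition positive_system (Phi Phip : {fset dual}) : Prop :=
  exists v : V,
    (forall a, a \in Phi -> (a v : R) != 0) /\
    Phip = [fset a in Phi | 0 < (a v : R)].

Definition simple_roots (Phip : {fset dual}) : {fset dual} :=
  [fset a in Phip | ~~ has (fun b => a - b \in Phip) Phip].

Definition root_le (Phip : {fset dual}) (b g : dual) : Prop :=
  exists c : dual -> nat, g - b = \sum_(a <- simple_roots Phip) a *+ c a.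

Definition root_ideal (Phip I : {fset dual}) : Prop :=
  I `<=` Phip /\
  forall a b, a \in I -> b \in Phip -> root_le Phip b a -> b \in I.

Definition ideal_arrangement (I : {fset dual}) : {fset {vspace V}} :=
  [fset lker b | b in I].

End RootSystems.

(* Main.v *)
(* Order the ideal [I] by height and let [A_h] consist of the roots of height at
   most [h]. Multiple addition (Abe, Barakat, Cuntz, Hoge, Terao) passes from
   [A_(h-1)] to [A_h]: the roots of height [h] are independent, no lower root
   lies in their span, and by the local-global formula for heights each of them
   loses at least [h - 1] hyperplanes under restriction. Hence all the basis
   fields of degree less than [h - 1] of [A_(h-1)] are logarithmic for [A_h], and
   those of degree [h - 1] can be recombined so that as many as there are new
   roots are each transverse to a single new hyperplane, while the others are
   again logarithmic.

   For accuracy one proves more: for every homogeneous basis of [D(A_h)] with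
   the increasing degrees [e_1, ..., e_l] and every admissible [d] there is a
   flat [X] of dimension [d] such that the first [d] fields of the basis restrict
   to independent fields on [X] and the restriction has at least
   [e_1 + ... + e_d] hyperplanes; by Saito's criterion they form a basis there.
   If the codimension of [X] is at most the number of roots of height [h], then
   [X] is an intersection of hyperplanes of height [h], chosen by a nonvanishing
   minor, and the hyperplanes are counted with Terao's lemma; otherwise [X] comes
   from [A_(h-1)].

   Linear forms are columns, points are rows, and polynomials are handled as
   functions, the base field being infinite. *)
From HB Require Import structures.
Require Import Defs.
From mathcomp Require Import all_boot all_order all_algebra.
From mathcomp Require Import finmap mpoly.
From mathcomp Require Import reals.
From mathcomp Require Import ring lra zify.

Set Implicit Arguments.
Unset Strict Implicit.
Unset Printing Implicit Defensive.

Import Order.TTheory GRing.Theory Num.Theory.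

Local Open Scope ring_scope.

(** * Lines of linear forms and their traces on a subspace *)

Section Lines.
Variable K : fieldType.

(** The field $\theta_j$ transverse to the new hyperplane $\ker\alpha_j$ is tangent to the other new
    hyperplanes, hence to all their intersections. Terao's lemma therefore applies to it inside such
    an intersection: cutting further with $\ker\alpha_j$ loses at most $h-1$ traces besides
    $\ker\alpha_j$ itself. The total $h$ is the degree of $\alpha_j\theta_j$, so the counts match
    the sums of exponents with nothing to spare. Both parts of a step evaluate at a point common to
    the new hyperplanes and off the old ones. Its existence is the statement on the span of the new
    roots: integrality of the Cartan numbers leaves open lower roots of height $h/2$, and a norm
    estimate excludes these. The roots need not span $V^*$, so the invariant forms are only
    semidefinite; vectors of norm zero are handled through their pairings with the roots or coroots,
    and thereby through heights. *)

Lemma trmx_eq0 m n (A : 'M[K]_(m, n)) : (A^T == 0) = (A == 0).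
Proof. by rewrite -(inj_eq (@trmx_inj _ _ _) A) trmx0. Qed.

(* A canonical representative of the line spanned by a column. *)
Definition rp n (b : 'cV[K]_n) : 'cV[K]_n := (nz_row <<b^T>>%MS)^T.

Lemma rp_eq0 n (b : 'cV[K]_n) : (rp b == 0) = (b == 0).
Proof.
rewrite /rp trmx_eq0 nz_row_eq0 -trmx_eq0 -[RHS]trmx_eq0 trmx_eq0.
by rewrite -!mxrank_eq0 genmxE.
Qed.

Lemma rpE n (b : 'cV[K]_n) : exists2 k, k != 0 & b = k *: rp b.
Proof.
have [->|b0] := eqVneq b 0.
  exists 1; first exact: oner_neq0.
  by apply/eqP; rewrite eq_sym scale1r rp_eq0.
have /sub_rVP [k E] : ((rp b)^T <= b^T)%MS.
  by rewrite /rp trmxK (submx_trans (nz_row_sub _)) ?genmxE.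
have E' : rp b = k *: b by rewrite -[rp b]trmxK E linearZ /= trmxK.
have k0 : k != 0.
  by apply: contraNneq b0 => k0; rewrite -rp_eq0 E' k0 scale0r.
by exists k^-1; rewrite ?invr_eq0 // E' scalerA mulVf // scale1r.
Qed.

Lemma rp_scale n k (b : 'cV[K]_n) : k != 0 -> rp (k *: b) = rp b.
Proof.
move=> k0; congr (_ ^T); congr (nz_row _); apply: eq_genmx.
by rewrite linearZ /=; apply: eqmx_scale.
Qed.

Lemma rp_eqE n (a b : 'cV[K]_n) :
  rp a = rp b <-> exists2 k, k != 0 & a = k *: b.
Proof.
split=> [E|[k k0 ->]]; last exact: rp_scale.
have [[k k0 Ea] [j j0 Eb]] := (rpE a, rpE b).
exists (k / j); first by rewrite mulf_neq0 ?invr_eq0.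
by rewrite [in RHS]Eb -E scalerA divfK.
Qed.

Lemma rp_mul m n (A : 'M[K]_(m, n)) a b : rp a = rp b -> rp (A *m a) = rp (A *m b).
Proof. by move=> /rp_eqE [k k0 ->]; rewrite -scalemxAr rp_scale. Qed.

Lemma rp_id n (b : 'cV[K]_n) : rp (rp b) = rp b.
Proof. by have [k k0 E] := rpE b; rewrite {2}E rp_scale. Qed.

Lemma rp_mulE m1 m2 n (A : 'M[K]_(m1, n)) (B : 'M[K]_(m2, n)) a b :
  (B <= A)%MS -> rp (A *m a) = rp (A *m b) -> rp (B *m a) = rp (B *m b).
Proof. by move=> /submxP [D ->] /(rp_mul D); rewrite !mulmxA. Qed.

Lemma mul_eq0_sub m1 m2 n p (A : 'M[K]_(m1, n)) (B : 'M[K]_(m2, n)) (a : 'M_(n, p)) :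
  (B <= A)%MS -> A *m a = 0 -> B *m a = 0.
Proof. by move=> /submxP [D ->] E; rewrite -mulmxA E mulmx0. Qed.

(* The number of distinct traces of the hyperplanes [ker a], [a \in L], on the
   row space of [A]. *)
Definition traces n (L : seq 'cV[K]_n) m (A : 'M[K]_(m, n)) : seq 'cV[K]_m :=
  undup [seq rp (A *m a) | a <- L & A *m a != 0].

Definition cnt n (L : seq 'cV[K]_n) m (A : 'M[K]_(m, n)) : nat :=
  size (traces L A).

(** Where [g] determines [f], sending a value of [g] to [f] of its first preimage gives a map [h]
    through which [f] factors, so [f] takes no more values than [g]. *)
Lemma size_undup_map_le (T U1 U2 : eqType) (f : T -> U1) (g : T -> U2) (s1 s2 : seq T) :
  {subset s1 <= s2} ->
  {in s1 &, forall x y, g x = g y -> f x = f y} ->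
  (size (undup (map f s1)) <= size (undup (map g s2)))%N.
Proof.
case: s1 => [//|x0 s1] sub fg; set s := x0 :: s1 in sub fg *.
pose h u := f (nth x0 s (find (fun x => g x == u) s)).
have hE x : x \in s -> h (g x) = f x.
  move=> xs; have hs : has (fun y => g y == g x) s by apply/hasP; exists x.
  rewrite /h; apply: fg => //; first by rewrite mem_nth // -has_find.
  exact/eqP/(nth_find x0 hs).
rewrite -(size_map h); apply: uniq_leq_size; first exact: undup_uniq.
move=> y; rewrite mem_undup => /mapP [x xs ->]; rewrite -hE //.
by rewrite map_f // mem_undup map_f // sub.
Qed.

Lemma cnt_le n (L1 L2 : seq 'cV[K]_n) m1 m2 (A : 'M_(m1, n)) (B : 'M_(m2, n)) :
  {subset L1 <= L2} -> (B <= A)%MS -> (A <= B)%MS -> (cnt L1 A <= cnt L2 B)%N.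
Proof.
move=> sub AB BA; apply: size_undup_map_le => [a|a b _ _].
  rewrite !mem_filter => /andP [a0 /sub ->]; rewrite andbT.
  by apply: contraNneq a0 => /(mul_eq0_sub BA) ->.
exact: rp_mulE.
Qed.

Lemma cnt_eq n (L : seq 'cV[K]_n) m1 m2 (A : 'M_(m1, n)) (B : 'M_(m2, n)) :
  (A :=: B)%MS -> cnt L A = cnt L B.
Proof. by move=> AB; apply/eqP; rewrite eqn_leq !cnt_le // AB. Qed.

Definition arr n (L : seq 'cV[K]_n) := (0 \notin L) && uniq (map (@rp n) L).

Lemma arr_cons n (a : 'cV_n) L :
  arr (a :: L) = [&& a != 0, rp a \notin map (@rp n) L & arr L].
Proof.
rewrite /arr inE negb_or /= (eq_sym 0).
by case: (a != 0); case: (0 \notin L); case: (_ \notin _).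
Qed.

Lemma arr_traces n (L : seq 'cV[K]_n) m (A : 'M[K]_(m, n)) : arr (traces L A).
Proof.
apply/andP; split.
  rewrite mem_undup; apply/mapP => -[a]; rewrite mem_filter => /andP [a0 _] /esym/eqP.
  by rewrite rp_eq0 (negbTE a0).
rewrite map_inj_in_uniq ?undup_uniq // => a b; rewrite !mem_undup.
by move=> /mapP [a' _ ->] /mapP [b' _ ->]; rewrite !rp_id.
Qed.

Lemma cnt1 n (L : seq 'cV[K]_n) : arr L -> cnt L (1%:M : 'M_n) = size L.
Proof.
case/andP => L0 Lu; rewrite /cnt /traces.
under eq_map do rewrite mul1mx; rewrite (_ : filter _ _ = L).
  by rewrite undup_id // size_map.
by apply/all_filterP/allP => a aL; rewrite mul1mx; apply: contraNneq L0 => <-.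
Qed.

Lemma dual_vector n (a : 'cV[K]_n) : a != 0 -> exists u : 'rV_n, u *m a = 1.
Proof.
move=> /cV0Pn [i ai]; exists ((a i 0)^-1 *: delta_mx 0 i).
apply/matrixP => j k; rewrite !ord1 -scalemxAl -rowE !mxE mulVf //.
Qed.

(** If [u b = 1], every [e_i - (e_i b) u] lies in the kernel of [b], hence in that of [a]; this says
    [a = b (u a)]. *)
Lemma sub_ker n (a b : 'cV[K]_n) :
  a != 0 -> b != 0 -> (forall v : 'rV_n, v *m b = 0 -> v *m a = 0) -> rp a = rp b.
Proof.
move=> a0 /dual_vector [u ub] H.
have E : a = b *m (u *m a).
  apply/row_matrixP => i; rewrite rowE [RHS]rowE; apply/eqP; rewrite -subr_eq0.
  apply/eqP; rewrite !mulmxA -mulmxBl; apply: H.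
  by rewrite mulmxBl -[_ *m u *m b]mulmxA ub mulmx1 subrr.
move: E; rewrite [u *m a]mx11_scalar mul_mx_scalar => E.
apply/rp_eqE; exists ((u *m a) 0 0) => //.
by apply: contraNneq a0 => k0; rewrite E k0 scale0r.
Qed.
End Lines.

(** * Polynomials vanishing on hyperplanes *)

(** Reduction modulo [N] reads off the lowest digit. This is what makes the Kronecker substitution
    below injective on monomials. *)
Lemma digits_inj (N n : nat) (f g : nat -> nat) :
  (forall i, i < n -> f i < N /\ g i < N)%N ->
  (\sum_(i < n) f i * N ^ i = \sum_(i < n) g i * N ^ i)%N ->
  forall i, (i < n)%N -> f i = g i.
Proof.
elim: n f g => [|n IH] f g fgN //; rewrite !big_ord_recl !expn0 !muln1 => E.
have sh (h : nat -> nat) :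
    (\sum_(i < n) h (lift ord0 i) * N ^ lift ord0 i
      = N * \sum_(i < n) h i.+1 * N ^ i)%N.
  by rewrite big_distrr; apply: eq_bigr => i _; rewrite lift0 expnS mulnCA.
rewrite !sh in E; have [f0 g0] := fgN 0%N isT.
have N0 : (0 < N)%N by case: (N) f0.
have E0 : f 0%N = g 0%N.
  have md x y : (x < N)%N -> ((x + N * y) %% N = x)%N.
    by move=> ltx; rewrite addnC mulnC modnMDl modn_small.
  by rewrite -(md _ (\sum_(i < n) f i.+1 * N ^ i)%N f0) E md.
have E1 : (\sum_(i < n) f i.+1 * N ^ i = \sum_(i < n) g i.+1 * N ^ i)%N.
  by move: E; rewrite E0 => /addnI/eqP; rewrite eqn_pmul2l // => /eqP.
case=> [//|i] lt_i.
by apply: (IH (fun i => f i.+1) (fun i => g i.+1)) => // j lt_j; apply: fgN.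
Qed.

Lemma poly_nonroot (K : numFieldType) (q : {poly K}) :
  q != 0 -> exists t, q.[t] != 0.
Proof.
move=> q0; set rs := [seq i%:R | i <- iota 0 (size q)] : seq K.
have rs_uniq : uniq rs.
  by rewrite map_inj_uniq ?iota_uniq // => i j /eqP; rewrite eqr_nat => /eqP.
have [ar|/allPn [t _ tr]] := boolP (all (root q) rs); last by exists t.
by have := max_poly_roots q0 ar rs_uniq; rewrite size_map size_iota ltnn.
Qed.

Section Points.
Variables (K : numFieldType) (n : nat).
Local Notation S := {mpoly K[n]}.

Definition ev (v : 'rV[K]_n) : S -> K := meval (v 0).
HB.instance Definition _ v := GRing.RMorphism.on (ev v).

(* Substituting [x_i = t ^ (N ^ i)] (Kronecker) separates the monomials. *)
Lemma ev_neq0 (f : S) : f != 0 -> exists v, ev v f != 0.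
Proof.
move=> f0; pose N := msize f.
pose w (m : 'X_{1..n}) := (\sum_(i < n) m i * N ^ i)%N.
have w_inj m m' : m \in msupp f -> m' \in msupp f -> w m = w m' -> m = m'.
  move=> fm fm' E; apply/mnmP => i.
  have hd (l : 'X_{1..n}) j : l \in msupp f -> (l j < N)%N.
    move=> fl; apply: leq_ltn_trans (msize_mdeg_lt fl).
    by rewrite mdegE (bigD1 j) //= leq_addr.
  pose F (l : 'X_{1..n}) j := (if insub j is Some k then l k else 0)%N.
  have FE (l : 'X_{1..n}) (j : 'I_n) : F l j = l j by rewrite /F valK.
  rewrite -!FE; apply: (@digits_inj N n) => // [j lt_j|].
    by rewrite (FE m (Ordinal lt_j)) (FE m' (Ordinal lt_j)) !hd.
  by under eq_bigr do rewrite FE; under [RHS]eq_bigr do rewrite FE.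
pose q : {poly K} := \sum_(m <- msupp f) f@_m *: 'X^(w m).
have q0 : q != 0.
  have fm := mlead_supp f0; apply: contraNneq f0 => q0.
  rewrite -mleadc_eq0 -[0](coef0 _ (w (mlead f))) -q0 /q coef_sum.
  rewrite (bigD1_seq (mlead f)) ?msupp_uniq //= coefZ coefXn eqxx mulr1.
  rewrite big_seq_cond big1 ?addr0 // => m /andP[fm' ne].
  rewrite coefZ coefXn; case: eqP => [/(w_inj _ _ fm fm') E|]; last by rewrite mulr0.
  by rewrite E eqxx in ne.
have [t qt] := poly_nonroot q0; exists (\row_i t ^+ (N ^ i)).
rewrite /ev mevalE; apply: contraNneq qt => E; rewrite /q horner_sum -[X in _ == X]E.
apply/eqP/eq_bigr => m _; rewrite hornerZ hornerXn; congr (_ * _).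
by rewrite /w -prodrXr; apply: eq_bigr => i _; rewrite mxE -exprM mulnC.
Qed.

Definition lin (a : 'cV[K]_n) : S := \sum_i a i 0 *: 'X_i.

Lemma ev_lin v a : ev v (lin a) = (v *m a) 0 0.
Proof.
rewrite /lin rmorph_sum mxE; apply: eq_bigr => i _.
by rewrite /= /ev mevalZ mevalXU mulrC.
Qed.

Lemma dhomog_lin a : lin a \is 1.-homog.
Proof. by apply: rpred_sum => i _; rewrite dhomogZ // dhomogX /= mdeg1. Qed.

Lemma lin_eq0 a : (lin a == 0) = (a == 0).
Proof.
apply/eqP/eqP => [a0|->]; last by rewrite /lin big1 // => i _; rewrite mxE scale0r.
apply/matrixP => i j; rewrite ord1 [RHS]mxE.
have := ev_lin (delta_mx 0 i) a; rewrite a0 rmorph0 => ->.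
by rewrite -rowE mxE.
Qed.

Lemma lin_scale k a : lin (k *: a) = k *: lin a.
Proof. by rewrite /lin scaler_sumr; apply: eq_bigr => i _; rewrite mxE scalerA. Qed.

Definition van (a : 'cV[K]_n) (f : S) := forall v, v *m a = 0 -> ev v f = 0.

(* The substitution [v |-> v - (v a) u], a projection onto [ker a] when
   [u a = 1]. *)
Definition sbst (a : 'cV[K]_n) (u : 'rV[K]_n) : S -> S :=
  comp_mpoly [tuple 'X_i - u 0 i *: lin a | i < n].
HB.instance Definition _ a u := GRing.RMorphism.on (sbst a u).

Lemma ev_sbst a u v f : ev v (sbst a u f) = ev (v - v *m a *m u) f.
Proof.
rewrite /ev /sbst comp_mpoly_meval; apply: meval_eq => i.
rewrite tnth_mktuple mevalB mevalZ mevalXU -/(ev v _) ev_lin.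
by rewrite [RHS]mxE [X in _ = _ + X]mxE [X in _ = _ - X]mxE big_ord1 mulrC.
Qed.

Lemma sbst_lin a u b : sbst a u (lin b) = lin ((1%:M - a *m u) *m b).
Proof.
apply/eqP; rewrite -subr_eq0; apply/negPn/negP => /ev_neq0 [v].
rewrite rmorphB /= ev_sbst !ev_lin mulmxA mulmxBr mulmx1 mulmxA.
by rewrite subrr eqxx.
Qed.

(** The polynomials with this property are closed under sums and products and contain the constants
    and the variables, since each ['X_i] is moved by a multiple of [lin a]. *)
Lemma sbst_mod a u f : exists g, f = sbst a u f + lin a * g.
Proof.
pose P f := exists g, f = sbst a u f + lin a * g.
have PD f1 f2 : P f1 -> P f2 -> P (f1 + f2).
  move=> [g1 E1] [g2 E2]; exists (g1 + g2).
  by rewrite rmorphD {1}E1 {1}E2 mulrDr addrACA.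
have PM f1 f2 : P f1 -> P f2 -> P (f1 * f2).
  move=> [g1 E1] [g2 E2]; exists (g1 * f2 + sbst a u f1 * g2).
  rewrite rmorphM /=.
  have -> : f1 * f2 = sbst a u f1 * f2 + lin a * g1 * f2 by rewrite -mulrDl -E1.
  by rewrite {1}E2; ring.
have PC c : P c%:MP by exists 0; rewrite mulr0 addr0 /sbst comp_mpolyC.
have PX i : P 'X_i.
  exists (u 0 i)%:MP; rewrite /sbst comp_mpolyXU -tnth_nth tnth_mktuple.
  by rewrite mulrC mul_mpolyC subrK.
elim/mpolyind: f => [|c m f _ _ Pf]; first exact: (PC 0).
rewrite -mul_mpolyC; apply: (PD) => //; apply: (PM) => //.
rewrite mpolyXE_id; elim/big_ind: _ => [||i _]; [exact: (PC 1)|exact: PM|].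
elim: (m i) => [|k IH]; first exact: (PC 1).
by rewrite exprS; apply: PM.
Qed.

Lemma sbst_van a u f : u *m a = 1 -> van a f -> sbst a u f = 0.
Proof.
move=> ua fa; apply/eqP/negPn/negP => /ev_neq0 [v]; rewrite ev_sbst fa ?eqxx //.
by rewrite mulmxBl -[v *m a *m u *m a]mulmxA ua mulmx1 subrr.
Qed.

Lemma sbst_eq0 a u f : u *m a = 1 -> sbst a u f = 0 -> van a f.
Proof.
move=> ua f0 v va; have := ev_sbst a u v f.
by rewrite f0 rmorph0 va mul0mx subr0.
Qed.

Lemma vanP a f : a != 0 -> van a f -> exists g, f = lin a * g.
Proof.
move=> /dual_vector [u ua] fa; have [g E] := sbst_mod a u f.
by exists g; rewrite {1}E (sbst_van ua fa) add0r.
Qed.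

Lemma van_lin a f : van a (lin a * f).
Proof. by move=> v va; rewrite rmorphM /= ev_lin va mxE mul0r. Qed.

(** Vanishing on [ker a] amounts to being killed by the ring morphism [sbst a u], whose target is a
    domain. *)
Lemma van_prime a f g : a != 0 -> van a (f * g) -> van a f \/ van a g.
Proof.
move=> /dual_vector [u ua] /(sbst_van ua); rewrite rmorphM => /eqP.
by rewrite mulf_eq0 => /orP[/eqP/(sbst_eq0 ua)|/eqP/(sbst_eq0 ua)]; [left|right].
Qed.

Lemma dhomog_comp m (t : m.-tuple S) p (f : {mpoly K[m]}) :
  (forall i, tnth t i \is 1.-homog) -> f \is p.-homog -> f \mPo t \is p.-homog.
Proof.
move=> t1 /dhomogP fp; rewrite comp_mpolyEX big_seq; apply: rpred_sum => l fl.
rewrite dhomogZ // -(fp l fl) comp_mpolyX /= mdegE.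
have : forall r : seq 'I_m,
    \prod_(i <- r) tnth t i ^+ l i \is (\sum_(i <- r) l i)%N.-homog.
  elim=> [|i r IH]; first by rewrite !big_nil dhomog1.
  by rewrite !big_cons dhomogM // -[X in X.-homog]mul1n dhomogMn.
exact.
Qed.

Lemma dhomog_sbst a u p (f : S) : f \is p.-homog -> sbst a u f \is p.-homog.
Proof.
apply: dhomog_comp => i; rewrite tnth_mktuple.
by rewrite rpredB ?dhomogX /= ?mdeg1 // dhomogZ // dhomog_lin.
Qed.

Lemma dhomog_msizeE p (f : S) : f \is p.-homog -> f != 0 -> msize f = p.+1.
Proof.
by move=> /dhomogP fp f0; rewrite -mlead_deg // (fp _ (mlead_supp f0)).
Qed.

(** Sizes add up in a product over a domain, and a polynomial of size one is a constant. All degree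
    comparisons below go through this. *)
Lemma dhomog_dvd p q (f g h : S) : f \is p.-homog -> g \is q.-homog -> f != 0 ->
  f = g * h -> (q <= p)%N /\ (p = q -> exists c, h = c%:MP).
Proof.
move=> fp gq f0 E; have : g * h != 0 by rewrite -E.
rewrite mulf_eq0 => /norP [g0 h0].
have := msizeM g0 h0; rewrite -E (dhomog_msizeE fp f0) (dhomog_msizeE gq g0).
have := h0; rewrite -msize_poly_eq0 -lt0n.
case sh : (msize h) => [//|s] _; rewrite addSn /= addnS => -[->].
split=> [|/eqP]; first exact: leq_addr.
rewrite -{2}[q]addn0 eqn_add2l => /eqP s0.
by exists (h@_0); apply: msize1_polyC; rewrite sh s0.
Qed.

Lemma generic_off (L : seq 'cV[K]_n) (f : S) :
  f != 0 -> 0 \notin L -> exists v, ev v f != 0 /\ forall a, a \in L -> v *m a != 0.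
Proof.
move=> f0 L0; have [|v] := @ev_neq0 (f * \prod_(a <- L) lin a).
  rewrite mulf_neq0 // prodf_seq_neq0; apply/allP => a aL /=.
  by rewrite lin_eq0; apply: contraNneq L0 => <-.
rewrite rmorphM mulf_eq0 => /norP [fv]; rewrite rmorph_prod prodf_seq_neq0.
move=> /allP Lv; exists v; split=> // a /Lv /=; rewrite ev_lin.
by apply: contraNneq => ->; rewrite mxE.
Qed.
End Points.

(** * Saito's criterion *)

Section Products.
Variables (K : numFieldType) (n : nat).
Local Notation S := {mpoly K[n]}.

Lemma dhomog_bigM (I : eqType) (r : seq I) (F : I -> S) (d : I -> nat) :
  (forall i, i \in r -> F i \is (d i).-homog) ->
  \prod_(i <- r) F i \is (\sum_(i <- r) d i)%N.-homog.
Proof.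
elim: r => [|i r IH] H; first by rewrite !big_nil dhomog1.
rewrite !big_cons dhomogM ?H ?mem_head //; apply: IH => j jr.
by rewrite H // inE jr orbT.
Qed.

Lemma dhomog_det m (M : 'M[S]_m) (e : 'I_m -> nat) :
  (forall i j, M i j \is (e i).-homog) -> \det M \is (\sum_i e i)%N.-homog.
Proof.
move=> H; apply: rpred_sum => s _; rewrite rpredMsign.
by apply: dhomog_bigM => i _.
Qed.

(** The defining polynomial of the arrangement. *)
Definition prodQ (L : seq 'cV[K]_n) : S := \prod_(a <- L) lin a.

Lemma dhomog_prodQ L : prodQ L \is (size L).-homog.
Proof.
by rewrite -sum1_size; apply: dhomog_bigM => a _; apply: dhomog_lin.
Qed.

Lemma prodQ_neq0 L : 0 \notin L -> prodQ L != 0.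
Proof.
move=> L0; rewrite prodf_seq_neq0; apply/allP => a aL /=; rewrite lin_eq0.
by apply: contraNneq L0 => <-.
Qed.

Lemma van_lin_rp (a b : 'cV[K]_n) : a != 0 -> b != 0 -> van b (lin a) -> rp a = rp b.
Proof.
move=> a0 b0 H; apply: sub_ker => // v vb; apply/matrixP => i j.
by rewrite !ord1 -ev_lin H // mxE.
Qed.

(** The forms are split off one at a time: after division by [lin a] the quotient still vanishes on
    the other kernels, because [lin a] is prime to their forms. *)
Lemma prodQ_dvd L f : arr L -> (forall a, a \in L -> van a f) ->
  exists g, f = prodQ L * g.
Proof.
elim: L f => [|a L IH] f; first by exists f; rewrite /prodQ big_nil mul1r.
rewrite arr_cons => /and3P [a0 aL arL] H.
have [g E] := vanP a0 (H _ (mem_head _ _)).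
have [b bL|h E'] := IH g arL; last by exists h; rewrite /prodQ big_cons -mulrA -E'.
have b0 : b != 0 by case/andP: arL => L0 _; apply: contraNneq L0 => <-.
have := H b; rewrite inE bL orbT E => /(_ isT) /(van_prime b0) [] //.
by move=> /(van_lin_rp a0 b0) E'; rewrite E' map_f in aL.
Qed.

Lemma coprime_pow_dvd (b : 'cV[K]_n) m (f g : S) : b != 0 -> ~ van b f ->
  (exists h, f * g = lin b ^+ m * h) -> exists h, g = lin b ^+ m * h.
Proof.
move=> b0 fb; elim: m => [|m IH] [h E]; first by exists g; rewrite mul1r.
have [|k Ek] := IH; first by exists (lin b * h); rewrite mulrA -exprSr.
have lb : lin b ^+ m != 0 by rewrite expf_neq0 // lin_eq0.
have E1 : f * k = lin b * h.
  by apply: (mulfI lb); rewrite [RHS]mulrA -exprSr -E Ek; ring.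
have [//|kb] : van b f \/ van b k by apply: van_prime; rewrite // E1; apply: van_lin.
by have [l El] := vanP b0 kb; exists l; rewrite Ek El exprSr mulrA.
Qed.

Lemma pow_prod_dvd (L : seq 'cV[K]_n) (m : 'cV[K]_n -> nat) (f : S) : arr L ->
  (forall b, b \in L -> exists h, f = lin b ^+ m b * h) ->
  exists h, f = (\prod_(b <- L) lin b ^+ m b) * h.
Proof.
elim: L f => [|a L IH] f; first by exists f; rewrite big_nil mul1r.
rewrite arr_cons => /and3P [a0 aL arL] H.
have [g E] := H _ (mem_head _ _).
have [b bL|h Eh] := IH g arL; last by exists h; rewrite big_cons -mulrA -Eh.
have b0 : b != 0 by case/andP: arL => L0 _; apply: contraNneq L0 => <-.
apply: (@coprime_pow_dvd b (m b) (lin a ^+ m a)) => //; last first.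
  by rewrite -E; apply: H; rewrite inE bL orbT.
suff : ~ van b (lin a).
  by elim: (m a) => [|k IHk] ab;
    [move=> /(_ 0 (mul0mx _ _)); rewrite rmorph1 => /eqP; rewrite oner_eq0|
     rewrite exprS => /(van_prime b0) [/ab|/(IHk ab)]].
by move=> /(van_lin_rp a0 b0) E'; rewrite E' map_f in aL.
Qed.
End Products.

Section Derivations.
Variables (K : numFieldType) (n : nat).
Local Notation S := {mpoly K[n]}.

Definition evm (v : 'rV[K]_n) p q (M : 'M[S]_(p, q)) : 'M[K]_(p, q) :=
  map_mx (ev v) M.

Lemma evm_mul v p q r (M : 'M[S]_(p, q)) (N : 'M[S]_(q, r)) :
  evm v (M *m N) = evm v M *m evm v N.
Proof. exact: map_mxM. Qed.

Lemma evm_add v p q (M N : 'M[S]_(p, q)) : evm v (M + N) = evm v M + evm v N.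
Proof. exact: map_mxD. Qed.

Lemma evm_row v p q (M : 'M[S]_(p, q)) i : evm v (row i M) = row i (evm v M).
Proof. by apply/matrixP => k l; rewrite !mxE. Qed.

Lemma evm_col v p1 p2 q (M : 'M[S]_(p1, q)) (N : 'M[S]_(p2, q)) :
  evm v (col_mx M N) = col_mx (evm v M) (evm v N).
Proof. exact: map_col_mx. Qed.

Definition cstm p q (A : 'M[K]_(p, q)) : 'M[S]_(p, q) := map_mx (@mpolyC n K) A.

Lemma evm_cstm v p q (A : 'M[K]_(p, q)) : evm v (cstm A) = A.
Proof. by apply/matrixP => i j; rewrite !mxE /ev mevalC. Qed.

Definition dv (th : 'rV[S]_n) (a : 'cV[K]_n) : S := (th *m cstm a) 0 0.

Lemma ev_dv v th a : ev v (dv th a) = (evm v th *m a) 0 0.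
Proof. by rewrite -[a in RHS](evm_cstm v) -evm_mul [RHS]mxE. Qed.

Definition vhomog p m (th : 'rV[{mpoly K[m]}]_n) := forall j, th 0 j \is p.-homog.

Lemma dhomog_dv p th a : vhomog p th -> dv th a \is p.-homog.
Proof.
move=> H; rewrite /dv mxE; apply: rpred_sum => j _.
by rewrite !mxE mulrC mul_mpolyC dhomogZ.
Qed.

(** Tangency to each hyperplane, tested at points; [logderE] identifies it with divisibility of
    [th (a)] by [a]. *)
Definition logd (L : seq 'cV[K]_n) (th : 'rV[S]_n) :=
  forall a, a \in L -> forall v, v *m a = 0 -> evm v th *m a = 0.

Definition hfam L m (M : 'M[S]_(m, n)) (e : nat -> nat) :=
  forall i : 'I_m, logd L (row i M) /\ vhomog (e i) (row i M).

(** The hypotheses of Saito's criterion. The degree bound is one-sided since the reverse inequality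
    follows from [prodQ L] dividing the determinant. The equation [m = n] is propositional so that
    [m] may be a sum of block sizes. *)
Definition saito L m (M : 'M[S]_(m, n)) (e : nat -> nat) :=
  [/\ m = n, hfam L M e, exists v, row_free (evm v M)
    & (\sum_(i < m) e i <= size L)%N].

Lemma det_singular (A : 'M[K]_n) (a : 'cV_n) : a != 0 -> A *m a = 0 -> \det A = 0.
Proof.
move=> a0 Aa; apply/eqP; rewrite -det_tr; apply/det0P; exists a^T.
  by rewrite trmx_eq0.
by rewrite -trmx_mul Aa trmx0.
Qed.

Lemma det_evm v (M : 'M[S]_n) : \det (evm v M) = ev v (\det M).
Proof. exact: det_map_mx. Qed.

Lemma logd_det L (M : 'M[S]_n) a : 0 \notin L -> (forall i, logd L (row i M)) ->
  a \in L -> van a (\det M).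
Proof.
move=> L0 H aL v va; rewrite -det_evm (@det_singular _ a) //.
  by apply: contraNneq L0 => <-.
apply/row_matrixP => i; rewrite row_mul -evm_row H // row0 //.
Qed.

(** On each hyperplane the fields are tangent, so the determinant vanishes there and is divisible by
    [prodQ L]; the degree bound leaves only a constant quotient. *)
Lemma saito_det L (M : 'M[S]_n) e : arr L -> saito L M e ->
  [/\ exists2 c, c != 0 & \det M = c%:MP * prodQ L, \det M != 0
    & (\sum_(i < n) e i)%N = size L].
Proof.
move=> arL [_ HM [v Mv] le]; have [L0 _] := andP arL.
have D0 : \det M != 0.
  apply/negP => /eqP D0; move: Mv; rewrite row_free_unit unitmxE det_evm D0.
  by rewrite rmorph0 unitr0.
have [g E] := prodQ_dvd arL (fun a => @logd_det L M a L0 (fun i => (HM i).1)).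
have Dh : \det M \is (\sum_(i < n) e i)%N.-homog.
  by apply: dhomog_det => i j; have [_ /(_ j)] := HM i; rewrite mxE.
have [ge H] := dhomog_dvd Dh (dhomog_prodQ L) D0 E.
have eqL : (\sum_(i < n) e i)%N = size L by apply/eqP; rewrite eqn_leq le ge.
split=> //; have [c Ec] := H eqL; exists c; last by rewrite E Ec mulrC.
by apply: contraNneq D0 => c0; rewrite E Ec c0 mulr0.
Qed.

Lemma saito_free L m (M : 'M[S]_(m, n)) e v : arr L -> saito L M e ->
  (forall a, a \in L -> v *m a != 0) -> row_free (evm v M).
Proof.
move=> arL sM vL; have [mn _ _ _] := sM; subst m.
have [[c c0 E] _ _] := saito_det arL sM.
rewrite row_free_unit unitmxE det_evm E rmorphM /= unitfE mulf_neq0 //.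
  by rewrite /ev mevalC.
rewrite rmorph_prod prodf_seq_neq0; apply/allP => a /vL /=; rewrite ev_lin.
apply: contraNN => /eqP E0; apply/eqP/matrixP => i j; rewrite !ord1 E0 mxE //.
Qed.

(** Cramer's rule: the [i]-th coefficient is the quotient of [\det (Mi i)], where [th] replaces row
    [i], by [\det M]. The numerator is again divisible by [prodQ L] and has degree
    [size L - e i + p], so it vanishes for [p < e i] and gives a constant for [p = e i]. *)
Lemma saito_coef L m (M : 'M[S]_(m, n)) e (th : 'rV[S]_n) :
  arr L -> saito L M e -> logd L th ->
  exists2 c : 'rV[S]_m, th = c *m M &
    forall p, vhomog p th -> forall i : 'I_m,
      ((p < e i)%N -> c 0 i = 0) /\ (p = e i -> exists k, c 0 i = k%:MP).
Proof.
move=> arL sM Hth; have [mn HM _ _] := sM; subst m.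
have [[c c0 E] D0 eL] := saito_det arL sM; have [L0 _] := andP arL.
pose Mi i : 'M[S]_n := \matrix_(k, j) (if k == i then th 0 j else M k j).
have rowM i k : row k (Mi i) = if k == i then th else row k M.
  by apply/rowP => j; rewrite !mxE; case: eqP => _; rewrite ?mxE // ord1.
have HMi i : exists g, \det (Mi i) = prodQ L * g.
  apply: prodQ_dvd => // a aL; apply: (logd_det L0) aL => k.
  by rewrite rowM; case: eqP => _ //; have [] := HM k.
have [g Hg] : exists g : 'I_n -> S, forall i, \det (Mi i) = prodQ L * g i.
  by apply: (fin_all_exists HMi).
have adj i : (th *m \adj M) 0 i = \det (Mi i).
  rewrite (expand_det_row _ i) mxE; apply: eq_bigr => j _; rewrite !mxE eqxx.
  congr (_ * _); rewrite /cofactor; congr (_ * \det _).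
  apply/matrixP => k l; rewrite !mxE; case: eqP => // /eqP.
  by rewrite eq_sym (negbTE (neq_lift _ _)).
pose cc := c^-1%:MP *: (\row_i g i).
have Q0 := prodQ_neq0 L0.
have ccE : th = cc *m M.
  have D : \det M *: th = prodQ L *: ((\row_i g i) *m M).
    rewrite -mul_mx_scalar -mul_adj_mx mulmxA scalemxAl; congr (_ *m _).
    by apply/rowP => i; rewrite adj Hg !mxE.
  have cQ : c%:MP * prodQ L != 0 by rewrite -E.
  apply/rowP => j; apply: (mulfI cQ); move/rowP/(_ j): D.
  rewrite E [LHS]mxE => ->; rewrite /cc -scalemxAl !mxE mulrACA -mpolyCM mulfV //.
  by rewrite mul1r.
exists cc => // p ph i; rewrite !mxE.
have Dh : \det (Mi i) \is (\sum_(k < n | k != i) e k + p)%N.-homog.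
  pose e' k := if k == i then p else e k.
  rewrite (_ : (_ + p)%N = \sum_k e' k)%N; last first.
    rewrite [RHS](bigD1 i) //= addnC /e' eqxx; congr (_ + _)%N.
    by apply: eq_bigr => k /negbTE ->.
  apply: dhomog_det => k j; rewrite mxE /e'; case: eqP => _; first exact: ph.
  by have [_ /(_ j)] := HM k; rewrite mxE.
have [g0|g0] := eqVneq (g i) 0.
  by rewrite g0 mulr0; split=> // _; exists 0.
have Di0 : \det (Mi i) != 0 by rewrite Hg mulf_neq0.
have [le H] := dhomog_dvd Dh (dhomog_prodQ L) Di0 (Hg i).
have sumE : (\sum_(k < n | k != i) e k + e i = size L)%N.
  by rewrite -eL [RHS](bigD1 i) //= addnC.
split=> [lt|pE]; first by move: le; rewrite -sumE leq_add2l leqNgt lt.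
have [k Ek] := H (etrans (congr1 _ pE) sumE).
by exists (c^-1 * k); rewrite Ek -mpolyCM.
Qed.

Lemma saito_indep L m (M : 'M[S]_(m, n)) e (c : 'rV[S]_m) :
  arr L -> saito L M e -> c *m M = 0 -> c = 0.
Proof.
move=> arL sM cM; have [mn HM _ _] := sM; subst m.
have [_ D0 _] := saito_det arL sM.
have : \det M *: c = 0 by rewrite -mul_mx_scalar -mul_mx_adj mulmxA cM mul0mx.
by move=> /eqP; rewrite scalemx_eq0 (negbTE D0) => /eqP.
Qed.
End Derivations.

(** * Terao's lemma *)

(** The left side is the degree of Terao's polynomial when [s] lists the traces with repetition; the
    right side is the number of hyperplanes lost. *)
Lemma sum_count_undup (T : eqType) (s : seq T) :
  (\sum_(b <- undup s) (count_mem b s).-1 = size s - size (undup s))%N.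
Proof.
have E : (\sum_(b <- undup s) count_mem b s = size s)%N.
  have := perm_size (perm_count_undup s); rewrite size_flatten /shape -map_comp sumnE big_map => <-.
  by apply: eq_bigr => b _; rewrite /= size_nseq.
rewrite -{1}E -sum1_size; apply/eqP; rewrite -(eqn_add2r (\sum_(i <- undup s) 1)).
rewrite subnK; last by rewrite E sum1_size size_undup.
rewrite -big_split /= big_seq [X in _ == X]big_seq; apply/eqP/eq_bigr => b.
by rewrite mem_undup -has_pred1 has_count addn1; case: (count_mem _ _).
Qed.

Section Terao.
Variables (K : numFieldType) (n : nat).
Local Notation S := {mpoly K[n]}.

Lemma sub_arr (L1 L2 : seq 'cV[K]_n) : subseq L1 L2 -> arr L2 -> arr L1.
Proof.
move=> sub /andP [L0 Lu]; apply/andP; split.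
  by apply: contra L0; apply: mem_subseq.
exact: subseq_uniq (map_subseq _ sub) Lu.
Qed.

(** The expression is alternating in [k] and [a], so replacing [k] by [k' = c k + y a] only
    multiplies it by [c]; for [k'] both terms vanish on [ker k']. *)
Lemma class_van (L : seq 'cV[K]_n) (a : 'cV_n) u k k' th : u *m a = 1 ->
  logd L th -> k' \in L ->
  rp ((1%:M - a *m u) *m k') = rp ((1%:M - a *m u) *m k) ->
  van k' (lin a * dv th k - lin k * dv th a).
Proof.
move=> ua Hth k'L /rp_eqE [c c0]; rewrite !mulmxBl !mul1mx => E v vk'.
have {}E : k' = c *: k + ((u *m k') 0 0 - c * (u *m k) 0 0) *: a.
  move/eqP: E; rewrite subr_eq => /eqP {1}->.
  rewrite scalerBr -!mulmxA [u *m k]mx11_scalar [u *m k' in LHS]mx11_scalar.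
  by rewrite !mul_mx_scalar scalerBl scalerA !mxE eqxx !mulr1n addrAC addrA.
set y := _ - _ in E.
have lc (w : 'rV_n) : (w *m k') 0 0 = c * (w *m k) 0 0 + y * (w *m a) 0 0.
  by rewrite E mulmxDr -!scalemxAr [LHS]mxE [X in X + _]mxE [X in _ + X]mxE.
have E1 := lc v; have E2 := lc (evm v th).
rewrite vk' mxE in E1; rewrite (Hth _ k'L _ vk') mxE in E2.
rewrite rmorphB !rmorphM /= !ev_lin !ev_dv; apply: (mulfI c0); rewrite mulr0.
move: E1 E2; set va := (v *m a) 0 0; set vk := (v *m k) 0 0.
set ta := (_ *m a) 0 0; set tk := (_ *m k) 0 0 => E1 E2.
have -> : c * (va * tk - vk * ta) = va * (c * tk + y * ta) - ta * (c * vk + y * va) by ring.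
by rewrite -E1 -E2 !mulr0 subrr.
Qed.

(* [B] is Terao's polynomial [Q(A') / prod_Y alpha_{H_Y}], restricted to
   [ker a]. *)
Lemma terao (L : seq 'cV[K]_n) (a : 'cV_n) u : arr L -> u *m a = 1 ->
  rp a \notin map (@rp K n) L ->
  exists B : S, B \is (size L - cnt L (1%:M - a *m u)).-homog /\
    forall th, logd L th -> exists g, sbst a u (dv th a) = B * g.
Proof.
move=> arL ua aL; set P := 1%:M - a *m u.
have Pk k : k \in L -> P *m k != 0.
  move=> kL; apply: contraNneq aL; rewrite mulmxBl mul1mx => /eqP.
  rewrite subr_eq0 -mulmxA [u *m k]mx11_scalar mul_mx_scalar => /eqP E.
  apply/mapP; exists k => //; apply/rp_eqE.
  have k0 : k != 0 by case/andP: arL => L0 _; apply: contraNneq L0 => <-.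
  have c0 : (u *m k) 0 0 != 0 by apply: contraNneq k0 => c0; rewrite E c0 scale0r.
  exists ((u *m k) 0 0)^-1; first by rewrite invr_eq0.
  by rewrite {2}E scalerA mulVf // scale1r.
pose s := [seq rp (P *m k) | k <- L].
have trE : traces L P = undup s.
  by rewrite /traces (_ : filter _ _ = L) //; apply/all_filterP/allP.
exists (\prod_(b <- undup s) lin b ^+ (count_mem b s).-1); split.
  rewrite /cnt trE -(size_map (fun k => rp (P *m k)) L) -/s -sum_count_undup.
  by apply: dhomog_bigM => b _; rewrite -[X in X.-homog]mul1n dhomogMn // dhomog_lin.
move=> th Hth; apply: pow_prod_dvd; first by rewrite -trE arr_traces.
move=> b; rewrite mem_undup => /mapP [k kL Eb].
pose cl := [seq k' <- L | rp (P *m k') == b].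
have arcl : arr cl by apply: sub_arr arL; apply: filter_subseq.
have [k' |g Eg] := @prodQ_dvd _ _ cl (lin a * dv th k - lin k * dv th a) arcl.
  rewrite mem_filter => /andP [/eqP E k'L]; apply: (class_van ua Hth k'L).
  by rewrite -/P E Eb.
(* Restriction to [ker a] kills [lin a] and turns every form of [cl], as well as [lin k], into a
   nonzero multiple of [lin b]. So [lin b] times the restriction of [th (a)] is divisible by
   [lin b ^+ size cl], and one factor cancels. *)
have {}Eg := congr1 (sbst a u) Eg; move: Eg.
have sa : sbst a u (lin a) = 0.
  by apply/eqP; rewrite sbst_lin lin_eq0 mulmxBl mul1mx -mulmxA ua mulmx1 subrr.
rewrite rmorphB !rmorphM /= sa mul0r sub0r sbst_lin -/P.
have [c c0 Ek] := rpE (P *m k); rewrite -Eb in Ek; rewrite Ek lin_scale.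
have [d d0 ->] : exists2 d, d != 0 & sbst a u (prodQ cl) = d *: lin b ^+ size cl.
  have: all (fun k' => rp (P *m k') == b) cl by apply: filter_all.
  rewrite /prodQ; elim: (cl) => [|k' r IH] /= => [_|/andP [/eqP E /IH [d d0 Ed]]].
    by exists 1; rewrite ?oner_neq0 // big_nil rmorph1 scale1r.
  have [c' c'0 Ek'] := rpE (P *m k'); exists (c' * d); first by rewrite mulf_neq0.
  rewrite big_cons rmorphM /= Ed sbst_lin -/P Ek' E lin_scale exprS.
  by rewrite -scalerAl -scalerAr scalerA.
have -> : size cl = count_mem b s by rewrite size_filter count_map.
have : (0 < count_mem b s)%N by rewrite -has_count has_pred1 Eb; apply: map_f.
case: (count_mem b s) => [//|m] _ /= E.
have lb : lin b != 0.
  by rewrite lin_eq0 Eb rp_eq0 Pk.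
exists (- (c^-1 * d) *: sbst a u g); apply: (mulfI lb).
rewrite mulrCA mulrA -exprSr -scalerAr; move: E.
rewrite -!scalerAl => /(congr1 (fun x => - c^-1 *: x)).
by rewrite scalerN scaleNr opprK scalerA mulVf // scale1r => ->; rewrite scalerA mulNr.
Qed.
End Terao.

(** * Fields and forms on a subspace *)

Section Pullback.
Variables (K : numFieldType) (m n : nat) (A : 'M[K]_(m, n)).

Definition pull : {mpoly K[n]} -> {mpoly K[m]} :=
  comp_mpoly [tuple lin (col i A) | i < n].

Lemma ev_pull y f : ev y (pull f) = ev (y *m A) f.
Proof.
rewrite /ev comp_mpoly_meval; apply: meval_eq => i.
by rewrite tnth_mktuple -/(ev y _) ev_lin colE mulmxA -colE mxE.
Qed.

Lemma dhomog_pull p f : f \is p.-homog -> pull f \is p.-homog.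
Proof. by apply: dhomog_comp => i; rewrite tnth_mktuple dhomog_lin. Qed.

(* The vector fields [M] in the coordinates of the row space of [A], to which
   they are assumed tangent. *)
Definition pullM q (M : 'M[{mpoly K[n]}]_(q, n)) : 'M[{mpoly K[m]}]_(q, m) :=
  map_mx pull M *m cstm _ (pinvmx A).

Lemma evm_pullM q (M : 'M[{mpoly K[n]}]_(q, n)) y :
  evm y (pullM M) = evm (y *m A) M *m pinvmx A.
Proof.
rewrite /pullM evm_mul evm_cstm; congr (_ *m _).
by apply/matrixP => i j; rewrite !mxE ev_pull.
Qed.

Lemma row_pullM q (M : 'M[{mpoly K[n]}]_(q, n)) i : row i (pullM M) = pullM (row i M).
Proof. by rewrite /pullM row_mul map_row. Qed.

Lemma vhomog_pullM p th : vhomog p th -> vhomog p (pullM th).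
Proof.
move=> H j; rewrite /pullM mxE; apply: rpred_sum => i _.
by rewrite !mxE mulrC mul_mpolyC dhomogZ // dhomog_pull.
Qed.

Definition tangent (th : 'rV[{mpoly K[n]}]_n) :=
  forall x, (x <= A)%MS -> (evm x th <= A)%MS.

Lemma evm_pullMK th y : tangent th -> evm y (pullM th) *m A = evm (y *m A) th.
Proof. by move=> tth; rewrite evm_pullM mulmxKpV // tth // submxMl. Qed.

Lemma logd_pull (L : seq 'cV[K]_n) th : tangent th ->
  (forall a, a \in L -> forall x, (x <= A)%MS -> x *m a = 0 -> evm x th *m a = 0) ->
  logd (traces L A) (pullM th).
Proof.
move=> tth H b; rewrite mem_undup => /mapP [a]; rewrite mem_filter => /andP [_ aL] -> y.
have [k k0 ] := rpE (A *m a); set r := rp _ => E yb.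
have yA : y *m A *m a = 0 by rewrite -mulmxA E -scalemxAr yb scaler0.
have := H a aL _ (submxMl _ _) yA; rewrite -evm_pullMK // -mulmxA E -scalemxAr.
by move=> /eqP; rewrite scalemx_eq0 (negbTE k0) => /eqP.
Qed.

(** Terao's polynomial for the traces on [A] and the hyperplane cut out by [a] has degree at least
    [cnt L A - cnt L A2]. It divides the restriction of [th (a)] to [A2], which has degree [p] and
    is nonzero because of the point [x]. *)
Lemma terao_rel m2 (A2 : 'M[K]_(m2, n)) (L : seq 'cV[K]_n) (a : 'cV_n) th p :
  vhomog p th -> tangent th ->
  (forall a, a \in L -> forall x, (x <= A)%MS -> x *m a = 0 -> evm x th *m a = 0) ->
  A *m a != 0 ->
  (forall b, b \in L -> A *m b != 0 -> rp (A *m b) <> rp (A *m a)) ->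
  (exists x, [/\ (x <= A)%MS, x *m a = 0 & evm x th *m a != 0]) ->
  (A2 <= A)%MS -> A2 *m a = 0 ->
  (forall x : 'rV_n, (x <= A)%MS -> x *m a = 0 -> (x <= A2)%MS) ->
  (cnt L A <= p + cnt L A2)%N.
Proof.
move=> ph tth H Aa0 npr [x [/submxP [y ->] ya xa]] A2A A2a AA2.
have [u ua] := dual_vector Aa0; set P := 1%:M - A *m a *m u.
have [|B [Bh HB]] := terao (arr_traces L A) ua.
  apply/mapP => -[b]; rewrite mem_undup => /mapP [c].
  rewrite mem_filter => /andP [c0 cL] -> /esym; rewrite rp_id; exact: npr.
have [g E] := HB _ (logd_pull tth H).
have sh : sbst (A *m a) u (dv (pullM th) (A *m a)) \is p.-homog.
  by apply: dhomog_sbst; apply: dhomog_dv; apply: vhomog_pullM.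
have s0 : sbst (A *m a) u (dv (pullM th) (A *m a)) != 0.
  apply: contraNneq xa => /(congr1 (ev y)); rewrite ev_sbst rmorph0.
  rewrite mulmxA ya mul0mx subr0 ev_dv mulmxA evm_pullMK // => E0.
  by apply/eqP/matrixP => i j; rewrite !ord1 E0 mxE.
have [le _] := dhomog_dvd sh Bh s0 E.
rewrite addnC -leq_subLR; apply: leq_trans le; rewrite leq_sub2l //.
have le1 : (cnt (traces L A) P <= cnt L (P *m A))%N.
  apply: uniq_leq_size; first exact: undup_uniq.
  move=> c; rewrite !mem_undup => /mapP [b]; rewrite mem_filter mem_undup.
  move=> /andP [Pb /mapP [d]]; rewrite mem_filter => /andP [d0 dL] Eb ->.
  have Er : rp (P *m b) = rp (P *m A *m d) by rewrite -mulmxA Eb; apply: rp_mul; rewrite rp_id.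
  rewrite Er; apply/mapP; exists d; rewrite // mem_filter dL andbT.
  by rewrite -rp_eq0 -Er rp_eq0.
apply: leq_trans le1 _; apply: cnt_le => //; last first.
  apply/row_subP => i; apply: AA2; first by rewrite row_mul submxMl.
  rewrite -row_mul mulmxBl mul1mx mulmxBl -!mulmxA ua mulmx1.
  by rewrite subrr row0.
have /submxP [D ED] := A2A; rewrite ED; move: A2a; rewrite ED -mulmxA => Da.
have -> : D *m A = D *m P *m A.
  by rewrite mulmxBr mulmx1 [D *m (_ *m _)]mulmxA Da mul0mx subr0.
by rewrite -mulmxA submxMl.
Qed.
End Pullback.

(** * Multiple addition *)

Section Free.
Variable K : fieldType.

Lemma row_free_col m1 m2 n (A : 'M[K]_(m1, n)) (B : 'M[K]_(m2, n)) u v :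
  row_free (col_mx A B) -> u *m A + v *m B = 0 :> 'rV_n -> u = 0 /\ v = 0.
Proof.
move=> free; rewrite -mul_row_col => /eqP; rewrite mulmx_free_eq0 // => /eqP.
by rewrite -[0](@hsubmxK _ 1 m1 m2) !linear0 => /eq_row_mx.
Qed.

Lemma row_free_colP m1 m2 n (A : 'M[K]_(m1, n)) (B : 'M[K]_(m2, n)) :
  (forall u v, u *m A + v *m B = 0 :> 'rV_n -> u = 0 /\ v = 0) -> row_free (col_mx A B).
Proof.
move=> H; apply: inj_row_free => w; rewrite -[w]hsubmxK mul_row_col.
by move=> /H [-> ->]; rewrite row_mx0.
Qed.

Lemma row_free_l m1 m2 n (A : 'M[K]_(m1, n)) (B : 'M[K]_(m2, n)) :
  row_free (col_mx A B) -> row_free A.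
Proof.
move=> free; apply: inj_row_free => u uA.
by have [] := @row_free_col _ _ _ _ _ u 0 free; rewrite ?uA ?mul0mx ?addr0.
Qed.

Lemma exists_free m n (A : 'M[K]_(m, n)) r : \rank A = r ->
  exists B : 'M_(r, n), row_free B /\ (B :=: A)%MS.
Proof.
by move=> <-; exists (row_base A); split; [exact: row_base_free|exact: eq_row_base].
Qed.
End Free.

Section MATCore.
Variables (K : numFieldType) (n : nat).
Local Notation S := {mpoly K[n]}.

Lemma hfam_row L m (M : 'M[S]_(m, n)) e : hfam L M e ->
  forall (a : 'cV_n) v, a \in L -> v *m a = 0 -> evm v M *m a = 0.
Proof.
move=> HM a v aL va; apply/row_matrixP => i; rewrite row_mul -evm_row row0.
by have [H _] := HM i; apply: H.
Qed.

Lemma proj_ker (a : 'cV[K]_n) u : u *m a = 1 -> (1%:M - a *m u :=: kermx a)%MS.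
Proof.
move=> ua; apply/eqmxP/andP; split.
  by apply/sub_kermxP; rewrite mulmxBl mul1mx -mulmxA ua mulmx1 subrr.
apply/submxP; exists (kermx a).
by rewrite mulmxBr mulmx1 mulmxA mulmx_ker mul0mx subr0.
Qed.

Lemma hfamP L m (M : 'M[S]_(m, n)) (e : nat -> nat) :
  (forall a, a \in L -> forall v, v *m a = 0 -> evm v M *m a = 0) ->
  (forall i j, M i j \is (e i).-homog) -> hfam L M e.
Proof.
move=> H1 H2 i; split=> [a aL v va|j]; last by rewrite mxE.
by rewrite evm_row -row_mul H1 // row0.
Qed.

Definition cols q (a : 'M[K]_(n, q)) : seq 'cV[K]_n := [seq col j a | j <- enum 'I_q].

Lemma col_cols q (a : 'M[K]_(n, q)) j : col j a \in cols a.
Proof. by apply: map_f; rewrite mem_enum. Qed.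

Lemma colsP q (a : 'M[K]_(n, q)) b : reflect (exists j, b = col j a) (b \in cols a).
Proof.
by apply: (iffP mapP) => [[j _ ->]|[j ->]]; exists j; rewrite ?mem_enum.
Qed.

Lemma mul_cols q (a : 'M[K]_(n, q)) m (A : 'M_(m, n)) :
  (forall j, A *m col j a = 0) -> A *m a = 0.
Proof.
move=> H; apply/matrixP => i j; have /matrixP /(_ i 0) := H j.
by rewrite !colE mulmxA -colE !mxE => ->.
Qed.

Lemma mul_col0 q (a : 'M[K]_(n, q)) m (A : 'M_(m, n)) j :
  A *m a = 0 -> A *m col j a = 0.
Proof. by rewrite colE mulmxA => ->; rewrite mul0mx. Qed.

(* Multiple addition: the fields of degree less than [d] stay logarithmic by
   Terao's lemma, those of degree [d] satisfy [th (a_j) = c_j B_j] on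
   [ker a_j], and evaluating at [x0] shows that [(c_ij)] has rank [q]. *)
Lemma multiple_addition (L : seq 'cV[K]_n) q (a : 'M[K]_(n, q)) m1 p
    (T : 'M[S]_(m1, n)) (F : 'M[S]_(p, n)) e d (x0 : 'rV[K]_n) :
  arr L -> saito L (col_mx T F) e ->
  (forall i, i < m1 -> e i < d)%N ->
  (forall i, m1 <= i < m1 + p -> e i = d)%N ->
  \rank a = q -> x0 *m a = 0 -> (forall b, b \in L -> x0 *m b != 0) ->
  (forall j, cnt L (kermx (col j a)) + d <= size L)%N ->
  exists p0, exists T1 : 'M[S]_(m1 + p0, n), exists F1 : 'M[S]_(q, n),
  [/\ (p = p0 + q)%N, hfam (L ++ cols a) T1 e, hfam L F1 (fun => d),
      row_free (evm x0 (col_mx T1 F1))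
    & forall i j v, i != j -> v *m col i a = 0 ->
        evm v (row j F1) *m col i a = 0].
Proof.
move=> arL sM ltd eqd ra x0a x0L Hcnt.
have [mn HM _ _] := sM.
have a0 j : col j a != 0.
  apply/negP => /eqP aj0; have : (row_free a^T) by rewrite /row_free mxrank_tr ra.
  move=> /(mulmx_free_eq0 (delta_mx 0 j : 'rV_q)).
  rewrite -rowE -tr_col aj0 trmx0 eqxx => /esym/eqP/matrixP/(_ 0 j).
  by rewrite !mxE !eqxx => /eqP; rewrite oner_eq0.
have [u ua] : exists u : 'I_q -> 'rV[K]_n, forall j, u j *m col j a = 1.
  by apply: (fin_all_exists (fun j => dual_vector (a0 j))).
have [B HB] : exists B : 'I_q -> S, forall j,
    B j \is (size L - cnt L (kermx (col j a))).-homog /\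
    forall th, logd L th -> exists g, sbst (col j a) (u j) (dv th (col j a)) = B j * g.
  apply: (@fin_all_exists _ _ (fun j (Bj : S) =>
    Bj \is (size L - cnt L (kermx (col j a))).-homog /\
    forall th, logd L th -> exists g, sbst (col j a) (u j) (dv th (col j a)) = Bj * g)) => j.
  (* [x0] kills every new form and no old one, so [col j a] is not proportional to a form in [L]. *)
  have [|B [B1 B2]] := terao arL (ua j).
    apply/mapP => -[b bL /esym/rp_eqE [c c0 Eb]].
    by have := x0L b bL; rewrite Eb -scalemxAr mul_col0 // scaler0 eqxx.
  by exists B; rewrite -(cnt_eq _ (proj_ker (ua j))).
have degB j : (d <= size L - cnt L (kermx (col j a)))%N.
  by rewrite leq_subRL ?(leq_trans (leq_addr _ _) (Hcnt j)).
have HMT (i : 'I_m1) : logd L (row i T) /\ vhomog (e i) (row i T).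
  by have := HM (lshift p i); rewrite -row_usubmx col_mxKu.
have HMF (i : 'I_p) : logd L (row i F) /\ vhomog d (row i F).
  have := HM (rshift m1 i); rewrite -row_dsubmx col_mxKd eqd //.
  by rewrite leq_addr ltn_add2l /=.
have TL (j : 'I_q) v : v *m col j a = 0 -> evm v T *m col j a = 0.
  move=> va; apply/row_matrixP => i; rewrite row_mul -evm_row row0.
  have [Hl Hh] := HMT i; have [g Eg] := (HB j).2 _ Hl.
  suff s0 : sbst (col j a) (u j) (dv (row i T) (col j a)) = 0.
    by apply/matrixP => k l; rewrite !ord1 -ev_dv (sbst_eq0 (ua j) s0) // mxE.
  apply/eqP/negPn/negP => n0.
  have [le _] := dhomog_dvd (dhomog_sbst _ _ (dhomog_dv _ Hh)) (HB j).1 n0 Eg.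
  by have := leq_trans (degB j) le; rewrite leqNgt ltd.
have [C HC] : exists C : 'I_p -> 'I_q -> K, forall k j v, v *m col j a = 0 ->
    (evm v (row k F) *m col j a) 0 0 = C k j * ev v (B j).
  apply: (@fin_all_exists _ _ (fun k (Ck : 'I_q -> K) => forall j v, v *m col j a = 0 ->
    (evm v (row k F) *m col j a) 0 0 = Ck j * ev v (B j))) => k.
  apply: (@fin_all_exists _ _ (fun j (Ckj : K) => forall v, v *m col j a = 0 ->
    (evm v (row k F) *m col j a) 0 0 = Ckj * ev v (B j))) => j.
  have [Hl Hh] := HMF k; have [g Eg] := (HB j).2 _ Hl.
  have [s0|s0] := eqVneq (sbst (col j a) (u j) (dv (row k F) (col j a))) 0.
    by exists 0 => v va; rewrite mul0r -ev_dv (sbst_eq0 (ua j) s0).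
  have [le H] := dhomog_dvd (dhomog_sbst _ _ (dhomog_dv _ Hh)) (HB j).1 s0 Eg.
  have [|c Ec] := H; first by apply/eqP; rewrite eqn_leq le degB.
  exists c => v va; have := congr1 (ev v) Eg.
  rewrite ev_sbst va mul0mx subr0 ev_dv => ->.
  by rewrite rmorphM Ec mulrC /= /ev mevalC.
pose Cm : 'M[K]_(p, q) := \matrix_(k, j) C k j.
have FE (j : 'I_q) v : v *m col j a = 0 -> evm v F *m col j a = ev v (B j) *: col j Cm.
  move=> va; apply/matrixP => k l; have := HC k j v va.
  by rewrite evm_row -row_mul mxE ord1 => ->; rewrite !mxE mulrC.
have free0 : row_free (evm x0 (col_mx T F)) by apply: saito_free sM _.
have rkC : \rank Cm = q.
  apply/eqP; rewrite eqn_leq rank_leq_col /=.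
  have full0 : row_full (evm x0 (col_mx T F)).
    by move: free0; rewrite /row_free /row_full => /eqP ->; rewrite mn.
  rewrite -{1}ra -(eqmxMfull a full0) evm_col mul_col_mx.
  have -> : evm x0 T *m a = 0.
    by apply: mul_cols => j; apply: TL; rewrite mul_col0.
  have -> : evm x0 F *m a = Cm *m diag_mx (\row_j ev x0 (B j)).
    apply/matrixP => k j; have := FE j x0 (mul_col0 _ x0a) => /matrixP /(_ k 0).
    by rewrite colE mulmxA -colE mxE mul_mx_diag !mxE mulrC.
  rewrite -addsmxE adds0mx; exact: mxrankM_maxl.
have [p0 Ep] : exists p0, p = (p0 + q)%N.
  by exists (p - q)%N; rewrite subnK // -rkC rank_leq_row.
have rkK : \rank (kermx Cm) = p0 by rewrite mxrank_ker rkC Ep addnK.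
have [K0 [K0free K0E]] := exists_free rkK.
have K0C : K0 *m Cm = 0 by apply/sub_kermxP; rewrite K0E.
have [Lm LmC] : exists Lm, Lm *m Cm = 1%:M by apply/row_fullP; rewrite /row_full rkC.
(* The left kernel [K0] of [Cm] gives fields tangent to all new hyperplanes; the rows of the left
   inverse [Lm] give fields dual to them, each transverse to one only. *)
exists p0, (col_mx T (cstm _ K0 *m F)), (cstm _ Lm *m F); split=> //.
- apply: hfamP => [b|i j].
    rewrite mem_cat => bL v vb; rewrite evm_col evm_mul evm_cstm mul_col_mx -mulmxA.
    case/orP: bL => [bL|/colsP [j Eb]].
      have := hfam_row HM bL vb; rewrite evm_col mul_col_mx => /eqP.
      by rewrite col_mx_eq0 => /andP [/eqP -> /eqP ->]; rewrite mulmx0 col_mx0.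
    rewrite Eb in vb *; rewrite TL // FE // -scalemxAr colE mulmxA K0C mul0mx scaler0.
    by rewrite col_mx0.
  rewrite mxE; case: split_ordP => k ->; first by have [_ /(_ j)] := HMT k; rewrite mxE.
  rewrite mxE; apply: rpred_sum => l _; rewrite mxE mul_mpolyC dhomogZ //.
  rewrite eqd /=; first by have [_ /(_ j)] := HMF l; rewrite mxE.
  by rewrite leq_addr ltn_add2l (leq_trans (ltn_ord k)) // Ep leq_addr.
- apply: hfamP => [b bL v vb|i j].
    rewrite evm_mul -mulmxA; have := hfam_row HM bL vb; rewrite evm_col mul_col_mx => /eqP.
    by rewrite col_mx_eq0 => /andP [_ /eqP ->]; rewrite mulmx0.
  rewrite mxE; apply: rpred_sum => l _; rewrite mxE mul_mpolyC dhomogZ //.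
  by have [_ /(_ j)] := HMF l; rewrite mxE.
- rewrite !evm_col !evm_mul !evm_cstm; apply: row_free_colP => w u3.
  rewrite -[w]hsubmxK mul_row_col; set u1 := lsubmx w; set u2 := rsubmx w.
  rewrite !mulmxA -addrA -mulmxDl evm_col in free0 * => /(row_free_col free0) [-> E].
  have u30 : u3 = 0.
    move: (congr1 (mulmx^~ Cm) E); rewrite mulmxDl -!mulmxA K0C LmC mulmx0 add0r.
    by rewrite mulmx1 mul0mx.
  move: E; rewrite u30 mul0mx addr0 => /eqP.
  by rewrite mulmx_free_eq0 // => /eqP ->; rewrite row_mx0.
- move=> i j v ij va; rewrite evm_row evm_mul evm_cstm -row_mul -mulmxA FE //.
  rewrite -scalemxAr colE mulmxA LmC mul1mx; apply/matrixP => k l.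
  by rewrite !mxE (eq_sym j) (negbTE ij) mulr0.
Qed.
End MATCore.

Lemma mul_colE (K : fieldType) p n q (A : 'M[K]_(p, n)) (a : 'M[K]_(n, q)) i j :
  (A *m col j a) i 0 = (A *m a) i j.
Proof. by rewrite colE mulmxA -colE mxE. Qed.

(** * Flats with enough traces *)

Section Good.
Variables (K : numFieldType) (n : nat).
Local Notation S := {mpoly K[n]}.

(* There is a flat [X], the common kernel of [J], of dimension [m1], on which
   the fields [U] are generically independent and which carries at least
   [e 0 + ... + e (m1 - 1)] traces of the arrangement. *)
Definition good (L : seq 'cV[K]_n) (e : nat -> nat) m1 (U : 'M[S]_(m1, n)) :=
  exists J : seq 'cV[K]_n, exists A : 'M[K]_(m1, n),
  [/\ {subset J <= L},
      exists x, (forall b, b \in J -> x *m b = 0) /\ row_free (evm x U),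
      row_free A,
      forall x : 'rV_n, (x <= A)%MS <-> (forall b, b \in J -> x *m b = 0)
    & (\sum_(i < m1) e i <= cnt L A)%N].

Lemma good_sub L1 L2 e1 e2 m1 (U : 'M[S]_(m1, n)) : {subset L1 <= L2} ->
  (forall i, i < m1 -> e1 i = e2 i)%N -> good L1 e1 U -> good L2 e2 U.
Proof.
move=> sub e12 [J [A [JL Hx Af AJ le]]]; exists J, A; split=> //.
  by move=> b /JL /sub.
rewrite (eq_bigr (fun i : 'I_m1 => e1 i)) => [|i _]; last by rewrite e12.
exact: leq_trans le (cnt_le sub (submx_refl _) (submx_refl _)).
Qed.

Lemma saito_assoc L m1 m2 m3 (A : 'M[S]_(m1, n)) (B : 'M[S]_(m2, n)) (C : 'M[S]_(m3, n)) e :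
  saito L (col_mx (col_mx A B) C) e -> saito L (col_mx A (col_mx B C)) e.
Proof. by rewrite col_mxA; case: _ / (esym (addnA m1 m2 m3)). Qed.
End Good.

(** * The addition step for flats *)

Section Step.
Variables (K : numFieldType) (n q m d : nat).
Local Notation S := {mpoly K[n]}.
Variables (L : seq 'cV[K]_n) (a : 'M[K]_(n, q)) (e : nat -> nat).
Variables (T : 'M[S]_(m, n)) (F : 'M[S]_(q, n)) (x0 : 'rV[K]_n).

Local Notation L' := (L ++ cols a).
Hypothesis mq : (m + q)%N = n.
Hypothesis arL' : arr L'.
Hypothesis HT : hfam L' T e.
Hypothesis HF : hfam L F (fun => d).
Hypothesis free0 : row_free (evm x0 (col_mx T F)).
Hypothesis HFa : forall i j v, i != j -> v *m col i a = 0 ->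
  evm v (row j F) *m col i a = 0.
Hypothesis ra : \rank a = q.
Hypothesis x0a : x0 *m a = 0.
Hypothesis x0L : forall b, b \in L -> x0 *m b != 0.
Hypothesis le_ed : forall i, (i < m -> e i <= d)%N.
Hypothesis eq_ed : forall i, (m <= i < n -> e i = d)%N.
Hypothesis sum_e : (\sum_(i < n) e i = size L)%N.

(** The last [q] exponents are equal to [d] and go up by one, as many as there are new
    hyperplanes. *)
Definition step_exp (i : nat) : nat := if (i < m)%N then e i else d.+1.
Local Notation e' := step_exp.

Lemma step_exp_lo i : (i < m)%N -> e' i = e i.
Proof. by rewrite /step_exp => ->. Qed.

Lemma step_exp_hi i : (m <= i)%N -> e' i = d.+1.
Proof. by rewrite /step_exp ltnNge => ->. Qed.

Let arL : arr L.
Proof. by apply: sub_arr arL'; rewrite -{1}[L]cats0 cat_subseq ?sub0seq. Qed.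

Let subL : {subset L <= L'}.
Proof. by move=> b bL; rewrite mem_cat bL. Qed.

Let colL j : col j a \in L'.
Proof. by rewrite mem_cat col_cols orbT. Qed.

Let size_L' : size L' = (size L + q)%N.
Proof. by rewrite size_cat size_map size_enum_ord. Qed.

Let dual : exists W, W *m a = 1%:M.
Proof. by apply/row_fullP; rewrite /row_full ra. Qed.

Lemma sum_block (f : nat -> nat) m1 m2 :
  (\sum_(i < m1 + m2) f i = \sum_(i < m1) f i + \sum_(i < m2) f (m1 + i))%N.
Proof. by rewrite big_split_ord. Qed.

Lemma sum_step : (\sum_(i < m) e i + q * d = size L)%N.
Proof.
rewrite -sum_e -mq sum_block; congr (_ + _)%N.
rewrite (eq_bigr (fun => d)); first by rewrite sum_nat_const card_ord.
by move=> i _; rewrite eq_ed // leq_addr -mq ltn_add2l /=.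
Qed.

(** Multiplication by its own form makes the [i]-th field tangent also to the one new hyperplane to
    which it is transverse. *)
Definition scaled : 'M[S]_(q, n) := \matrix_(i, j) (lin (col i a) * F i j).

Lemma evm_scaled v : evm v scaled = diag_mx (v *m a) *m evm v F.
Proof.
apply/matrixP => i j; rewrite mul_diag_mx !mxE rmorphM /= ev_lin.
by rewrite colE mulmxA -colE mxE mxE.
Qed.

Lemma saito_old (U : 'M[S]_(m, n)) : hfam L' U e ->
  (exists v, row_free (evm v (col_mx U F))) -> saito L (col_mx U F) e.
Proof.
move=> HU free; split=> //; last by rewrite mq sum_e.
apply: hfamP => [b bL v vb|i j].
  by rewrite evm_col mul_col_mx (hfam_row HF bL vb) (hfam_row HU (subL bL) vb) col_mx0.
rewrite mxE; case: split_ordP => k ->.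
  by have [_ /(_ j)] := HU k; rewrite mxE.
by rewrite eq_ed ?leq_addr -?mq ?ltn_add2l //=; have [_ /(_ j)] := HF k; rewrite mxE.
Qed.

Lemma saito_TF : saito L (col_mx T F) e.
Proof. by apply: saito_old HT _; exists x0. Qed.

Lemma off_a (v : 'rV[K]_n) : (forall b, b \in L' -> v *m b != 0) -> forall j, (v *m a) 0 j != 0.
Proof.
move=> vL j; apply: contraNN (vL _ (colL j)) => /eqP E.
by apply/eqP/matrixP => k l; rewrite !ord1 colE mulmxA -colE !mxE -[RHS]E mxE.
Qed.

Lemma diag_free (w : 'rV[K]_q) : (forall j, w 0 j != 0) -> row_free (diag_mx w).
Proof.
move=> w0; apply: inj_row_free => u; rewrite mul_mx_diag => /matrixP E.
apply/rowP => j; have /eqP := E 0 j; rewrite !mxE mulf_eq0 (negbTE (w0 j)) orbF.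
by move=> /eqP.
Qed.

Lemma exists_off : exists v : 'rV[K]_n, forall b, b \in L' -> v *m b != 0.
Proof.
have [|v [_ vL]] := @generic_off K n L' 1 (oner_neq0 _); last by exists v.
by case/andP: arL'.
Qed.

Lemma saito_new : saito L' (col_mx T scaled) e'.
Proof.
split=> //.
- apply: hfamP => [b bL v vb|i j].
    rewrite evm_col mul_col_mx (hfam_row HT bL vb) evm_scaled.
    rewrite (_ : _ *m b = 0) ?col_mx0 //.
    move: bL; rewrite mem_cat => /orP [bL|/colsP [j Eb]].
      by rewrite -mulmxA (hfam_row HF bL vb) mulmx0.
    rewrite {b}Eb in vb *; rewrite -mulmxA mul_diag_mx; apply/matrixP => k l.
    rewrite [LHS]mxE [RHS]mxE ord1; have [<-|kj] := eqVneq j k.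
      by rewrite -mul_colE vb mxE mul0r.
    have := HFa kj vb; rewrite evm_row -row_mul => /matrixP /(_ 0 0).
    by rewrite [LHS]mxE [RHS]mxE => ->; rewrite mulr0.
  rewrite /step_exp; case: (split_ordP i) => k ->; rewrite ?col_mxEu ?col_mxEd /=.
    by have [_ /(_ j)] := HT k; rewrite mxE.
  rewrite mxE -add1n dhomogM ?dhomog_lin //.
  by have [_ /(_ j)] := HF k; rewrite mxE.
- have [v vL] := exists_off; exists v.
  have vL1 b : b \in L -> v *m b != 0 by move/subL/vL.
  have := saito_free arL saito_TF vL1; rewrite !evm_col => free.
  apply: row_free_colP => u1 u2; rewrite evm_scaled mulmxA.
  move=> /(row_free_col free) [-> /eqP].
  by rewrite (mulmx_free_eq0 _ (diag_free (off_a vL))) => /eqP ->.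
- rewrite sum_block size_L' -sum_step -addnA -mulnSr.
  rewrite (eq_bigr (fun i : 'I_m => e i)) => [|i _]; last by rewrite step_exp_lo.
  rewrite leq_add2l (eq_bigr (fun => d.+1)) ?sum_nat_const ?card_ord //.
  by move=> i _; rewrite step_exp_hi ?leq_addr.
Qed.

(** The fields in [scaled] have degree [d.+1], too large to occur in [th]. *)
Lemma low_coef (th : 'rV[S]_n) p : logd L' th -> vhomog p th -> (p <= d)%N ->
  exists c, th = c *m T.
Proof.
move=> Hth ph pd; have [c E Hc] := saito_coef arL' saito_new Hth.
exists (lsubmx c); rewrite E -{1}[c]hsubmxK mul_row_col [X in _ + X](_ : _ = 0) ?addr0 //.
rewrite (_ : rsubmx c = 0) ?mul0mx //; apply/rowP => i; rewrite !mxE.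
by have [-> //] := Hc p ph (rshift m i); rewrite step_exp_hi ?ltnS ?leq_addr.
Qed.

Lemma low_coefs m1 (U : 'M[S]_(m1, n)) : hfam L' U e' -> (m1 <= m)%N ->
  exists G, U = G *m T.
Proof.
move=> HU m1m.
have [c Hc] : exists c : 'I_m1 -> 'rV[S]_m, forall i, row i U = c i *m T.
  apply: (@fin_all_exists _ _ (fun i ci => row i U = ci *m T)) => i.
  have [Hl Hh] := HU i; apply: low_coef Hl Hh _.
  have im := leq_trans (ltn_ord i) m1m.
  by rewrite step_exp_lo ?le_ed.
exists (\matrix_i c i); apply/row_matrixP => i.
by rewrite Hc row_mul rowK.
Qed.

(** By degree [U = G T], and [G] is invertible at [v] because [U] is independent there; so [U] may
    replace [T] beside [F]. This is how an arbitrary basis of the new arrangement yields one of the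
    old. *)
Lemma transfer m' (U : 'M[S]_(m', n)) : m' = m -> hfam L' U e' ->
  (exists2 v : 'rV[K]_n, (forall b, b \in L' -> v *m b != 0) & row_free (evm v U)) ->
  saito L (col_mx U F) e.
Proof.
move=> Em; subst m' => HU [v vL Uf]; have [G EG] := low_coefs HU (leqnn _).
have vL1 b : b \in L -> v *m b != 0 by move/subL/vL.
have := saito_free arL saito_TF vL1; rewrite !evm_col => free.
apply: saito_old.
  move=> i; have [Hl Hh] := HU i; split=> // j; move: (Hh j).
  by rewrite step_exp_lo.
exists v; rewrite evm_col; apply: row_free_colP => u1 u2; rewrite EG evm_mul mulmxA.
move=> /(row_free_col free) [E ->]; split=> //.
move: Uf; rewrite EG evm_mul => /(mulmx_free_eq0 u1).
by rewrite mulmxA E mul0mx eqxx => /esym/eqP.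
Qed.

Lemma hfam_l m1 m2 (N1 : 'M[S]_(m1, n)) (N2 : 'M[S]_(m2, n)) f :
  hfam L' (col_mx N1 N2) f -> hfam L' N1 f.
Proof. by move=> H i; have := H (lshift m2 i); rewrite -row_usubmx col_mxKu. Qed.

(** Fields from the top of [N2] complete [N1] to [m] fields, and [F] completes these to a basis of
    the old arrangement. The exponents of [N1] are unchanged, so a flat found there serves here
    too. *)
Lemma good_high m1 m2 (N1 : 'M[S]_(m1, n)) (N2 : 'M[S]_(m2, n)) : (m1 <= m)%N ->
  saito L' (col_mx N1 N2) e' ->
  (forall m2' (N2' : 'M[S]_(m2', n)), m2' = m2 -> saito L (col_mx N1 N2') e -> good L e N1) ->
  good L' e' N1.
Proof.
move=> m1m sN H; have [mn HN _ _] := sN.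
have [m3 Em2] : exists m3, m2 = (m3 + q)%N by exists (m2 - q)%N; lia.
subst m2; suff : good L e N1.
  by apply: good_sub => // i im1; rewrite step_exp_lo // (leq_trans im1).
apply: (H _ (col_mx (usubmx N2) F) erefl); apply: saito_assoc.
have sN' : saito L' (col_mx (col_mx N1 (usubmx N2)) (dsubmx N2)) e'.
  move: sN; rewrite -{1}[N2]vsubmxK col_mxA.
  by case: _ / (esym (addnA _ _ _)).
have [_ HN' _ _] := sN'; apply: transfer; [lia|exact: hfam_l HN'|].
have [v vL] := exists_off; exists v => //.
by have := saito_free arL' sN' vL; rewrite evm_col => /row_free_l.
Qed.

Definition sel (J : {set 'I_q}) : 'M[K]_(n, #|J|) := colsub (@enum_val _ (mem J)) a.

Lemma mul_sel J p (A : 'M[K]_(p, n)) :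
  A *m sel J = 0 <-> forall j, j \in J -> A *m col j a = 0.
Proof.
have E k : col k (A *m sel J) = A *m col (enum_val k) a.
  by rewrite !colE -mulmxA -!colE; congr (_ *m _); apply/matrixP => i l; rewrite !mxE.
split=> [A0 j jJ|A0]; first by rewrite -(enum_rankK_in jJ jJ) -E A0 colE mul0mx.
apply/matrixP => i k; have /matrixP /(_ i 0) := E k.
by rewrite A0 ?enum_valP // !mxE.
Qed.

Lemma rank_sel J : \rank (sel J) = #|J|.
Proof.
have [W Wa] := dual; apply/eqP; rewrite -/(row_full _); apply/row_fullP.
exists (rowsub (@enum_val _ (mem J)) W); apply/matrixP => i j.
have /matrixP /(_ (enum_val i) (enum_val j)) := Wa; rewrite !mxE.
rewrite (inj_eq enum_val_inj) => <-; apply: eq_bigr => k _; rewrite !mxE //.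
Qed.

Lemma sub_sel J p (x : 'M[K]_(p, n)) :
  (x <= kermx (sel J))%MS <-> forall j, j \in J -> x *m col j a = 0.
Proof. by rewrite -mul_sel; split=> /sub_kermxP. Qed.

Lemma dual_col W i j : W *m a = 1%:M -> row i W *m col j a = (i == j)%:R%:M.
Proof.
move=> Wa; apply/matrixP => k l; rewrite !ord1 mul_colE -row_mul Wa !mxE eqxx.
by rewrite mulr1n.
Qed.

(** Otherwise all fields of the basis would kill [col j a] at [x0]: those in [T] by tangency, the
    others in [F] by duality. But at [x0] they span everything, including a vector on which
    [col j a] is 1. *)
Lemma witness j : evm x0 (row j F) *m col j a != 0.
Proof.
have full : row_full (evm x0 (col_mx T F)).
  by move: free0; rewrite /row_free /row_full => /eqP ->; rewrite mq.
have [W Wa] := dual.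
have /submxP [D ED] : (row j W <= evm x0 (col_mx T F))%MS by apply: submx_full.
apply: contraTneq (oner_neq0 K) => E.
have := dual_col j j Wa; rewrite eqxx ED -[D]hsubmxK evm_col mul_row_col mulmxDl.
rewrite -!mulmxA (hfam_row HT (colL j) (mul_col0 _ x0a)) mulmx0 add0r.
rewrite (_ : _ *m col j a = 0).
  by rewrite mulmx0 => /matrixP /(_ 0 0); rewrite !mxE => /esym/eqP ->.
apply/row_matrixP => i; rewrite row_mul row0 -evm_row.
have [->//|ij] := eqVneq i j.
by apply: HFa (mul_col0 _ x0a); rewrite eq_sym.
Qed.

(** The [j]-th field of [F] is tangent to the larger intersection [X'] and transverse to
    [ker (col j a)] at [x0], so [terao_rel] bounds the loss among the other hyperplanes by its
    degree [d]. The extra 1 is the trace of [ker (col j a)] itself. *)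
Lemma chain_step (J : {set 'I_q}) j : j \in J ->
  (cnt L' (kermx (sel (J :\ j))) <= cnt L' (kermx (sel J)) + d.+1)%N.
Proof.
move=> jJ; set X' := kermx (sel (J :\ j)); set X := kermx (sel J).
pose L0 := [seq b <- L' | b != col j a].
have L0L' : {subset L0 <= L'} by move=> b; rewrite mem_filter => /andP [].
have le1 : (cnt L' X' <= (cnt L0 X').+1)%N.
  apply: (@uniq_leq_size _ (traces L' X') (rp (X' *m col j a) :: traces L0 X')).
    exact: undup_uniq.
  move=> r; rewrite inE !mem_undup => /mapP [b]; rewrite mem_filter => /andP [b0 bL] ->.
  have [->|ne] := eqVneq b (col j a); first by rewrite eqxx.
  apply/orP; right; apply/mapP; exists b => //.
  by rewrite mem_filter b0 mem_filter ne.
have [W Wa] := dual.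
have x0X' : (x0 <= X')%MS by apply/sub_sel => i _; apply: mul_col0.
have WX' i : i \notin J :\ j -> (row i W <= X')%MS.
  move=> iJ; apply/sub_sel => k kJ; rewrite dual_col //.
  by have [E|_] := eqVneq i k; [rewrite E kJ in iJ|rewrite raddf0].
have le2 : (cnt L0 X' <= d + cnt L0 X)%N.
  have [_ hF] := HF j.
  apply: (@terao_rel _ _ _ X' _ X L0 (col j a) (row j F)) => //.
  - move=> x /sub_sel xX; apply/sub_sel => i iJ; apply: HFa (xX i iJ).
    by move: iJ; rewrite !inE => /andP [].
  - move=> b; rewrite mem_filter mem_cat => /andP [ne /orP [bL|/colsP [i Eb]]] x _ xb.
      by have [Hl _] := HF j; apply: Hl xb.
    by rewrite Eb in ne xb *; apply: HFa xb; apply: contraNneq ne => ->.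
  - apply/negP => /eqP E; have := dual_col j j Wa.
    have /submxP [D ->] := WX' j (negbT (setD11 _ _)).
    rewrite -mulmxA E mulmx0 eqxx => /matrixP /(_ 0 0); rewrite !mxE => /esym/eqP.
    by rewrite oner_eq0.
  (* No other form has the same trace as [col j a] on [X']: an old one is nonzero at [x0], and a new
     one [col i a] is 1 at the dual vector [row i W], where [col j a] is 0. *)
  - move=> b; rewrite mem_filter mem_cat => /andP [ne bL'] Xb /rp_eqE [c c0 E].
    have prop (x : 'rV_n) : (x <= X')%MS -> x *m b = c *: (x *m col j a).
      by move=> /submxP [D ->]; rewrite -[LHS]mulmxA E -scalemxAr -[in RHS]mulmxA.
    case/orP: bL' => [bL|/colsP [i Eb]].
      by have := x0L bL; rewrite prop // mul_col0 // scaler0 eqxx.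
    have ij : i != j by apply: contraNneq ne => <-; rewrite Eb.
    have [iJ|iJ] := boolP (i \in J :\ j).
      by case/eqP: Xb; rewrite Eb; move/sub_sel: (submx_refl X'); apply.
    have := prop _ (WX' _ iJ); rewrite Eb !dual_col // eqxx (negbTE ij) raddf0 scaler0.
    by move=> /matrixP /(_ 0 0); rewrite !mxE => /eqP; rewrite oner_eq0.
  - by exists x0; split=> //; [apply: mul_col0|apply: witness].
  - apply/sub_sel => i; rewrite in_setD1 => /andP [_ iJ].
    by move/sub_sel: (submx_refl X); apply.
  - by move/sub_sel: (submx_refl X); apply.
  - move=> x /sub_sel xX xj; apply/sub_sel => i iJ.
    have [->//|ij] := eqVneq i j; apply: xX; by rewrite !inE ij.
have le3 : (cnt L0 X <= cnt L' X)%N by apply: cnt_le.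
by lia.
Qed.

Lemma chain (J : {set 'I_q}) : (size L' <= cnt L' (kermx (sel J)) + #|J| * d.+1)%N.
Proof.
elim: {J}_.+1 {-2}J (ltnSn #|J|) => // k IH J ltJ.
have [->|[j jJ]] := set_0Vmem J.
  apply: leq_trans (leq_addr _ _); rewrite -(cnt1 arL') cnt_le // ?submx1 //.
  by apply/sub_sel => j; rewrite inE.
have cJ : #|J| = #|J :\ j|.+1 by rewrite (cardsD1 j J) jJ.
have := IH (J :\ j); rewrite -ltnS -cJ => /(_ ltJ).
have E : (#|J| * d.+1 = d.+1 + #|J :\ j| * d.+1)%N by rewrite {1}cJ mulSn.
move=> IHj; apply: leq_trans IHj _; rewrite E addnA leq_add2r.
exact: chain_step.
Qed.

Lemma new_coefs s (U : 'M[S]_(s, n)) : hfam L' U (fun => d.+1) ->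
  exists G, exists C : 'M[K]_(s, q), U = G *m T + cstm _ C *m scaled.
Proof.
move=> HU.
have [c Hc] : exists c : 'I_s -> 'rV[S]_m * 'rV[K]_q,
    forall i, row i U = (c i).1 *m T + cstm _ (c i).2 *m scaled.
  apply: (@fin_all_exists _ _ (fun i (ci : 'rV[S]_m * 'rV[K]_q) =>
    row i U = ci.1 *m T + cstm _ ci.2 *m scaled)) => i.
  have [Hl Hh] := HU i; have [c E Hc] := saito_coef arL' saito_new Hl.
  have [k Hk] : exists k : 'I_q -> K, forall j, c 0 (rshift m j) = (k j)%:MP.
    apply: (@fin_all_exists _ _ (fun j (kj : K) => c 0 (rshift m j) = kj%:MP)) => j.
    by have [_] := Hc _ Hh (rshift m j); apply; rewrite step_exp_hi ?leq_addr.
  exists (lsubmx c, \row_j k j) => /=; rewrite E -{1}[c]hsubmxK mul_row_col.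
  by congr (_ + _ *m _); apply/rowP => j; rewrite !mxE Hk.
exists (\matrix_i (c i).1), (\matrix_i (c i).2); apply/row_matrixP => i.
rewrite Hc linearD /= !row_mul rowK; congr (_ + _ *m _).
by apply/rowP => j; rewrite !mxE.
Qed.

(** Modulo [T], the fields [N2] are the constant combinations [C] of [scaled]. On the flat of [J]
    only the columns of [C] outside [J] survive, so independence there needs an invertible minor in
    these columns. *)
Lemma good_low s k (N1 : 'M[S]_(m, n)) (N2 : 'M[S]_(s, n)) (N3 : 'M[S]_(k, n)) :
  saito L' (col_mx (col_mx N1 N2) N3) e' -> good L' e' (col_mx N1 N2).
Proof.
move=> sN; have [mn HN _ _] := sN; have Eq : q = (s + k)%N by lia.
have HN12 := hfam_l HN; have HN1 := hfam_l HN12.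
have HN2 : hfam L' N2 (fun => d.+1).
  move=> i; have := HN12 (rshift m i); rewrite -row_dsubmx col_mxKd.
  by rewrite step_exp_hi // leq_addr.
have [G1 E1] := low_coefs HN1 (leqnn _); have [G2 [C E2]] := new_coefs HN2.
have sub1 (v : 'rV_n) : (forall b, b \in L' -> v *m b != 0) -> forall b, b \in L -> v *m b != 0.
  by move=> vL b /subL /vL.
have free12 v : (forall b, b \in L' -> v *m b != 0) ->
    row_free (evm v (col_mx N1 N2)).
  by move=> vL; have := saito_free arL' sN vL; rewrite evm_col => /row_free_l.
have [v0 v0L] := exists_off.
have sN1 : saito L (col_mx N1 F) e.
  apply: transfer => //; exists v0 => //.
  by have := free12 _ v0L; rewrite evm_col => /row_free_l.
have G1unit v : (forall b, b \in L -> v *m b != 0) -> evm v G1 \in unitmx.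
  move=> vL; have := saito_free arL sN1 vL; rewrite evm_col => /row_free_l.
  rewrite E1 evm_mul -row_free_unit => free; apply: inj_row_free => u uG.
  by apply/eqP; rewrite -(mulmx_free_eq0 u free) mulmxA uG mul0mx.
(* A relation [u C = 0] would express [u N2] through [T], hence through [N1], at the point [v0]. *)
have rkC : \rank C = s.
  have vL1 := sub1 _ v0L; have := free12 _ v0L; rewrite evm_col => free.
  apply/eqP; rewrite -/(row_free C); apply: inj_row_free => u uC.
  suff [_ //] : - (u *m evm v0 G2 *m invmx (evm v0 G1)) = 0 /\ u = 0.
  apply: (row_free_col free); rewrite E2 evm_add !evm_mul evm_cstm mulmxDr.
  rewrite [u *m (C *m _)]mulmxA uC mul0mx addr0 E1 evm_mul mulNmx !mulmxA.
  by rewrite mulmxKV ?addNr // G1unit.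
have fullC : row_full C^T by rewrite /row_full mxrank_tr rkC.
(* [f] selects [s] columns on which [C] is invertible; the remaining [q - s] new hyperplanes cut out
   the flat, of dimension [m + s]. *)
pose f := fullrankfun fullC; have f_inj := @fullrankfun_inj _ _ _ _ fullC.
pose J := ~: [set f i | i : 'I_s].
have cJ : (#|J| + s = q)%N.
  have := cardsC [set f i | i : 'I_s]; rewrite -/J card_ord.
  by rewrite card_imset // card_ord addnC.
have rkX : \rank (kermx (sel J)) = (m + s)%N.
  rewrite mxrank_ker rank_sel; apply: (canLR (addnK #|J|)).
  apply: (etrans (esym mq)); apply: (etrans (congr1 (addn m) (esym cJ))).
  by rewrite (addnC #|J|) addnA.
have [A [Af AE]] := exists_free rkX.
have AX (x : 'rV_n) : (x <= A)%MS <-> (forall j, j \in J -> x *m col j a = 0).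
  by rewrite AE; apply: sub_sel.
have [W Wa] := dual.
exists [seq col j a | j <- enum J], A; split=> //.
- by move=> b /mapP [j _ ->].
(* A generic point of the flat avoids the old hyperplanes and the new ones outside [J]. None of
   their forms vanishes on the flat, as [x0] and the dual vectors [row j W] show. *)
- pose L1 := [seq A *m b | b <- L ++ [seq col j a | j <- enum (~: J)]].
  have [|y [_ yL1]] := @generic_off K _ L1 1 (oner_neq0 _).
    apply/mapP => -[b]; rewrite mem_cat => /orP [bL|/mapP [j]].
      have /submxP [D E] : (x0 <= A)%MS by apply/AX => j _; apply: mul_col0.
      by move=> /esym Ab; have := x0L bL; rewrite E -mulmxA Ab mulmx0 eqxx.
    rewrite mem_enum inE => jJ -> /esym Ab.
    have /submxP [D E] : (row j W <= A)%MS.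
      apply/AX => i iJ; rewrite dual_col //.
      by have [Eij|_] := eqVneq j i; [rewrite Eij iJ in jJ|rewrite raddf0].
    have := dual_col j j Wa; rewrite eqxx E -mulmxA Ab mulmx0.
    by move=> /matrixP /(_ 0 0); rewrite !mxE => /esym/eqP; rewrite oner_eq0.
  have xX : (y *m A <= A)%MS by apply: submxMl.
  have xL b : b \in L -> y *m A *m b != 0.
    by move=> bL; rewrite -mulmxA yL1 // map_f // mem_cat bL.
  have xJ j : j \notin J -> (y *m A *m a) 0 j != 0.
    move=> jJ; rewrite -mul_colE -mulmxA.
    have : y *m (A *m col j a) != 0.
      apply/yL1/map_f; rewrite mem_cat; apply/orP; right.
      by apply: (map_f (fun i => col i a)); rewrite mem_enum inE.
    by apply: contraNN => /eqP E; apply/eqP/matrixP => i l; rewrite !ord1 E mxE.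
  exists (y *m A); split.
    by move=> b /mapP [j]; rewrite mem_enum => jJ ->; apply: (AX _).1 jJ.
  move: xX xL xJ; set x := y *m A => xX xL xJ.
  have := saito_free arL saito_TF xL; rewrite !evm_col => freeTF.
  apply: row_free_colP => u1 u2.
  have -> : evm x N1 = evm x G1 *m evm x T by rewrite E1 evm_mul.
  have -> : evm x N2 = evm x G2 *m evm x T + C *m (diag_mx (x *m a) *m evm x F).
    by rewrite E2 evm_add !evm_mul evm_cstm evm_scaled.
  rewrite mulmxDr addrA !mulmxA -mulmxDl => /(row_free_col freeTF) [EG EC].
  have u20 : u2 = 0.
    apply/eqP; rewrite -(mulmx_free_eq0 u2 (_ : row_free (rowsub f C^T)^T)); last first.
      by rewrite row_free_unit unitmx_tr fullrowsub_unit.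
    apply/eqP/rowP => i; have /rowP /(_ (f i)) := EC; rewrite mul_mx_diag [LHS]mxE.
    rewrite [RHS]mxE => /eqP; rewrite mulf_eq0 (negbTE (xJ _ _)) ?orbF; last first.
      by rewrite inE negbK imset_f.
    move=> /eqP E; rewrite [RHS]mxE -E !mxE.
    by apply: eq_bigr => l _; rewrite !mxE.
  split=> //; move: EG; rewrite u20 mul0mx addr0 => /(congr1 (mulmx^~ (invmx (evm x G1)))).
  by rewrite mulmxK ?mul0mx // G1unit.
- move=> x; rewrite AX; split=> [H b /mapP [j]|H j jJ].
    by rewrite mem_enum => jJ ->; apply: H.
  by apply: H; apply: (map_f (fun i => col i a)); rewrite mem_enum.
(* Since [size L'] is the sum of the first [m] exponents plus [q * d.+1], removing [#|J| * d.+1]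
   leaves exactly the first [m + s] exponents. *)
- rewrite sum_block (cnt_eq _ AE) -(leq_add2r (#|J| * d.+1)).
  apply: leq_trans (chain J); rewrite size_L' -sum_step.
  rewrite (eq_bigr (fun i : 'I_m => e i)) => [|i _]; last by rewrite step_exp_lo.
  rewrite (eq_bigr (fun i : 'I_s => d.+1)) => [|i _]; last by rewrite step_exp_hi ?leq_addr.
  by rewrite sum_nat_const card_ord -addnA -mulnDl (addnC s) cJ mulnSr addnA.
Qed.

(* The flats of codimension larger than [q] come from the old arrangement. *)
Theorem good_step r :
  (forall m1 m2 (N1 : 'M[S]_(m1, n)) (N2 : 'M[S]_(m2, n)), saito L (col_mx N1 N2) e ->
    (q < m2 <= r)%N -> good L e N1) ->
  forall m1 m2 (N1 : 'M[S]_(m1, n)) (N2 : 'M[S]_(m2, n)), saito L' (col_mx N1 N2) e' ->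
    (m2 <= r)%N -> good L' e' N1.
Proof.
move=> old m1 m2 N1 N2 sN m2r; have [mn _ _ _] := sN.
have [le|lt] := leqP m m1.
  have [s Em1] : exists s, m1 = (m + s)%N by exists (m1 - m)%N; lia.
  subst m1; rewrite -[N1]vsubmxK in sN *; exact: good_low sN.
apply: (good_high (ltnW lt) sN) => m2' N2' Em2 sN'; apply: old sN' _.
by rewrite Em2 m2r andbT; lia.
Qed.
End Step.

(** * Root systems *)

Section RootSystem.
Variables (R : realType) (n : nat).
Local Notation E := 'cV[R]_n.

Definition app (x : 'rV[R]_n) (u : E) : R := (x *m u) 0 0.

Lemma appD x u w : app x (u + w) = app x u + app x w.
Proof. by rewrite /app mulmxDr mxE. Qed.
Lemma appN x u : app x (- u) = - app x u.
Proof. by rewrite /app mulmxN mxE. Qed.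
Lemma appB x u w : app x (u - w) = app x u - app x w.
Proof. by rewrite appD appN. Qed.
Lemma appZ x k u : app x (k *: u) = k * app x u.
Proof. by rewrite /app -scalemxAr mxE. Qed.
Lemma app0 x : app x 0 = 0.
Proof. by rewrite /app mulmx0 mxE. Qed.
Lemma app_sum x (I : Type) (r : seq I) (P : pred I) F :
  app x (\sum_(i <- r | P i) F i) = \sum_(i <- r | P i) app x (F i).
Proof. by rewrite /app mulmx_sumr summxE. Qed.
Lemma appBl x y u : app (x - y) u = app x u - app y u.
Proof. by rewrite /app mulmxBl !mxE. Qed.
Lemma appZl k x u : app (k *: x) u = k * app x u.
Proof. by rewrite /app -scalemxAl mxE. Qed.
Lemma app_suml (I : Type) (r : seq I) F u :
  app (\sum_(i <- r) F i) u = \sum_(i <- r) app (F i) u.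
Proof. by rewrite /app mulmx_suml summxE. Qed.

Lemma app_inj u w : (forall x, app x u = app x w) -> u = w.
Proof.
move=> H; apply/colP => i; have := H (delta_mx 0 i).
by rewrite /app -!rowE !mxE.
Qed.

(* [co a] is the coroot of [a]. *)
Definition rsys (Phi : seq E) (co : E -> 'rV[R]_n) : Prop :=
  [/\ uniq Phi,
      forall a, a \in Phi -> app (co a) a = 2,
      forall a b, a \in Phi -> b \in Phi -> b - app (co a) b *: a \in Phi,
      forall a b, a \in Phi -> b \in Phi -> app (co a) b \is a Num.int
    & forall a t, a \in Phi -> t *: a \in Phi -> t = 1 \/ t = -1].

Section Theory.
Variables (Phi : seq E) (co : E -> 'rV[R]_n).
Hypothesis HPhi : rsys Phi co.

Let uPhi : uniq Phi. Proof. by case: HPhi. Qed.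
Let co2 a : a \in Phi -> app (co a) a = 2. Proof. by case: HPhi => _ H _ _ _; apply: H. Qed.
Let intPhi a b : a \in Phi -> b \in Phi -> app (co a) b \is a Num.int.
Proof. by case: HPhi => _ _ _ H _; apply: H. Qed.
Let redPhi a t : a \in Phi -> t *: a \in Phi -> t = 1 \/ t = -1.
Proof. by case: HPhi => _ _ _ _ H; apply: H. Qed.

Definition refl (a b : E) : E := b - app (co a) b *: a.

Lemma refl_in a b : a \in Phi -> b \in Phi -> refl a b \in Phi.
Proof. by case: HPhi => _ _ H _ _; apply: H. Qed.

Lemma app_refl x a b : app x (refl a b) = app x b - app (co a) b * app x a.
Proof. by rewrite /refl appB appZ. Qed.

Lemma refl_lin a u k w : refl a (u - k *: w) = refl a u - k *: refl a w.
Proof. by rewrite /refl appB appZ; apply/colP => i; rewrite !mxE; ring. Qed.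

Lemma reflK a b : a \in Phi -> refl a (refl a b) = b.
Proof.
move=> aP; rewrite {1}/refl app_refl co2 // /refl.
by rewrite (_ : _ - _ = - app (co a) b); [rewrite scaleNr opprK subrK|ring].
Qed.

Lemma refl_self a : a \in Phi -> refl a a = - a.
Proof. by move=> aP; rewrite /refl co2 // scaler_nat mulr2n opprD addrA subrr sub0r. Qed.

Lemma opp_in a : a \in Phi -> - a \in Phi.
Proof. by move=> aP; rewrite -refl_self // refl_in. Qed.

Lemma refl_perm a : a \in Phi -> perm_eq [seq refl a b | b <- Phi] Phi.
Proof.
move=> aP; have inj : injective (refl a) by apply: can_inj (fun b => reflK b aP).
apply: uniq_perm => //; first by rewrite map_inj_uniq.
move=> b; apply/mapP/idP => [[c cP ->]|bP]; first exact: refl_in.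
by exists (refl a b); rewrite ?reflK // refl_in.
Qed.

(** The canonical invariant form on points; its radical is the common kernel of the roots. *)
Definition bil (x y : 'rV[R]_n) : R := \sum_(g <- Phi) app x g * app y g.

Lemma bil_sym x y : bil x y = bil y x.
Proof. by apply: eq_bigr => g _; rewrite mulrC. Qed.

Lemma bil_eq0 x : bil x x = 0 -> forall g, g \in Phi -> app x g = 0.
Proof.
move=> /eqP; rewrite psumr_eq0 => [|g _]; last by rewrite -expr2 sqr_ge0.
by move=> /allP H g /H /=; rewrite mulf_eq0 orbb => /eqP.
Qed.

(* A reflection permuting [Phi] preserves [bil], so its linear form is
   determined by its root. *)
Lemma bil_coroot c a x : app c a = 2 ->
  (forall b, b \in Phi -> b - app c b *: a \in Phi) ->
  2 * bil x c = app x a * bil c c.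
Proof.
move=> ca cP; pose s b := b - app c b *: a.
have sK b : s (s b) = b.
  rewrite {1}/s /s appB appZ ca.
  by rewrite (_ : _ - _ * 2 = - app c b); [rewrite scaleNr opprK subrK|ring].
have sperm : perm_eq (map s Phi) Phi.
  apply: uniq_perm => //; first by rewrite map_inj_uniq //; exact: can_inj sK.
  move=> b; apply/mapP/idP => [[d dP ->]|bP]; first exact: cP.
  by exists (s b); rewrite ?sK // cP.
have : bil x c = \sum_(g <- Phi) (app x a * (app c g * app c g) - app x g * app c g).
  rewrite /bil -(perm_big _ sperm) big_map; apply: eq_bigr => g _.
  by rewrite /s !appB !appZ ca; ring.
by rewrite sumrB -mulr_sumr -/(bil c c) -/(bil x c) => E; lra.
Qed.

(** By [bil_coroot] the norms of [c] and [co a] both equal their product, so [c - co a] has norm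
    zero and vanishes on all roots. *)
Lemma coroot_uniq c a : a \in Phi -> app c a = 2 ->
  (forall b, b \in Phi -> b - app c b *: a \in Phi) ->
  forall g, g \in Phi -> app c g = app (co a) g.
Proof.
move=> aP ca cP g gP; apply/eqP; rewrite -subr_eq0 -appBl; apply/eqP.
apply: bil_eq0 gP.
have E1 := bil_coroot (co a) ca cP; rewrite co2 // in E1.
have E2 := bil_coroot c (co2 aP) (fun b => @refl_in a b aP); rewrite ca in E2.
have -> : bil (c - co a) (c - co a) = bil c c - 2 * bil (co a) c + bil (co a) (co a).
  by rewrite /bil mulr_sumr -sumrB -big_split /=; apply: eq_bigr => h _; rewrite appBl; ring.
by rewrite (bil_sym c) in E2; lra.
Qed.

(** The functional [co a] transported by [refl d] has the defining properties of a coroot of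
    [refl d a]; uniqueness applies. This gives the invariance of [ip]. *)
Lemma app_refl_refl d a b : d \in Phi -> a \in Phi -> b \in Phi ->
  app (co (refl d a)) (refl d b) = app (co a) b.
Proof.
move=> dP aP bP; set c := co a - app (co a) d *: co d.
have cE g : app c g = app (co a) (refl d g).
  by rewrite /c appBl appZl app_refl mulrC.
rewrite -(@coroot_uniq c) ?refl_in //.
- by rewrite cE reflK.
- by rewrite cE reflK // co2.
- move=> g gP; rewrite cE; have := refl_in dP (refl_in aP (refl_in dP gP)).
  by rewrite {2}/refl refl_lin reflK.
Qed.

(** The counterpart of [bil] on linear forms, built from the coroots. It is positive on each root,
    but a vector of norm zero is only known to pair to zero with all coroots. *)
Definition ip (u w : E) : R := \sum_(g <- Phi) app (co g) u * app (co g) w.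

Lemma ipC u w : ip u w = ip w u.
Proof. by apply: eq_bigr => g _; rewrite mulrC. Qed.
Lemma ipDl u v w : ip (u + v) w = ip u w + ip v w.
Proof. by rewrite /ip -big_split; apply: eq_bigr => g _; rewrite appD mulrDl. Qed.
Lemma ipZl k u w : ip (k *: u) w = k * ip u w.
Proof. by rewrite /ip mulr_sumr; apply: eq_bigr => g _; rewrite appZ mulrA. Qed.
Lemma ip0l w : ip 0 w = 0.
Proof. by rewrite -(scale0r 0) ipZl mul0r. Qed.
Lemma ip_suml (I : Type) (r : seq I) (P : pred I) F w :
  ip (\sum_(i <- r | P i) F i) w = \sum_(i <- r | P i) ip (F i) w.
Proof.
by elim/big_rec2: _ => [|i y x _ IH]; [exact: ip0l|rewrite ipDl IH].
Qed.
Lemma ip_sumr (I : Type) (r : seq I) (P : pred I) F w :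
  ip w (\sum_(i <- r | P i) F i) = \sum_(i <- r | P i) ip w (F i).
Proof. by rewrite ipC ip_suml; apply: eq_bigr => i _; rewrite ipC. Qed.
Lemma ipZr k u w : ip u (k *: w) = k * ip u w.
Proof. by rewrite ipC ipZl ipC. Qed.
Lemma ipDr u v w : ip u (v + w) = ip u v + ip u w.
Proof. by rewrite ipC ipDl !(ipC u). Qed.
Lemma ipNr u w : ip u (- w) = - ip u w.
Proof. by rewrite -scaleN1r ipZr mulN1r. Qed.
Lemma ipBl u v w : ip (u - v) w = ip u w - ip v w.
Proof. by rewrite ipDl -scaleN1r ipZl mulN1r. Qed.
Lemma ip_ge0 u : 0 <= ip u u.
Proof. by apply: sumr_ge0 => g _; rewrite -expr2 sqr_ge0. Qed.

Lemma ip_eq0 u : ip u u = 0 -> forall g, g \in Phi -> app (co g) u = 0.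
Proof.
move=> /eqP; rewrite psumr_eq0 => [|g _]; last by rewrite -expr2 sqr_ge0.
by move=> /allP H g /H /=; rewrite mulf_eq0 orbb => /eqP.
Qed.

Lemma ip_gt0 a : a \in Phi -> 0 < ip a a.
Proof.
move=> aP; rewrite lt_def ip_ge0 andbT; apply/negP => /eqP /ip_eq0 /(_ a aP) /eqP.
by rewrite co2 // pnatr_eq0.
Qed.

Lemma ip_refl d u w : d \in Phi -> u \in Phi -> w \in Phi ->
  ip (refl d u) (refl d w) = ip u w.
Proof.
move=> dP uP wP; rewrite /ip -(perm_big _ (refl_perm dP)) big_map.
by rewrite !big_seq; apply: eq_bigr => g gP; rewrite !app_refl_refl.
Qed.

Lemma ip_co a u : a \in Phi -> u \in Phi -> 2 * ip u a = app (co a) u * ip a a.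
Proof.
move=> aP uP; have := ip_refl aP uP aP; rewrite refl_self // {1}/refl.
by rewrite ipNr ipBl ipZl => E; lra.
Qed.

Lemma co_gt0 a u : a \in Phi -> u \in Phi -> (0 < app (co a) u) = (0 < ip u a).
Proof.
move=> aP uP; have := ip_co aP uP; have := ip_gt0 aP => a0 E.
by rewrite -(pmulr_lgt0 _ a0) -E pmulr_rgt0.
Qed.

Lemma int_gt0_ge1 (x : R) : x \is a Num.int -> 0 < x -> 1 <= x.
Proof. by move=> /intrP [z ->]; rewrite ltr0z ler1z gtz0_ge1. Qed.

(** If one of the two Cartan integers is 1, a reflection produces the difference. If both are at
    least 2, then [a - b] has norm zero, so the coroots agree on [Phi], and [bil_coroot] recovers
    the root from its coroot. *)
Lemma sub_root a b : a \in Phi -> b \in Phi -> a != b -> 0 < ip a b -> a - b \in Phi.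
Proof.
move=> aP bP ab ip0; have ab0 : 0 < app (co b) a by rewrite co_gt0.
have ba0 : 0 < app (co a) b by rewrite co_gt0 // ipC.
have ge2 (x : R) : x \is a Num.int -> 0 < x -> x != 1 -> 2 <= x.
  move=> xi x0 x1; have := int_gt0_ge1 xi x0 => x1'.
  have : 1 <= x - 1 by apply: int_gt0_ge1; rewrite ?rpredB ?rpred1 // subr_gt0 lt_def x1.
  by lra.
have [E|n1] := eqVneq (app (co b) a) 1.
  by have := refl_in bP aP; rewrite /refl E scale1r.
have [E|n2] := eqVneq (app (co a) b) 1.
  by have := opp_in (refl_in aP bP); rewrite /refl E scale1r opprB.
have {}n1 := ge2 _ (intPhi bP aP) ab0 n1; have {}n2 := ge2 _ (intPhi aP bP) ba0 n2.
have E1 := ip_co bP aP; have E2 := ip_co aP bP.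
have a0 := ip_gt0 aP; have b0 := ip_gt0 bP; rewrite (ipC b a) in E2.
have le1 : ip b b <= ip a b by nra.
have le2 : ip a a <= ip a b by nra.
have eq0 : ip (a - b) (a - b) = 0.
  apply/eqP; rewrite eq_le ip_ge0 andbT ipBl !ipDr !ipNr (ipC b a).
  by lra.
have ipE g : ip g a = ip g b.
  rewrite /ip !big_seq; apply: eq_bigr => h hP; congr (_ * _).
  by have := ip_eq0 eq0 hP; rewrite appB => /eqP; rewrite subr_eq0 => /eqP.
have coE g : g \in Phi -> app (co a) g = app (co b) g.
  move=> gP; have := ip_co aP gP; have := ip_co bP gP.
  have Eab : ip a a = ip b b by rewrite ipE ipC ipE.
  by rewrite ipE Eab => -> /(mulIf (lt0r_neq0 b0)).
case/eqP: ab; apply: app_inj => x.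
have H c : c \in Phi -> 2 * bil x (co c) = app x c * bil (co c) (co c).
  by move=> cP; apply: bil_coroot => [|g gP]; [exact: co2|exact: refl_in].
have B1 : bil x (co a) = bil x (co b).
  by rewrite /bil !big_seq; apply: eq_bigr => g gP; rewrite coE.
have B2 : bil (co a) (co a) = bil (co b) (co b).
  by rewrite /bil !big_seq; apply: eq_bigr => g gP; rewrite coE.
have N0 : bil (co b) (co b) != 0.
  by apply/negP => /eqP /bil_eq0 /(_ b bP) /eqP; rewrite co2 // pnatr_eq0.
by have := H _ aP; rewrite B1 (H _ bP) B2 => /(mulIf N0).
Qed.

(** * Positive roots, simple roots and heights *)

Section Positive.
Variable f : 'rV[R]_n.
Hypothesis f0 : forall a, a \in Phi -> app f a != 0.

Definition posr : seq E := [seq a <- Phi | 0 < app f a].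
Definition simp : seq E := [seq a <- posr | ~~ has (fun b => a - b \in posr) posr].

Lemma posr_sub a : a \in posr -> a \in Phi.
Proof. by rewrite mem_filter => /andP []. Qed.
Lemma posr_gt0 a : a \in posr -> 0 < app f a.
Proof. by rewrite mem_filter => /andP []. Qed.
Lemma simp_pos a : a \in simp -> a \in posr.
Proof. by rewrite mem_filter => /andP []. Qed.

Lemma pos_or_neg a : a \in Phi -> a \in posr \/ - a \in posr.
Proof.
move=> aP; rewrite !mem_filter aP opp_in // appN oppr_gt0 !andbT.
by have := f0 aP; rewrite neq_lt => /orP [|]; [right|left].
Qed.

Lemma posr_uniq : uniq posr.
Proof. exact: filter_uniq. Qed.

(** The real values of [f] are well ordered only by finiteness of [Phi]: the measure is the number
    of positive roots with a smaller value. *)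
Lemma pos_ind (P : E -> Prop) :
  (forall a, a \in posr -> (forall b, b \in posr -> app f b < app f a -> P b) -> P a) ->
  forall a, a \in posr -> P a.
Proof.
move=> IH a; pose lo a := [seq b <- posr | app f b < app f a].
elim: {a}(size (lo a)).+1 {-2}a (ltnSn (size (lo a))) => // k IHk a lta aP.
apply: IH => // b bP ltb; apply: IHk => //; rewrite -ltnS; apply: leq_trans lta.
rewrite ltnS; apply: (@uniq_leq_size _ (b :: lo b)).
  by rewrite /= mem_filter ltxx filter_uniq // posr_uniq.
move=> c; rewrite inE !mem_filter => /orP [/eqP ->|/andP [ltc ->]].
  by rewrite ltb; move: bP; rewrite mem_filter.
by rewrite (lt_trans ltc ltb).
Qed.

Lemma simp_or_sum a : a \in posr -> a \in simp \/ exists b c,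
  [/\ b \in posr, c \in posr & a = b + c].
Proof.
move=> aP; have [/hasP [b bP abP]|nh] := boolP (has (fun b => a - b \in posr) posr).
  by right; exists b, (a - b); rewrite subrKC.
by left; rewrite mem_filter nh.
Qed.

Lemma simp_indec d b c : d \in simp -> b \in posr -> c \in posr -> d != b + c.
Proof.
rewrite mem_filter => /andP [/hasPn H dP] bP cP; apply: contraTneq cP => E.
by have := H b bP; rewrite E addrC addKr.
Qed.

Lemma simp_comb a : a \in posr -> exists s : seq E,
  [/\ {subset s <= simp}, a = \sum_(d <- s) d & s != [::]].
Proof.
move: a; apply: pos_ind => a aP IH; have [as_|[b [c [bP cP E]]]] := simp_or_sum aP.
  exists [:: a]; split=> //; last by rewrite big_seq1.
  by move=> d; rewrite inE => /eqP ->.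
have [|s [sD Es _]] := IH b bP; first by rewrite E appD ltrDl posr_gt0.
have [|t [tD Et t0]] := IH c cP; first by rewrite E appD ltrDr posr_gt0.
exists (s ++ t); split; last by case: (s) t0.
  by move=> d; rewrite mem_cat => /orP [/sD|/tD].
by rewrite big_cat -Es -Et.
Qed.

Lemma simp_sub a d : a \in posr -> d \in simp -> a - d \in Phi -> a - d \in posr.
Proof.
move=> aP dS /pos_or_neg [//|]; rewrite opprB => daP.
by have := simp_indec dS aP daP; rewrite subrKC eqxx.
Qed.

(** As [a] has positive norm and is a sum of simple roots, its product with one of them is
    positive. *)
Lemma nonsimp_sub a : a \in posr -> a \notin simp ->
  exists2 d, d \in simp & a - d \in posr.
Proof.
move=> aP aS; have [s [sD Es _]] := simp_comb aP.
have [d ds ip0] : exists2 d, d \in s & 0 < ip a d.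
  apply/hasP; apply: contraTT (ip_gt0 (posr_sub aP)) => /hasPn H; rewrite -leNgt.
  rewrite {2}Es ip_sumr big_seq; apply: sumr_le0 => d /H; by rewrite -leNgt.
have dS := sD _ ds; have dP := posr_sub (simp_pos dS).
exists d => //; apply: simp_sub => //; apply: sub_root => //; first exact: posr_sub.
by apply: contraNneq aS => ->.
Qed.

Lemma scale_pos a t : a \in posr -> t *: a \in posr -> t = 1.
Proof.
move=> aP taP; have [//|E] := redPhi (posr_sub aP) (posr_sub taP).
have := posr_gt0 taP; rewrite E scaleN1r appN oppr_gt0 => /lt_trans /(_ (posr_gt0 aP)).
by rewrite ltxx.
Qed.

(** If the Cartan integer is nonpositive, the value of [f] does not drop. Otherwise [a - d] is a
    smaller positive root, and [refl d a] is [refl d (a - d)] minus the simple root [d], hence again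
    positive. *)
Lemma refl_simp_pos d a : d \in simp -> a \in posr -> a != d -> refl d a \in posr.
Proof.
move=> dS; have dpos := simp_pos dS; have dP := posr_sub dpos.
move: a; apply: pos_ind => a aP IH ad; have aPhi := posr_sub aP.
have [le0|gt0] := lerP (app (co d) a) 0.
  rewrite mem_filter refl_in // andbT app_refl.
  have := posr_gt0 aP; have := posr_gt0 dpos => d0 a0.
  by rewrite subr_gt0; apply: le_lt_trans a0; apply: mulr_le0_ge0 (ltW d0).
have bPhi : a - d \in Phi by apply: sub_root => //; rewrite -co_gt0.
have bP := simp_sub aP dS bPhi.
have bd : a - d != d.
  apply/eqP => E; have E2 : a = 2 *: d by rewrite scaler_nat mulr2n -{1}E subrK.
  by have := @scale_pos d 2 dpos; rewrite -E2 => /(_ aP) /eqP;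
    rewrite -subr_eq0 (_ : 2 - 1 = 1) ?oner_eq0 //; ring.
have gP : refl d (a - d) \in posr.
  by apply: IH; rewrite // appB ltrBlDr ltrDl posr_gt0.
have E : refl d a = refl d (a - d) - d.
  by rewrite -[X in a - X]scale1r refl_lin scale1r refl_self // opprK addrK.
by rewrite E; apply: simp_sub => //; rewrite -E refl_in.
Qed.

(** [refl d] permutes the positive roots other than [d] and changes the sign of their contributions,
    so only that of [d] remains. *)
Lemma sum_coroot_simp d : d \in simp -> \sum_(g <- posr) app (co g) d = 2.
Proof.
move=> dS; have dpos := simp_pos dS; have dP := posr_sub dpos.
rewrite (perm_big _ (perm_to_rem dpos)) big_cons /= co2 //.
suff -> : \sum_(g <- rem d posr) app (co g) d = 0 by rewrite addr0.
have inj : injective (refl d) by apply: can_inj (fun b => reflK b dP).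
have memr g : g \in rem d posr = (g != d) && (g \in posr).
  by rewrite mem_rem_uniq ?posr_uniq.
have stab g : g \in rem d posr -> refl d g \in rem d posr.
  rewrite !memr => /andP [gd gP]; rewrite refl_simp_pos // andbT.
  apply/eqP => E; have := reflK g dP; rewrite E refl_self // => E'.
  have := posr_gt0 gP; rewrite -E' appN oppr_gt0 => /lt_trans /(_ (posr_gt0 dpos)).
  by rewrite ltxx.
have perm : perm_eq (map (refl d) (rem d posr)) (rem d posr).
  apply: uniq_perm; rewrite ?map_inj_uniq ?rem_uniq ?posr_uniq //.
  move=> g; apply/mapP/idP => [[h hP ->]|gP]; first exact: stab.
  by exists (refl d g); rewrite ?reflK // stab.
have E : \sum_(g <- rem d posr) app (co g) d = - \sum_(g <- rem d posr) app (co g) d.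
  rewrite -{1}(perm_big _ perm) big_map -sumrN !big_seq.
  apply: eq_bigr => g; rewrite memr => /andP [_ gP].
  have := app_refl_refl dP (posr_sub gP) dP.
  by rewrite (refl_self dP) appN => <-; rewrite opprK.
by move: E; set x := \sum_(_ <- _) _; lra.
Qed.

(** Half the sum of the positive coroots. Through it the height is a linear form, free of
    coordinates in the simple roots and comparable between subsystems. *)
Definition rho : 'rV[R]_n := 2^-1 *: \sum_(g <- posr) co g.
Definition height (u : E) : R := app rho u.

Lemma htE u : height u = 2^-1 * \sum_(g <- posr) app (co g) u.
Proof. by rewrite /height /rho appZl app_suml. Qed.

Lemma ht_simp d : d \in simp -> height d = 1.
Proof. by move=> dS; rewrite htE sum_coroot_simp // mulVf // pnatr_eq0. Qed.

Lemma ht_nat a : a \in posr -> exists k : nat, (0 < k)%N /\ height a = k%:R.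
Proof.
move=> /simp_comb [s [sD -> s0]]; exists (size s); split; first by case: (s) s0.
rewrite /height app_sum -sum1_size natr_sum !big_seq.
by apply: eq_bigr => d /sD /ht_simp.
Qed.

Lemma ht_gt0 a : a \in posr -> 0 < height a.
Proof. by move=> /ht_nat [k [k0 ->]]; rewrite ltr0n. Qed.

Lemma ht_neq0 a : a \in Phi -> height a != 0.
Proof.
move=> /pos_or_neg [] /ht_gt0; first by move/lt0r_neq0.
by rewrite /height appN oppr_gt0 => /ltr0_neq0.
Qed.

Lemma ht_pos a : a \in Phi -> (a \in posr) = (0 < height a).
Proof.
move=> aP; have [ap|/ht_gt0] := pos_or_neg aP; first by rewrite ap ht_gt0.
rewrite /height appN oppr_gt0 => lt0; rewrite [RHS]ltNge (ltW lt0) /=.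
by apply: contraTF lt0 => /ht_gt0; rewrite -leNgt => /ltW.
Qed.

(* [g < b] in the root order, through a decomposition into positive roots. *)
Definition below (g b : E) : Prop := g \in posr /\
  exists t : seq E, [/\ {subset t <= posr}, t != [::] & b = g + \sum_(d <- t) d].

Lemma below_lt x g b : (forall a, a \in posr -> 0 < app x a) -> below g b -> app x g < app x b.
Proof.
move=> x0 [gP [t [tP t0 ->]]]; case: t tP t0 => [//|d t] tP _; rewrite appD ltrDl big_cons appD.
apply: ltr_pwDl; first by apply: x0; apply: tP; rewrite mem_head.
rewrite app_sum big_seq; apply: sumr_ge0 => e et; apply/ltW/x0/tP.
by rewrite inE et orbT.
Qed.

(** If [b = b' + d] with [d] simple, then [b'] and everything below [b'] lie below [b]. Nothing lies
    below a simple root, so the induction starts at height two, with [b'] and [d]. *)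
Lemma below_many b : b \in posr -> b \notin simp -> exists s : seq E,
  [/\ uniq s, forall g, g \in s -> below g b & (size s)%:R = height b].
Proof.
move: b; apply: pos_ind => b bP IH bS.
have [d dS b'P] := nonsimp_sub bP bS; set b' := b - d in b'P.
have Eb : b = b' + d by rewrite subrK.
have dP := simp_pos dS.
have htb : height b = height b' + 1 by rewrite Eb /height appD -!/(height _) (ht_simp dS).
have bel1 : below b' b.
  split=> //; exists [:: d]; rewrite big_seq1; split=> // g; rewrite inE => /eqP ->.
  exact: dP.
have bel2 : below d b.
  split=> //; exists [:: b']; rewrite big_seq1 addrC; split=> // g; rewrite inE => /eqP -> //.
have [b'S|b'S] := boolP (b' \in simp).
  exists [:: b'; d]; split.
  - rewrite /= inE andbT; apply: contraNneq bS => E; exfalso.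
    have : b = 2 *: d by rewrite Eb E scaler_nat mulr2n.
    move=> E2; move: bP; rewrite E2 => /(scale_pos dP) /eqP.
    by rewrite -subr_eq0 (_ : 2 - 1 = 1) ?oner_eq0 //; ring.
  - by move=> g; rewrite !inE => /orP [] /eqP ->.
  - by rewrite htb (ht_simp b'S) /= -[2%N]/(1 + 1)%N natrD.
have [|s [us sb sz]] := IH b' b'P _ b'S.
  by rewrite Eb appD ltrDl posr_gt0.
exists (b' :: s); split.
- rewrite /= us andbT; apply/negP => /sb /(below_lt (fun a aP => posr_gt0 aP)).
  by rewrite ltxx.
- move=> g; rewrite inE => /orP [/eqP -> //|/sb [gP [t [tP t0 Et]]]].
  split=> //; exists (rcons t d); split; last by rewrite -cats1 big_cat big_seq1 Eb Et addrA.
    by move=> h; rewrite mem_rcons inE => /orP [/eqP -> //|/tP].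
  by rewrite -size_eq0 size_rcons.
- by rewrite htb -sz /= -natr1.
Qed.

(** Moving the negative coefficients to the other side gives [P = N] with [ip P N <= 0], so [P] has
    norm zero and hence height zero. As heights of positive roots are positive, all coefficients
    vanish. *)
Lemma obtuse_indep (ws : seq E) (c : E -> R) : {subset ws <= posr} ->
  (forall w w', w \in ws -> w' \in ws -> w != w' -> ip w w' <= 0) ->
  \sum_(w <- ws) c w *: w = 0 -> forall w, w \in ws -> c w = 0.
Proof.
move=> wsP obt sum0; set P := \sum_(w <- ws | 0 < c w) c w *: w.
set N := \sum_(w <- ws | ~~ (0 < c w)) - c w *: w.
have PN : P = N.
  apply/eqP; rewrite -subr_eq0; move: sum0; rewrite (bigID (fun w => 0 < c w)) /= => <-.
  rewrite /N -sumrN; apply/eqP; congr (_ + _).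
  by apply: eq_bigr => w _; rewrite scaleNr opprK.
have P0 : ip P P = 0.
  apply/eqP; rewrite eq_le ip_ge0 andbT {2}PN ip_suml big_seq_cond.
  apply: sumr_le0 => w /andP [wws cw]; rewrite ip_sumr big_seq_cond.
  apply: sumr_le0 => w' /andP [w'ws]; rewrite -leNgt => cw'; rewrite ipZl ipZr.
  rewrite mulrA mulr_ge0_le0 //; first by rewrite mulr_ge0 ?oppr_ge0 // ltW.
  by apply: obt => //; apply: contraTneq cw => ->; rewrite -leNgt.
have htP : height P = 0.
  by rewrite htE big_seq big1 ?mulr0 // => g gP; apply: ip_eq0 P0 _ (posr_sub gP).
have htN : height N = 0 by rewrite -PN.
move=> w wws; have htw := ht_gt0 (wsP w wws).
have [cw|cw] := boolP (0 < c w).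
  move/eqP: htP; rewrite /height app_sum big_seq_cond psumr_eq0 => [/allP /(_ w wws)|v].
    by rewrite wws cw /= appZ mulf_eq0 => /orP [/eqP //|/eqP E]; move: htw; rewrite /height E ltxx.
  by move=> /andP [/wsP /ht_gt0 hv cv]; rewrite appZ mulr_ge0 // ltW.
move/eqP: htN; rewrite /height app_sum big_seq_cond psumr_eq0 => [/allP /(_ w wws)|v].
  rewrite wws cw /= appZ mulf_eq0 oppr_eq0 => /orP [/eqP //|/eqP E].
  by move: htw; rewrite /height E ltxx.
move=> /andP [/wsP /ht_gt0 hv]; rewrite -leNgt => cv.
by rewrite appZ mulr_ge0 ?oppr_ge0 // ltW.
Qed.

Definition mat (ws : seq E) : 'M[R]_(n, size ws) := \matrix_(i, j) ws`_j i 0.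

Lemma col_mat ws j : col j (mat ws) = ws`_j.
Proof. by apply/colP => i; rewrite !mxE. Qed.

Lemma obtuse_rank (ws : seq E) : uniq ws -> {subset ws <= posr} ->
  (forall w w', w \in ws -> w' \in ws -> w != w' -> ip w w' <= 0) ->
  \rank (mat ws) = size ws.
Proof.
move=> uws wsP obt; rewrite -mxrank_tr; apply/eqP; apply: inj_row_free => u uM.
pose c w := if insub (index w ws) is Some j then u 0 j else 0.
have cE (j : 'I_(size ws)) : c ws`_j = u 0 j by rewrite /c index_uniq // valK.
have sum0 : \sum_(w <- ws) c w *: w = 0.
  rewrite (big_nth 0) big_mkord; apply/colP => i; rewrite summxE.
  have /rowP /(_ i) := uM; rewrite [RHS]mxE [LHS]mxE => E0.
  rewrite [RHS]mxE -[RHS]E0; apply: eq_bigr => j _.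
  by rewrite cE !mxE.
apply/rowP => j; rewrite mxE -cE; apply: (obtuse_indep wsP obt sum0).
exact: mem_nth.
Qed.
End Positive.
End Theory.

Lemma rsys_sub (Phi : seq E) co (P : pred E) : rsys Phi co ->
  (forall a b, a \in Phi -> b \in Phi -> P a -> P b -> P (refl co a b)) ->
  rsys (filter P Phi) co.
Proof.
move=> [h1 h2 h3 h4 h5] HP; split; first exact: filter_uniq.
- by move=> a; rewrite mem_filter => /andP [_ /h2].
- move=> a b; rewrite !mem_filter => /andP [Pa aP] /andP [Pb bP].
  by rewrite h3 // andbT; apply: HP.
- by move=> a b; rewrite !mem_filter => /andP [_ aP] /andP [_ bP]; apply: h4.
- by move=> a t; rewrite !mem_filter => /andP [_ aP] /andP [_ tP]; apply: h5 tP.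
Qed.

Lemma posr_filter (Phi : seq E) f (P : pred E) g :
  (g \in posr (filter P Phi) f) = P g && (g \in posr Phi f).
Proof. by rewrite !mem_filter; case: (P g); case: (0 < _). Qed.
End RootSystem.

(** * Heights *)

Section Heights.
Variables (R : realType) (n : nat).
Local Notation E := 'cV[R]_n.
Variables (Phi : seq E) (co : E -> 'rV[R]_n) (f : 'rV[R]_n).
Hypothesis HPhi : rsys Phi co.
Hypothesis f0 : forall a, a \in Phi -> app f a != 0.

Local Notation pos := (posr Phi f).
Local Notation ht := (height Phi co f).
Local Notation ip := (ip Phi co).

Lemma sum_class (U : eqType) (s : seq E) (y : E -> U) (F : E -> R) :
  \sum_(g <- s) F g = \sum_(u <- undup (map y s)) \sum_(g <- s | y g == u) F g.
Proof.
rewrite (exchange_big_dep xpredT) //= !big_seq; apply: eq_bigr => g gs.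
rewrite -big_filter (_ : filter _ _ = [:: y g]) ?big_seq1 //.
have u1 : uniq [seq u <- undup (map y s) | y g == u] by rewrite filter_uniq ?undup_uniq.
apply/perm_small_eq => //; apply: uniq_perm => // u.
rewrite mem_filter mem_undup inE eq_sym; case: eqP => // ->.
by rewrite map_f.
Qed.

Lemma kermx_prop (b g : E) : b != 0 -> kermx b *m g = 0 -> exists t, g = t *: b.
Proof.
move=> b0 Eg; have [->|g0] := eqVneq g 0; first by exists 0; rewrite scale0r.
have /rp_eqE [t _ E] : rp g = rp b; last by exists t.
apply: sub_ker => // v vb; have /submxP [D ->] : (v <= kermx b)%MS by apply/sub_kermxP.
by rewrite -mulmxA Eg mulmx0.
Qed.

Lemma pos_neq0 b : b \in pos -> b != 0.
Proof.
by move=> /posr_gt0; apply: contraTneq => ->; rewrite app0 ltxx.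
Qed.

(* [Psi] is the rank two subsystem of the roots whose trace on [ker b] is [y] or
   empty: there [b] has at least [ht_Psi b] roots below it, unless it is simple. *)
Lemma class_bound (I : seq E) b y : uniq I -> b \in pos ->
  (forall g, below Phi f g b -> g \in I) -> y != 0 -> rp y = y ->
  2^-1 * \sum_(g <- pos | (g != b) && (rp (kermx b *m g) == y)) app (co g) b
    <= (count_mem y [seq rp (kermx b *m g) | g <- I & ht g < ht b]).-1%:R.
Proof.
move=> uI bP bI y0 yy; set pi := kermx b.
pose inPsi g := (pi *m g == 0) || (rp (pi *m g) == y).
have lineP g : inPsi g -> exists t, pi *m g = t *: y.
  move=> /orP [/eqP ->|/eqP <-]; first by exists 0; rewrite scale0r.
  by have [t _ E] := rpE (pi *m g); exists t.
have lineI g t : pi *m g = t *: y -> inPsi g.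
  move=> E; have [t0|t0] := eqVneq t 0; first by rewrite /inPsi E t0 scale0r eqxx.
  by rewrite /inPsi E rp_scale // yy eqxx orbT.
pose Psi := filter inPsi Phi.
have HPsi : rsys Psi co.
  apply: rsys_sub HPhi _ => a c _ _ /lineP [t Et] /lineP [s Es].
  apply: (lineI _ (s - app (co a) c * t)).
  by rewrite /refl mulmxBr -scalemxAr Et Es scalerBl scalerA.
have fPsi0 a : a \in Psi -> app f a != 0 by rewrite mem_filter => /andP [_ /f0].
have pib : pi *m b = 0 by apply: mulmx_ker.
have bPsi : b \in posr Psi f by rewrite posr_filter bP andbT /inPsi pib eqxx.
have pi0 g : g \in pos -> (pi *m g == 0) = (g == b).
  move=> gP; apply/eqP/eqP => [E|->//]; have [t Et] := kermx_prop (pos_neq0 bP) E.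
  by rewrite Et (scale_pos HPhi bP (_ : t *: b \in pos)) ?scale1r // -Et.
have sumE : \sum_(g <- pos | (g != b) && (rp (pi *m g) == y)) app (co g) b
    = 2 * height Psi co f b - 2.
  rewrite htE mulrA mulfV ?pnatr_eq0 // mul1r.
  rewrite (bigD1_seq b) ?(posr_uniq HPsi) //= (_ : app (co b) b = 2); last first.
    by case: HPsi => _ -> //; exact: posr_sub bPsi.
  rewrite addrC addrK -[LHS]big_filter -[RHS]big_filter; apply: perm_big; apply: uniq_perm.
  - by rewrite filter_uniq // (posr_uniq HPhi).
  - by rewrite filter_uniq // (posr_uniq HPsi).
  move=> g; rewrite mem_filter [RHS]mem_filter posr_filter.
  have [gP|] := boolP (g \in pos); last by rewrite !andbF.
  by rewrite !andbT /inPsi pi0 //; case: (g == b).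
rewrite sumE mulrBr mulrA mulVf ?pnatr_eq0 // mul1r.
have [bS|bS] := boolP (b \in simp Psi f).
  by rewrite (ht_simp HPsi fPsi0 bS) subrr ler0n.
have [s [us sb Es]] := below_many HPsi fPsi0 bPsi bS; rewrite -Es.
have s0 : (0 < size s)%N by rewrite -(ltr0n R) Es (ht_gt0 HPsi).
have le : (size s <= count_mem y [seq rp (pi *m g) | g <- I & (ht g < ht b)%R])%N.
  rewrite count_map -size_filter; apply: uniq_leq_size => // g gs.
  have [gPsi [t [tPsi t0 Eb]]] := sb g gs.
  have gP : g \in pos by move: gPsi; rewrite posr_filter => /andP [].
  have gb : below Phi f g b.
    split=> //; exists t; split=> // d /tPsi; by rewrite posr_filter => /andP [].
  have lt : ht g < ht b by apply: below_lt gb => a; apply: ht_gt0.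
  rewrite !mem_filter lt (bI _ gb) !andbT /=.
  move: gPsi; rewrite posr_filter => /andP [+ _] => /orP [|//]; rewrite pi0 // => /eqP E.
  by rewrite E ltxx in lt.
apply: le_trans (_ : (size s).-1%:R <= _).
  by case: (size s) s0 => // k _; rewrite -natr1 addrK.
by rewrite ler_nat -!subn1 leq_sub2r.
Qed.

(* The local-global formula for heights: [ht b - 1] is the sum of the local
   terms [ht_Psi b - 1]. *)
Lemma coincidences (I : seq E) b k : uniq I -> {subset I <= pos} -> b \in pos ->
  (forall g, below Phi f g b -> g \in I) -> ht b = k.+1%:R ->
  (cnt [seq g <- I | (ht g < ht b)%R] (kermx b) + k
     <= size [seq g <- I | (ht g < ht b)%R])%N.
Proof.
move=> uI IP bP bI htb; set L := [seq g <- I | _]; set pi := kermx b.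
pose y g := rp (pi *m g).
have pin0 g : g \in pos -> g != b -> pi *m g != 0.
  move=> gP; apply: contraNneq => E; have [t Et] := kermx_prop (pos_neq0 bP) E.
  by rewrite Et (scale_pos HPhi bP (_ : t *: b \in pos)) ?scale1r // -Et.
have Lnb g : g \in L -> g \in pos /\ g != b.
  rewrite mem_filter => /andP [lt gI]; split; first exact: IP.
  by apply: contraTneq lt => ->; rewrite ltxx.
have trE : traces L pi = undup (map y L).
  rewrite /traces (_ : filter _ L = L) //; apply/all_filterP/allP => g /Lnb [gP gb].
  exact: pin0.
pose pos' := [seq g <- pos | g != b]; pose ys := undup (map y pos').
(* The term of [b] itself is 2, which lowers the height [k.+1] to [k]. *)
have sumk : 2 * k%:R = \sum_(g <- pos') app (co g) b.
  have := htb; rewrite htE (bigD1_seq b) ?(posr_uniq HPhi) //=.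
  rewrite (_ : app (co b) b = 2); last by case: HPhi => _ -> //; exact: posr_sub bP.
  by rewrite -natr1 /pos' big_filter => /(congr1 ( *%R 2));
    rewrite mulrA mulfV ?pnatr_eq0 // mul1r => E; lra.
have le : k%:R <= \sum_(u <- ys) (count_mem u (map y L)).-1%:R :> R.
  have -> : k%:R = \sum_(u <- ys) 2^-1 * \sum_(g <- pos' | y g == u) app (co g) b :> R.
    by rewrite -mulr_sumr -sum_class -sumk mulrA mulVf ?pnatr_eq0 // mul1r.
  rewrite !big_seq; apply: ler_sum => u; rewrite mem_undup => /mapP [g].
  rewrite mem_filter => /andP [gb gP] Eu.
  rewrite /pos' big_filter_cond; apply: class_bound => //.
    by rewrite Eu rp_eq0 pin0.
  by rewrite Eu rp_id.
have Esum : (\sum_(u <- ys) (count_mem u (map y L)).-1 = size L - cnt L pi)%N.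
  rewrite /cnt trE -(size_map y L) -sum_count_undup.
  (* A class that contains no root of [L] contributes [0.-1 = 0]. *)
  rewrite (bigID (mem (map y L))) /= [X in (_ + X)%N]big1 => [|u /count_memPn ->//].
  rewrite addn0 -big_filter; apply: perm_big; apply: uniq_perm.
  - by rewrite filter_uniq ?undup_uniq.
  - exact: undup_uniq.
  move=> u; rewrite mem_filter !mem_undup; apply/andb_idr => /mapP [g gL ->].
  by rewrite map_f // mem_filter; have [-> ->] := Lnb g gL.
move: le; rewrite -natr_sum ler_nat Esum => le.
have cl : (cnt L pi <= size L)%N.
  by rewrite /cnt trE -(size_map y L) size_undup.
by rewrite -(subnKC cl) leq_add2l.
Qed.

Lemma pos_rt a : a \in pos -> a \in Phi. Proof. exact: posr_sub. Qed.

Lemma ip_le0 a b : a \in pos -> b \in pos -> ht a = ht b -> a != b -> ip a b <= 0.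
Proof.
move=> aP bP Eh ab; rewrite leNgt; apply/negP => /(sub_root HPhi (pos_rt aP) (pos_rt bP) ab).
by move=> /(ht_neq0 HPhi f0); rewrite /height appB -!/(height _ _ _ _) Eh subrr eqxx.
Qed.

Lemma height_rank (bs : seq E) h : uniq bs -> {subset bs <= pos} ->
  (forall b, b \in bs -> ht b = h) -> \rank (mat bs) = size bs.
Proof.
move=> ub bP bh; apply: (obtuse_rank HPhi f0) => // a b ab bb; apply: ip_le0.
- exact: bP.
- exact: bP.
- by rewrite !bh.
Qed.

(** Both Cartan integers are at most -1: they are nonpositive, and if one vanished, reflecting the
    sum would make the difference a root, of height zero. *)
Lemma ip_sum_root a b : a \in pos -> b \in pos -> ht a = ht b -> a != b -> a + b \in Phi ->
  4 * ip a b <= - (ip a a + ip b b).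
Proof.
move=> aP bP Eh ab abP; have aPhi := pos_rt aP; have bPhi := pos_rt bP.
have half c d : c \in pos -> d \in pos -> ht c = ht d -> c != d -> c + d \in Phi ->
    2 * ip c d <= - ip d d.
  move=> cP dP E cd cdP; have cPhi := pos_rt cP; have dPhi := pos_rt dP.
  have d0 := ip_gt0 HPhi dPhi; have le0 := ip_le0 cP dP E cd.
  have Eco := ip_co HPhi dPhi cPhi.
  have co0 : app (co d) c != 0.
    apply/negP => /eqP co0; have := refl_in HPhi dPhi cdP.
    rewrite /refl appD co0 add0r (_ : app (co d) d = 2); last by case: HPhi => _ ->.
    rewrite (_ : _ - _ = c - d) => [/(ht_neq0 HPhi f0)|].
      by rewrite /height appB -!/(height _ _ _ _) E subrr eqxx.
    by rewrite scaler_nat mulr2n opprD addrA addrK.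
  have co_lt0 : app (co d) c < 0.
    rewrite lt_def eq_sym co0 /=; move: le0; rewrite -(pmulr_rle0 _ (ltr0n R 2)) Eco.
    by rewrite pmulr_lle0.
  have : 1 <= - app (co d) c.
    apply: int_gt0_ge1; last by rewrite oppr_gt0.
    by rewrite rpredN; case: HPhi => _ _ _ H _; apply: H.
  by rewrite Eco; nra.
have h1 := half _ _ aP bP Eh ab abP.
have := half _ _ bP aP (esym Eh); rewrite eq_sym ab addrC abP => /(_ isT isT).
by rewrite (ipC _ _ b a); lra.
Qed.

(* The normalised sum of the roots of [P] has positive norm, so the graph whose
   edges are the roots [ga + ga'] has fewer edges than vertices. *)
Lemma few_sums (P Es : seq E) h : uniq P -> {subset P <= pos} -> P != [::] ->
  (forall g, g \in P -> ht g = h) -> uniq Es -> {subset Es <= Phi} ->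
  (forall b, b \in Es -> exists g, [/\ g \in P, b - g \in P & g != b - g]) ->
  (size Es < size P)%N.
Proof.
move=> uP PP P0 Ph uE EP HE; pose x g := (Num.sqrt (ip g g))^-1.
have x0 g : g \in P -> 0 < x g.
  by move=> /PP /pos_rt /(ip_gt0 HPhi) ig; rewrite invr_gt0 sqrtr_gt0.
have xx g : g \in P -> x g * x g * ip g g = 1.
  move=> /PP /pos_rt /(ip_gt0 HPhi) ig; rewrite /x -invfM -expr2 sqr_sqrtr ?ltW //.
  by rewrite mulVf // lt0r_neq0.
pose v := \sum_(g <- P) x g *: g.
have v0 : 0 < ip v v.
  rewrite lt_def ip_ge0 andbT; apply/negP => /eqP /ip_eq0 iv.
  have : ht v = 0 by rewrite htE big_seq big1 ?mulr0 // => g /pos_rt; apply: iv.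
  move/eqP; rewrite /height app_sum big_seq psumr_eq0 => [|g gP]; last first.
    by rewrite appZ mulr_ge0 ?ltW ?x0 // (ht_gt0 HPhi f0) // PP.
  case: (P) P0 x0 PP => [//|g P'] _ x0' PP' /allP /(_ g (mem_head _ _)) /=.
  rewrite mem_head appZ mulf_eq0 !gt_eqF ?x0' ?mem_head //.
  by apply: (ht_gt0 HPhi f0); apply: PP'; rewrite mem_head.
(* The Gram matrix of the normalised roots: 1 on the diagonal, at most -1/2 at an edge, nonpositive
   elsewhere. *)
pose c g g' := x g * x g' * ip g g'.
have cle g g' : g \in P -> g' \in P ->
    c g g' <= (g == g')%:R - 2^-1 * \sum_(b <- Es) ((g + g' == b) && (g != g'))%:R.
  move=> gP g'P; have [<-|gg'] := eqVneq g g'.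
    by rewrite /c xx // big1 ?mulr0 ?subr0 // => b _; rewrite andbF.
  have eh : ht g = ht g' by rewrite !Ph.
  have le0 := ip_le0 (PP _ gP) (PP _ g'P) eh gg'.
  have xg := x0 _ gP; have xg' := x0 _ g'P.
  under eq_bigr do rewrite andbT.
  have [sE|sE] := boolP (g + g' \in Es); last first.
    rewrite big_seq big1 => [|b bE]; last by case: eqP => // E; rewrite E bE in sE.
    by rewrite mulr0 subr0 /c mulr_ge0_le0 // mulr_ge0 // ltW.
  rewrite (bigD1_seq _ sE uE) /= eqxx big1 => [|b /negbTE]; last by rewrite eq_sym => ->.
  rewrite addr0 sub0r mulr1.
  have := ip_sum_root (PP _ gP) (PP _ g'P) eh gg' (EP _ sE).
  have := xx _ gP; have := xx _ g'P; rewrite /c.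
  set a := ip g g; set b := ip g' g'; set p := ip g g'; set y := x g; set z := x g' => Ez Ey le4.
  have yz : 0 < y * z by rewrite mulr_gt0.
  have : (y * z) * (4 * p) <= (y * z) * - (a + b) by rewrite ler_pM2l.
  (* By normalisation [y * z * a] and [y * z * b] are positive with product 1, so their sum is at
     least 2. *)
  have am : 2 <= (y * z) * (a + b).
    have Ea : y * z * a * (y * z * b) = 1 by rewrite -[1]mulr1 -{1}Ey -Ez; ring.
    have a0 : 0 < y * z * a by rewrite mulr_gt0 // (ip_gt0 HPhi) // pos_rt // PP.
    have b0 : 0 < y * z * b by rewrite mulr_gt0 // (ip_gt0 HPhi) // pos_rt // PP.
    rewrite mulrDr; move: (y * z * a) (y * z * b) Ea a0 b0 => A B AB A0 B0.
    rewrite leNgt; apply/negP => lt2; have := sqr_ge0 (A - B).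
    have : 0 < (2 - (A + B)) * (2 + (A + B)) by rewrite mulr_gt0; lra.
    by rewrite expr2; lra.
  by rewrite mulrN; lra.
have vE : ip v v = \sum_(g <- P) \sum_(g' <- P) c g g'.
  rewrite /v ip_suml; apply: eq_bigr => g _; rewrite ip_sumr; apply: eq_bigr => g' _.
  by rewrite ipZl ipZr mulrA.
have le1 : ip v v <= \sum_(g <- P) \sum_(g' <- P)
    ((g == g')%:R - 2^-1 * \sum_(b <- Es) ((g + g' == b) && (g != g'))%:R).
  rewrite vE !big_seq; apply: ler_sum => g gP; rewrite !big_seq; apply: ler_sum => g' g'P.
  exact: cle.
have diag : \sum_(g <- P) \sum_(g' <- P) (g == g')%:R = (size P)%:R :> R.
  rewrite -sum1_size natr_sum !big_seq; apply: eq_bigr => g gP.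
  rewrite (bigD1_seq g gP uP) /= eqxx big1 ?addr0 // => g'.
  by rewrite eq_sym => /negbTE ->.
(* Each edge [b] comes from the two ordered pairs [(g, b - g)] and [(b - g, g)]. *)
have offd : 2 * (size Es)%:R <= \sum_(g <- P) \sum_(g' <- P) \sum_(b <- Es)
    ((g + g' == b) && (g != g'))%:R :> R.
  under eq_bigr do rewrite exchange_big /=; rewrite exchange_big /=.
  rewrite -sum1_size natr_sum mulr_sumr !big_seq; apply: ler_sum => b bE.
  have [g [gP g'P gg']] := HE b bE.
  have one a : a \in P -> \sum_(i <- P) (i == a)%:R = 1 :> R.
    by move=> aP; rewrite (bigD1_seq a aP uP) /= eqxx big1 ?addr0 // => i /negbTE ->.
  have ge1 a a' : a \in P -> a' \in P -> a + a' = b -> a != a' ->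
      1 <= \sum_(i <- P) ((a + i == b) && (a != i))%:R :> R.
    move=> aP a'P E ne; rewrite (bigD1_seq a' a'P uP) /= E eqxx ne lerDl.
    by apply: sumr_ge0 => *; rewrite ler0n.
  have -> : 2 * 1%:R = \sum_(i <- P) ((i == g)%:R + (i == b - g)%:R) :> R.
    by rewrite big_split /= !one // mulr1.
  rewrite !big_seq; apply: ler_sum => i iP.
  have [->|ig] := eqVneq i g.
    by rewrite (negbTE gg') addr0; apply: (ge1 _ (b - g)); rewrite ?subrKC.
  rewrite add0r; have [->|_] := eqVneq i (b - g).
    by apply: (ge1 _ g); rewrite ?subrK // eq_sym.
  by apply: sumr_ge0 => *; rewrite ler0n.
rewrite -(ltr_nat R); move: le1; under eq_bigr do rewrite sumrB -mulr_sumr.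
by rewrite sumrB -mulr_sumr diag; lra.
Qed.

Lemma mat_comb (bs : seq E) g : (g^T <= (mat bs)^T)%MS ->
  exists D : 'I_(size bs) -> R, g = \sum_j D j *: bs`_j.
Proof.
move=> /submxP [D ED]; exists (fun j => D 0 j); apply/colP => i.
have /rowP /(_ i) := ED; rewrite [LHS]mxE => ->; rewrite summxE mxE.
by apply: eq_bigr => j _; rewrite !mxE.
Qed.

Lemma rank_sub_mat (ws bs : seq E) : \rank (mat ws) = size ws ->
  (forall w, w \in ws -> (w^T <= (mat bs)^T)%MS) -> (size ws <= size bs)%N.
Proof.
move=> <- H; apply: leq_trans (rank_leq_col (mat bs));
rewrite -mxrank_tr -[X in (_ <= X)%N]mxrank_tr.
by apply/mxrankS/row_subP => j; rewrite -tr_col col_mat H // mem_nth.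
Qed.

(* Let [Phi'] be the roots in the span of [bs].  As the elements of [bs] are
   simple in the subsystem [Psi] of the roots of [Phi'] whose height is a
   multiple of [k], [ht / k] is the half sum of the positive coroots of [Psi], so
   it is half-integral on [Phi'] and the roots in question have height [k / 2].
   With the elements of [bs] that are not a sum of two of them they would form
   an independent family larger than [bs]. *)
Lemma no_lower (bs : seq E) k g0 : uniq bs -> {subset bs <= pos} ->
  (forall b, b \in bs -> ht b = k) -> g0 \in pos -> ht g0 < k ->
  ~~ (g0^T <= (mat bs)^T)%MS.
Proof.
move=> ub bP bk g0P g0k; apply/negP => g0B.
have k0 : 0 < k by apply: lt_trans g0k; apply: (ht_gt0 HPhi f0).
have kn0 : k != 0 by apply: lt0r_neq0.
pose span (g : E) := (g^T <= (mat bs)^T)%MS.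
have spanD g g' t : span g -> span g' -> span (g - t *: g').
  by rewrite /span linearB linearZ /= => gB g'B; rewrite addmx_sub // eqmx_opp scalemx_sub.
have span_b b : b \in bs -> span b.
  move=> bb; rewrite /span -(nth_index 0 bb).
  have lt : (index b bs < size bs)%N by rewrite index_mem.
  by rewrite -(col_mat (Ordinal lt)) tr_col row_sub.
pose inPsi g := span g && (ht g / k \is a Num.int).
pose Psi := filter inPsi Phi.
have HPsi : rsys Psi co.
  apply: rsys_sub HPhi _ => a b aP' bP' /andP [sa ia] /andP [sb ib].
  apply/andP; split; first exact: spanD.
  rewrite /refl /height appB appZ -!/(height _ _ _ _) mulrBl -mulrA rpredB // rpredM //.
  by case: HPhi => _ _ _ H _; apply: H.
have fPsi0 a : a \in Psi -> app f a != 0 by rewrite mem_filter => /andP [_ /f0].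
have bS b : b \in bs -> b \in simp Psi f.
  move=> bb; rewrite mem_filter posr_filter bP // /inPsi span_b // bk // mulfV // rpred1.
  rewrite !andbT; apply/hasPn => c; rewrite posr_filter => /andP [/andP [_ ic] cP].
  rewrite posr_filter; apply/negP => /andP [/andP [_ id] dP].
  have big d : d \in pos -> ht d / k \is a Num.int -> k <= ht d.
    move=> dP' id'; have : 1 <= ht d / k by apply: int_gt0_ge1; rewrite ?divr_gt0 // (ht_gt0 HPhi).
    by rewrite ler_pdivlMr // mul1r.
  have h1 := big _ cP ic; have h2 := big _ dP id.
  by move: h2; rewrite /height appB -!/(height _ _ _ _) bk //; lra.
have htk g : span g -> ht g = k * height Psi co f g.
  move=> /mat_comb [D ->]; rewrite /height !app_sum mulr_sumr; apply: eq_bigr => j _.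
  rewrite !appZ -!/(height _ _ _ _) (ht_simp HPsi fPsi0) ?bS ?mem_nth //.
  by rewrite bk ?mem_nth // mulr1 mulrC.
have half g : g \in pos -> span g -> ht g < k -> ht g = k / 2.
  move=> gP sg gk; have h0 := ht_gt0 HPhi f0 gP.
  have E1 : 2 * (ht g / k) = \sum_(h <- posr Psi f) app (co h) g.
    by rewrite htk // htE mulrAC mulfV // mul1r mulrA mulfV ?pnatr_eq0 // mul1r.
  (* A sum of Cartan integers, lying strictly between 0 and 2, must be 1. *)
  have i2 : 2 * (ht g / k) \is a Num.int.
    rewrite E1 big_seq; apply: rpred_sum => h; rewrite posr_filter => /andP [_ hP].
    by case: HPhi => _ _ _ H _; apply: H; apply: pos_rt.
  have ge1 : 1 <= 2 * (ht g / k) by apply: int_gt0_ge1; rewrite // mulr_gt0 // divr_gt0.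
  have lt2 : 2 * (ht g / k) < 2 by rewrite gtr_pMr // ltr_pdivrMr // mul1r.
  have [E|ne] := eqVneq (2 * (ht g / k)) 1.
    by rewrite -[LHS](divfK kn0) [RHS]mulrC; congr (_ * k);
      apply: (mulfI (_ : 2 != 0)); rewrite ?pnatr_eq0 // E mulfV ?pnatr_eq0.
  have : 1 <= 2 * (ht g / k) - 1.
    by apply: int_gt0_ge1; rewrite ?rpredB ?rpred1 // subr_gt0 lt_def ne.
  by rewrite lerBrDr -[1 + 1]/(2%:R : R) leNgt lt2.
pose P := [seq g <- pos | span g && (ht g < k)].
have PP : {subset P <= pos} by move=> g; rewrite mem_filter => /andP [].
have Ph g : g \in P -> ht g = k / 2.
  by rewrite mem_filter => /andP [/andP [sg gk] gP]; apply: half.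
have Psp g : g \in P -> span g by rewrite mem_filter => /andP [/andP []].
have uP : uniq P by rewrite filter_uniq // (posr_uniq HPhi).
have P0 : P != [::].
  have : g0 \in P by rewrite mem_filter g0P g0k andbT andbT.
  by case: (P).
pose Es := [seq b <- bs | has (fun g => b - g \in Phi) P].
have ltE : (size Es < size P)%N.
  apply: (few_sums uP PP P0 Ph) => [||b].
  - exact: filter_uniq.
  - by move=> b; rewrite mem_filter => /andP [_ /bP /pos_rt].
  rewrite mem_filter => /andP [/hasP [g gP bgP] bb].
  have hbg : ht (b - g) = k / 2.
    by rewrite /height appB -!/(height _ _ _ _) bk // Ph //; field.
  exists g; split=> //.
    rewrite mem_filter (ht_pos HPhi f0) // hbg divr_gt0 // andbT.
    have -> : span (b - g) by rewrite -[g]scale1r; apply: spanD; [exact: span_b|exact: Psp].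
    by rewrite ltr_pdivrMr // mulr_natr mulr2n ltrDl.
  apply/eqP => E; have E2 : b = 2 *: g by rewrite scaler_nat mulr2n {1}E subrK.
  have := scale_pos HPhi (PP _ gP) (_ : 2 *: g \in pos); rewrite -E2 bP // => /(_ isT) /eqP.
  by rewrite -subr_eq0 (_ : 2 - 1 = 1) ?oner_eq0 //; ring.
pose Q := P ++ [seq b <- bs | b \notin Es].
have PnE g b : g \in P -> b \in bs -> g != b.
  move=> gP bb; apply/eqP => E; have := Ph _ gP; rewrite E bk // => E2.
  by move/eqP: E2; rewrite -subr_eq0 (_ : k - k / 2 = k / 2) ?mulf_eq0 ?invr_eq0
    ?pnatr_eq0 ?orbF ?(negbTE kn0) //; field.
(* A positive product would make [b - g] a root and thus put [b] into [Es]. *)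
have PQ g b : g \in P -> b \in bs -> b \notin Es -> ip b g <= 0.
  move=> gP bb bE; rewrite leNgt; apply: contra bE => ip0; rewrite mem_filter bb andbT.
  apply/hasP; exists g => //; apply: (sub_root HPhi) => //.
  - exact/pos_rt/bP.
  - exact/pos_rt/PP.
  - by rewrite eq_sym PnE.
have uQ : uniq Q.
  rewrite cat_uniq uP filter_uniq // andbT; apply/hasPn => b; rewrite mem_filter => /andP [_ bb].
  by apply/negP => /PnE /(_ bb); rewrite eqxx.
have rkQ : \rank (mat Q) = size Q.
  apply: (obtuse_rank HPhi f0) => //.
    by move=> w; rewrite mem_cat => /orP [/PP //|]; rewrite mem_filter => /andP [_ /bP].
  have inQ w : w \in Q -> w \in P \/ (w \in bs /\ w \notin Es).
    by rewrite mem_cat => /orP [|]; [left|rewrite mem_filter => /andP []; right].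
  move=> w w' /inQ [wP|[wb wE]] /inQ [w'P|[w'b w'E]] ww'.
  - by apply: ip_le0; [exact: PP|exact: PP|rewrite !Ph|].
  - by rewrite ipC PQ.
  - by rewrite PQ.
  - by apply: ip_le0; [exact: bP|exact: bP|rewrite !bk|].
have leQ : (size Q <= size bs)%N.
  apply: (rank_sub_mat rkQ) => w; rewrite mem_cat => /orP [/Psp //|].
  by rewrite mem_filter => /andP [_ /span_b].
have EQ : (size Es + size [seq b <- bs | b \notin Es] = size bs)%N.
  rewrite -(count_predC (mem Es) bs) !size_filter; congr (_ + _)%N.
  by apply: eq_in_count => b bb; rewrite /= mem_filter bb andbT.
by move: leQ ltE; rewrite /Q size_cat -EQ leq_add2r ltnNge => ->.
Qed.
End Heights.

(** * The ideal arrangement, height by height *)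

Lemma saito_sum (K : numFieldType) n (L : seq 'cV[K]_n) m (M : 'M[{mpoly K[n]}]_(m, n)) e :
  arr L -> saito L M e -> (\sum_(i < n) e i)%N = size L.
Proof. by move=> arL sM; have [mn _ _ _] := sM; subst m; have [] := saito_det arL sM. Qed.

Lemma kermx_mul0 (K : fieldType) n q (a : 'M[K]_(n, q)) (b : 'cV[K]_n) :
  kermx a *m b = 0 -> (b^T <= a^T)%MS.
Proof.
move=> ab; rewrite submxE; apply/eqP/trmx_inj; rewrite trmx_mul trmxK trmx0.
apply: (mul_eq0_sub _ ab); apply/sub_kermxP.
by apply: trmx_inj; rewrite trmx_mul trmxK mulmx_coker trmx0.
Qed.

Lemma cols_mat (R : realType) n (ws : seq 'cV[R]_n) : cols (mat ws) = ws.
Proof.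
apply: (@eq_from_nth _ 0); rewrite size_map size_enum_ord // => i lt.
rewrite (nth_map (Ordinal lt)) ?size_enum_ord // col_mat.
by rewrite (nth_enum_ord (Ordinal lt)).
Qed.

Section Assembly.
Variables (R : realType) (n : nat).
Local Notation E := 'cV[R]_n.
Local Notation S := {mpoly R[n]}.
Variables (Phi : seq E) (co : E -> 'rV[R]_n) (f : 'rV[R]_n) (I : seq E).
Hypothesis HPhi : rsys Phi co.
Hypothesis f0 : forall a, a \in Phi -> app f a != 0.
Hypothesis uI : uniq I.
Hypothesis IP : {subset I <= posr Phi f}.
Hypothesis Iideal : forall b g, b \in I -> below Phi f g b -> g \in I.

Local Notation ht := (height Phi co f).

Definition level (h : nat) : seq E := [seq g <- I | ht g == h%:R].

(** Heights are appended one at a time, so that each stage has the shape [L ++ cols a] of the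
    addition step. *)
Fixpoint lower (h : nat) : seq E :=
  if h is k.+1 then lower k ++ level k.+1 else [::].

Lemma mem_lower h g : (g \in lower h) = (g \in I) && (ht g < h.+1%:R).
Proof.
elim: h => [|h IH] /=.
  rewrite in_nil; apply/esym/negP => /andP [/IP /(ht_nat HPhi f0) [k [k0 ->]]].
  by rewrite ltr_nat ltnS leqNgt k0.
rewrite mem_cat IH mem_filter; have [gI|_] := boolP (g \in I); rewrite ?andbF //= andbT.
have [k [_ ->]] := ht_nat HPhi f0 (IP gI).
by rewrite eqr_nat !ltr_nat !ltnS orbC -leq_eqVlt.
Qed.

Lemma lower_uniq h : uniq (lower h).
Proof.
elim: h => //= h IH; rewrite cat_uniq IH filter_uniq // andbT; apply/hasPn => g.
by rewrite mem_filter => /andP [/eqP E gI]; rewrite mem_lower gI E ltxx.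
Qed.

Lemma pos_arr (L : seq E) : uniq L -> {subset L <= posr Phi f} -> arr L.
Proof.
move=> uL LP; apply/andP; split.
  by apply/negP => /LP /posr_gt0; rewrite app0 ltxx.
rewrite map_inj_in_uniq // => a b aL bL /rp_eqE [k _ E].
by rewrite E (scale_pos HPhi (LP _ bL) (_ : k *: b \in _)) ?scale1r // -E; apply: LP.
Qed.

Lemma lower_arr h : arr (lower h).
Proof.
by apply: pos_arr; [exact: lower_uniq|move=> g; rewrite mem_lower => /andP [/IP]].
Qed.

Lemma level_count h b : b \in level h.+1 ->
  (cnt (lower h) (kermx b) + h <= size (lower h))%N.
Proof.
rewrite mem_filter => /andP [/eqP htb bI].
have H := coincidences HPhi f0 uI IP (IP bI) (fun g => Iideal bI) htb.
have mem g : (g \in [seq g <- I | ht g < ht b]) = (g \in lower h).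
  by rewrite mem_filter mem_lower htb andbC.
have -> : size (lower h) = size [seq g <- I | ht g < ht b].
  apply/perm_size/uniq_perm; [exact: lower_uniq|exact: filter_uniq|].
  by move=> g; rewrite mem.
by apply: leq_trans H; rewrite leq_add2r cnt_le // => g; rewrite mem.
Qed.

Lemma level_rank h : \rank (mat (level h)) = size (level h).
Proof.
apply: (height_rank HPhi f0 (h := h%:R)).
- exact: filter_uniq.
- by move=> g; rewrite mem_filter => /andP [_ /IP].
- by move=> g; rewrite mem_filter => /andP [/eqP].
Qed.

(** By [no_lower] no lower root vanishes on the common kernel of the roots of height [h.+1]; a
    generic point of that kernel avoids all their hyperplanes. *)
Lemma level_point h : exists x0 : 'rV[R]_n,
  x0 *m mat (level h.+1) = 0 /\ forall b, b \in lower h -> x0 *m b != 0.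
Proof.
pose K := kermx (mat (level h.+1)).
have [|y [_ yK]] := @generic_off R n [seq K *m b | b <- lower h] 1 (oner_neq0 _).
  apply/mapP => -[b]; rewrite mem_lower => /andP [bI lt] /esym /kermx_mul0; apply/negP.
  apply: (no_lower HPhi f0 (k := h.+1%:R)) => //.
  - exact: filter_uniq.
  - by move=> g; rewrite mem_filter => /andP [_ /IP].
  - by move=> g; rewrite mem_filter => /andP [/eqP].
  - exact: IP.
exists (y *m K); split; first by rewrite -mulmxA mulmx_ker mulmx0.
by move=> b bL; rewrite -mulmxA yK // map_f.
Qed.

Definition rk := size (level 1).

(** The last clause starts at [h = 1]: for [h = 0] the arrangement is empty and its only flat is the
    whole space. The bound [rk], the number of simple roots in [I], is the codimension of the
    center. *)
Definition stage (h : nat) (e : nat -> nat) : Prop :=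
  [/\ exists m p (T : 'M[S]_(m, n)) (F : 'M[S]_(p, n)),
        [/\ saito (lower h) (col_mx T F) e, forall i, (i < m -> e i < h)%N
          & forall i, (m <= i < n -> e i = h)%N],
      forall i j, (i <= j < n -> e i <= e j)%N
    & (0 < h)%N -> forall m1 m2 (N1 : 'M[S]_(m1, n)) (N2 : 'M[S]_(m2, n)),
        saito (lower h) (col_mx N1 N2) e -> (m2 <= rk)%N -> good (lower h) e N1].

Lemma stage0 : stage 0 (fun => 0%N).
Proof.
split=> //; exists 0%N, n, (0 : 'M_(0, n)), (cstm _ 1%:M); split=> //.
split=> //.
- apply: hfamP => // i j; rewrite mxE; case: split_ordP => k _.
    by rewrite mxE dhomog0.
  by rewrite !mxE mpolyC_nat; case: (k == j); rewrite ?dhomog1 ?dhomog0.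
- exists 0; rewrite evm_col evm_cstm; apply: row_free_colP => u v.
  by rewrite mulmx1 [u](thinmx0 u) mul0mx add0r => ->.
- by rewrite big1.
Qed.

Lemma stageS h e : stage h e -> exists e', stage h.+1 e'.
Proof.
move=> [[m [p [T [F [sM lt_e eq_e]]]]] mono Hgood].
have [mn _ _ _] := sM; have [x0 [x0a x0L]] := level_point h.
have arL := lower_arr h; set a := mat (level h.+1) in x0a.
have ra : \rank a = size (level h.+1) by apply: level_rank.
have colsE : cols a = level h.+1 by apply: cols_mat.
have [] := multiple_addition arL sM lt_e _ ra x0a x0L.
- by move=> i; rewrite mn; apply: eq_e.
- by move=> j; apply: level_count; have := col_cols a j; rewrite colsE.
move=> p0 [T1 [F1 [Ep HT HF free0 HFa]]].
have mq : (m + p0 + size (level h.+1))%N = n by lia.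
have arL' : arr (lower h ++ cols a) by rewrite colsE; apply: (lower_arr h.+1).
have le_ed i : (i < m + p0 -> e i <= h)%N.
  move=> lti; have [/lt_e/ltnW//|ge] := ltnP i m.
  by rewrite eq_e // ge; lia.
have eq_ed i : (m + p0 <= i < n -> e i = h)%N by move=> lti; apply: eq_e; lia.
have sum_e := saito_sum arL sM.
exists (step_exp (m + p0) h e); split.
- exists (m + p0)%N, (size (level h.+1)), T1, (scaled a F1).
  have := saito_new mq arL' HT HF free0 HFa eq_ed sum_e.
  rewrite colsE => sN; split=> // i lti.
    by rewrite step_exp_lo // ltnS le_ed.
  by rewrite step_exp_hi //; case/andP: lti.
- move=> i j lij; have [ltj|gej] := ltnP j (m + p0).
    by rewrite !step_exp_lo ?mono //; lia.
  rewrite (step_exp_hi _ _ gej); have [lti|gei] := ltnP i (m + p0).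
    by rewrite step_exp_lo // ltnW // ltnS le_ed.
  by rewrite step_exp_hi.
- move=> _; have := good_step mq arL' HT HF free0 HFa ra x0a x0L le_ed eq_ed sum_e.
  rewrite colsE => step m1 m2 N1 N2 sN m2r; apply: (step rk) sN m2r.
  (* For [h = 0] the new roots are those counted by [rk], so the range of codimensions left to the
     old arrangement is empty. *)
  move=> m1' m2' N1' N2' sN' /andP [lt1 lt2]; case: (h) Hgood lt1 sN' => [_|k Hg _ sN'].
    by rewrite /rk in lt2 *; lia.
  exact: Hg sN' lt2.
Qed.

(** The simple summands of a root of [I] lie below it, or are equal to it, and so belong to the
    ideal. *)
Lemma level1_span (x : 'rV[R]_n) : (forall b, b \in level 1 -> x *m b = 0) ->
  forall g, g \in I -> x *m g = 0.
Proof.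
move=> H g gI; have [s [sS Es _]] := simp_comb HPhi (IP gI).
rewrite Es mulmx_sumr big_seq big1 // => d ds; apply: H.
rewrite mem_filter (ht_simp HPhi f0) ?sS // eqxx /=.
have [E|ne] := eqVneq (rem d s) [::].
  suff <- : g = d by []; rewrite Es (perm_big _ (perm_to_rem ds)) big_cons E big_nil /= addr0 //.
apply: Iideal gI _; split; first by apply: simp_pos; apply: sS.
exists (rem d s); split=> //.
  by move=> c /mem_rem /sS /simp_pos.
by rewrite Es (perm_big _ (perm_to_rem ds)) big_cons.
Qed.

Lemma max_height : exists h, forall g, g \in I -> ht g < h.+1%:R.
Proof.
have : {subset I <= posr Phi f} := IP; elim: (I) => [|b s IH] sP; first by exists 0%N.
have [h Hh] := IH (fun g gs => sP g (mem_behead (s := b :: s) gs)).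
have [k [_ Ek]] := ht_nat HPhi f0 (sP b (mem_head _ _)).
exists (maxn h k) => g; rewrite inE => /orP [/eqP ->|/Hh lt].
  by rewrite Ek ltr_nat ltnS leq_maxr.
by apply: lt_le_trans lt _; rewrite ler_nat ltnS leq_maxl.
Qed.

Theorem ideal_columns : exists (L : seq E) (e : nat -> nat),
  [/\ L =i I, arr L,
      exists m1 m2 (N1 : 'M[S]_(m1, n)) (N2 : 'M[S]_(m2, n)), saito L (col_mx N1 N2) e,
      forall i j, (i <= j < n -> e i <= e j)%N
    & forall m1 m2 (N1 : 'M[S]_(m1, n)) (N2 : 'M[S]_(m2, n)),
        saito L (col_mx N1 N2) e -> (m2 <= rk)%N -> good L e N1].
Proof.
have [h Hh] := max_height.
have [e [He mono Hg]] : exists e, stage h.+1 e.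
  elim: h.+1 => [|k [e /stageS //]]; by exists (fun => 0%N); apply: stage0.
exists (lower h.+1), e; split=> //.
- move=> g; rewrite mem_lower; apply/andb_idr => /Hh lt.
  by apply: lt_trans lt _; rewrite ltr_nat.
- exact: lower_arr.
- by have [m [p [T [F [sM _ _]]]]] := He; exists m, p, T, F.
- exact: Hg.
Qed.
End Assembly.

(** * Coordinates *)

Local Open Scope fset_scope.
Local Open Scope ring_scope.

Section Coordinates.
Variables (K : numFieldType) (V : vectType K).
Local Notation N := (\dim {:V}).
Local Notation S := {mpoly K[N]}.

Definition acol (a : 'Hom(V, K^o)) : 'cV[K]_N := \col_i (a (vbasis {:V})`_i : K).
Definition crow (w : V) : 'rV[K]_N := \row_i coord (vbasis {:V}) i w.

Lemma crowE a w : (crow w *m acol a) 0 0 = a w.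
Proof.
rewrite {2}(coord_vbasis (memvf w)) linear_sum mxE; apply: eq_bigr => i _.
by rewrite !mxE linearZ.
Qed.

Lemma crow_surj (v : 'rV[K]_N) : exists w, crow w = v.
Proof.
exists (\sum_i v 0 i *: (vbasis {:V})`_i); apply/rowP => i; rewrite mxE.
exact: coord_sum_free (basis_free (vbasisP _)).
Qed.

Lemma crow_lker a w : (w \in lker a) = (crow w *m acol a == 0).
Proof.
rewrite memv_ker -crowE; apply/eqP/eqP => [E|->]; last by rewrite mxE.
by apply/matrixP => i j; rewrite !ord1 E mxE.
Qed.

Lemma acol_inj : injective acol.
Proof. by move=> a b E; apply/lfunP => w; rewrite -!crowE E. Qed.

Lemma acol0 : acol 0 = 0.
Proof. by apply/colP => i; rewrite !mxE lfunE. Qed.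
Lemma acolD a b : acol (a + b) = acol a + acol b.
Proof. by apply/colP => i; rewrite !mxE lfunE. Qed.
Lemma acolZ k a : acol (k *: a) = k *: acol a.
Proof. by apply/colP => i; rewrite !mxE lfunE. Qed.
Lemma acolN a : acol (- a) = - acol a.
Proof. by rewrite -scaleN1r acolZ scaleN1r. Qed.
Lemma acol_sum (I : Type) (r : seq I) F :
  acol (\sum_(i <- r) F i) = \sum_(i <- r) acol (F i).
Proof. by elim/big_rec2: _ => [|i x y _ <-]; [exact: acol0|exact: acolD]. Qed.

Lemma acol_eq0 a : (acol a == 0) = (a == 0).
Proof. by rewrite -acol0 (inj_eq acol_inj). Qed.

Lemma lker_rp a b : a != 0 -> b != 0 -> lker a = lker b -> rp (acol a) = rp (acol b).
Proof.
move=> a0 b0 E; apply: sub_ker; rewrite ?acol_eq0 // => v.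
have [w <-] := crow_surj v; move/eqP; rewrite -crow_lker -E crow_lker.
exact: eqP.
Qed.

Lemma form_polyE a : form_poly a = lin (acol a).
Proof. by apply: eq_bigr => i _; rewrite mxE. Qed.

Lemma der_applyE (th : 'rV[S]_N) a : der_apply th (form_poly a) = dv th (acol a).
Proof.
rewrite /der_apply /dv mxE; apply: eq_bigr => i _; rewrite !mxE; congr (_ * _).
rewrite /form_poly linear_sum (bigD1 i) //= mderivZ mderivX big1 ?addr0 => [|j ne].
  have -> : (U_(i) - U_(i) = 0 :> 'X_{1..N})%MM by apply/mnmP => k; rewrite mnmBE subnn mnm0E.
  by rewrite mpolyX0 mnm1E eqxx scale1r -mul_mpolyC mulr1.
by rewrite mderivZ mderivX mnm1E (negbTE ne) scale0r scaler0.
Qed.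

(** Forms are matched only up to nonzero scalars, since an arrangement remembers just their
    kernels. *)
Definition represents (L : seq 'cV[K]_N) (A : {fset {vspace V}}) : Prop :=
  (forall a, a != 0 -> lker a \in A -> rp (acol a) \in map (@rp K N) L) /\
  (forall b, b \in L -> exists2 a, lker a \in A & rp (acol a) = rp b).

Lemma logderE L A th : represents L A -> logder A th <-> logd L th.
Proof.
move=> [H1 H2]; split=> [Hth b bL v vb|Hth a aA].
  have [a aA E] := H2 b bL; have [g Eg] := Hth a aA; apply/matrixP => i j.
  rewrite !ord1 [RHS]mxE -ev_dv; move: E => /esym/rp_eqE [k k0 Eb].
  have -> : dv th b = k%:MP * dv th (acol a).
    rewrite /dv Eb !mxE mulr_sumr; apply: eq_bigr => l _.
    by rewrite !mxE mpolyCM mulrCA.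
  rewrite -der_applyE Eg form_polyE !rmorphM /= ev_lin.
  suff -> : v *m acol a = 0 by rewrite mxE mul0r mulr0.
  by apply/eqP; move/eqP: vb; rewrite Eb -scalemxAr scalemx_eq0 (negbTE k0).
have [->|a0] := eqVneq a 0; first by exists 0; rewrite der_applyE form_polyE acol0
  (_ : lin 0 = 0) ?mulr0 /dv ?mxE ?big1 //; first (by move=> l _; rewrite !mxE mulr0);
  apply/eqP; rewrite lin_eq0.
rewrite der_applyE form_polyE; apply: vanP; first by rewrite acol_eq0.
have /mapP [b bL E] := H1 a a0 aA.
move: E => /rp_eqE [k k0 Ea] v va.
rewrite ev_dv Ea -scalemxAr Hth // ?mxE ?mulr0 //.
by apply/eqP; move/eqP: va; rewrite Ea -scalemxAr scalemx_eq0 (negbTE k0).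
Qed.

Lemma saito_split L m (M : 'M[S]_(m, N)) e m1 m2 : saito L M e -> m = (m1 + m2)%N ->
  exists N1 N2, saito L (col_mx N1 N2 : 'M_(m1 + m2, N)) e.
Proof.
by move=> sM Em; subst m; exists (usubmx M), (dsubmx M); rewrite vsubmxK.
Qed.

Lemma saito_exponents L A m (M : 'M[S]_(m, N)) (es : seq nat) :
  arr L -> represents L A -> saito L M (nth 0%N es) -> size es = m ->
  free_with_exponents A es.
Proof.
move=> arL LA sM Em; subst m; have [_ HM _ _] := sM.
have bas : is_basis (logder A) (fun i => row i M).
  split=> [i|th|c].
  - by rewrite (logderE _ LA); have [] := HM i.
  - rewrite (logderE _ LA) => Hth; have [c -> _] := saito_coef arL sM Hth.
    by exists (fun i => c 0 i); rewrite mulmx_sum_row.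
  - move=> sum0 i; have : (\row_j c j) *m M = 0.
      by rewrite mulmx_sum_row -[RHS]sum0; apply: eq_bigr => j _; rewrite mxE.
    by move=> /(saito_indep arL sM) /rowP /(_ i); rewrite !mxE.
split; first by exists (size es), (fun i => row i M).
exists (fun i => row i M); split=> // i j; have [_ H] := HM i; exact: H.
Qed.
End Coordinates.

(** * Restriction to a flat in coordinates *)

Section Restriction.
Variables (K : numFieldType) (V : vectType K) (X : {vspace V}).
Local Notation N := (\dim {:V}).
Local Notation W := (subvs_of X).
Local Notation incl := (linfun (@vsval K V X)).

Definition iota_mx : 'M[K]_(\dim {:W}, N) := \matrix_i crow (vsval (vbasis {:W})`_i).

Lemma crow_incl (w : W) : crow (vsval w) = crow w *m iota_mx.
Proof.
rewrite {1}(coord_vbasis (memvf w)) mulmx_sum_row; apply/rowP => j.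
rewrite mxE !linear_sum summxE; apply: eq_bigr => i _.
by rewrite !linearZ /= mxE rowK !mxE.
Qed.

Lemma acol_incl (a : 'Hom(V, K^o)) : acol (a \o incl)%VF = iota_mx *m acol a.
Proof.
apply/colP => i; rewrite mxE comp_lfunE lfunE -crowE.
have -> : crow (vsval (vbasis {:W})`_i) = row i iota_mx by rewrite rowK.
by rewrite -row_mul mxE.
Qed.

Lemma iota_free : row_free iota_mx.
Proof.
apply: inj_row_free => v; have [w <-] := crow_surj v; rewrite -crow_incl => E.
have w0 : vsval w = 0.
  rewrite (coord_vbasis (memvf (vsval w))) big1 // => i _.
  by have /rowP /(_ i) := E; rewrite !mxE => ->; rewrite scale0r.
have -> : w = 0 by apply: subvs_inj.
by apply/rowP => i; rewrite !mxE linear0.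
Qed.

Lemma iota_sub (v : 'rV[K]_N) : (v <= iota_mx)%MS <-> exists2 w, w \in X & v = crow w.
Proof.
split=> [/submxP [D ->]|[w wX ->]].
  by have [w <-] := crow_surj D; exists (vsval w); rewrite ?subvsP // crow_incl.
by rewrite -[w]/(vsval (Subvs wX)) crow_incl submxMl.
Qed.

Lemma dim_subvs : \dim {:W} = \dim X.
Proof. by rewrite dimvf. Qed.

Lemma sub_lker (a : 'Hom(V, K^o)) : (X <= lker a)%VS = (iota_mx *m acol a == 0).
Proof.
rewrite -acol_incl acol_eq0; apply/subvP/eqP => [H|E w wX].
  apply/lfunP => w; rewrite comp_lfunE !lfunE /=; apply/eqP.
  by rewrite -memv_ker H // subvsP.
by rewrite memv_ker -[w]/(vsval (Subvs wX)) -[vsval _](lfunE (@vsval K V X)) -comp_lfunE E lfunE.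
Qed.

Lemma restriction_represents (I : {fset 'Hom(V, K^o)}) (L : seq 'cV[K]_N) :
  L =i map (@acol K V) I ->
  represents (traces L iota_mx) (restriction [fset lker b | b in I] X).
Proof.
move=> LI; have preim (b : 'Hom(V, K^o)) : (incl @^-1: lker b)%VS = lker (b \o incl)%VF.
  by apply/vspaceP => w; rewrite -memv_preim !memv_ker comp_lfunE.
split=> [a a0|b'].
  move=> /imfsetP [/= H /andP [/imfsetP [/= b bI ->]] nX Ea].
  have b0 : iota_mx *m acol b != 0 by rewrite -sub_lker.
  have bi0 : (b \o incl)%VF != 0 by rewrite -acol_eq0 acol_incl.
  rewrite (@lker_rp _ _ a (b \o incl)%VF) //; last by rewrite Ea preim.
  rewrite acol_incl -rp_id; apply: map_f; rewrite mem_undup; apply/mapP.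
  by exists (acol b); rewrite // mem_filter b0 LI map_f.
rewrite mem_undup => /mapP [c]; rewrite mem_filter LI => /andP [c0 /mapP [b bI Ec]] ->.
exists (b \o incl)%VF; last by rewrite acol_incl rp_id Ec.
rewrite -preim; apply/imfsetP; exists (lker b) => //=.
rewrite inE /= sub_lker -Ec c0 andbT; apply/imfsetP; by exists b.
Qed.
End Restriction.

Lemma seq_choice (T : eqType) (U : Type) (u0 : U) (s : seq T) (P : T -> U -> Prop) :
  (forall x, x \in s -> exists u, P x u) -> exists f, forall x, x \in s -> P x (f x).
Proof.
elim: s => [|y s IH] H; first by exists (fun => u0).
have [f Hf] := IH (fun x xs => H x (mem_behead (s := y :: s) xs)).
have [u Hu] := H y (mem_head _ _).
exists (fun x => if x == y then u else f x) => x; rewrite inE.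
by case: eqP => [->|_ /Hf].
Qed.

Lemma saito_ext (K : numFieldType) n (L : seq 'cV[K]_n) m (M : 'M[{mpoly K[n]}]_(m, n)) e1 e2 :
  (forall i, i < m -> e1 i = e2 i)%N -> saito L M e1 -> saito L M e2.
Proof.
move=> E [mn HM Hv le]; split=> //.
  by move=> i; have [H1 H2] := HM i; split=> // j; rewrite -E.
by rewrite (eq_bigr (fun i : 'I_m => e1 i)) // => i _; rewrite E.
Qed.

Section Spaces.
Variables (K : fieldType) (V : vectType K).

Lemma memv_bigcaps (s : seq {vspace V}) w :
  (w \in (\bigcap_(H <- s) H)%VS) <-> (forall H, H \in s -> w \in H).
Proof.
elim: s => [|H s IH]; first by rewrite big_nil memvf.
rewrite big_cons memv_cap; split=> [/andP [wH /IH ws] G|ws].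
  by rewrite inE => /orP [/eqP ->|/ws].
by rewrite ws ?mem_head //=; apply/IH => G Gs; rewrite ws // inE Gs orbT.
Qed.

Lemma dim_bigcap_lker (s : seq 'Hom(V, K^o)) :
  (\dim {:V} <= \dim (\bigcap_(b <- s) lker b)%VS + size s)%N.
Proof.
elim: s => [|b s IH]; first by rewrite big_nil addn0.
rewrite big_cons capvC; set U := (\bigcap_(c <- s) _)%VS in IH *.
have le1 : (\dim (b @: U) <= 1)%N.
  by apply: leq_trans (dimvS (subvf _)) _; rewrite dimvf.
apply: leq_trans IH _; rewrite -(limg_ker_dim b U) /=.
by rewrite -addnA leq_add2l addnC -addn1 leq_add2l.
Qed.
End Spaces.

Section Good.
Variables (K : numFieldType) (V : vectType K).
Local Notation N := (\dim {:V}).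

(** Saito's criterion on [X]: the restricted fields keep their degrees and their independence at
    [x], and [good] supplies enough traces for the degree bound. *)
Lemma good_restriction (I : {fset 'Hom(V, K^o)}) (L : seq 'cV[K]_N) (es : seq nat) d
    (N1 : 'M[{mpoly K[N]}]_(d, N)) :
  L =i map (@acol K V) I -> (d <= size es)%N ->
  (forall i : 'I_d, logd L (row i N1) /\ vhomog (nth 0%N es i) (row i N1)) ->
  good L (nth 0%N es) N1 ->
  exists X : {vspace V}, [/\ is_flat [fset lker b | b in I] X, \dim X = d
    & free_with_exponents (restriction [fset lker b | b in I] X) (take d es)].
Proof.
move=> LI dle HN1 [J [A0 [JL [x [xJ x_free]] A0free A0J le]]].
pose B : {fset {vspace V}} := [fset lker b | b in I & acol b \in J].
pose X := (\bigcap_(H <- B) H)%VS.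
have XJ w : (w \in X) <-> (forall c, c \in J -> crow w *m c = 0).
  rewrite memv_bigcaps; split=> [H c cJ|H G /imfsetP [/= b]].
    have /mapP [b bI Ec] : c \in map (@acol K V) I by rewrite -LI JL.
    apply/eqP; rewrite Ec -crow_lker; apply: H; apply/imfsetP; exists b => //=.
    by rewrite inE /= bI -Ec.
  by rewrite inE /= => /andP [bI bJ] ->; rewrite crow_lker H.
set io := iota_mx X.
have ioJ (v : 'rV_N) : (v <= io)%MS <-> (forall c, c \in J -> v *m c = 0).
  rewrite iota_sub; split=> [[w wX ->]|H]; first exact/XJ.
  by have [w Ew] := crow_surj v; exists w => //; apply/XJ => c cJ; rewrite Ew H.
have io_eq : (io :=: A0)%MS.
  apply/eqmxP/andP; split; apply/row_subP => i.
    by apply/A0J => c cJ; apply: (ioJ _).1 cJ; apply: row_sub.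
  by apply/ioJ => c cJ; apply: (A0J _).1 cJ; apply: row_sub.
have dimW : \dim {: subvs_of X} = d.
  have := iota_free X; rewrite -/io /row_free => /eqP <-.
  by rewrite io_eq; apply/eqP.
exists X; split; [|by rewrite -dim_subvs|].
  exists B => //; apply/fsubsetP => H /imfsetP [/= b]; rewrite inE => /andP [bI _] ->.
  by apply/imfsetP; exists b.
apply: (@saito_exponents _ _ (traces L io) _ _ (pullM io N1)).
- exact: arr_traces.
- exact: restriction_represents.
- have tan i : tangent io (row i N1).
    move=> y yio; apply/ioJ => c cJ; have [Hl _] := HN1 i.
    by apply: Hl; [exact: JL|exact: (ioJ _).1 yio c cJ].
  split; first by rewrite dimW.
  + move=> i; rewrite row_pullM; have [Hl Hh] := HN1 i; split.
      by apply: logd_pull => // a aL y _; apply: Hl.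
    by rewrite nth_take //; apply: vhomog_pullM.
  + have /submxP [y Ex] : (x <= io)%MS by apply/ioJ.
    exists y; rewrite evm_pullM -Ex; apply: inj_row_free => u uM.
    apply/eqP; rewrite -(mulmx_free_eq0 u x_free); apply/eqP.
    have sub : (evm x N1 <= io)%MS.
      apply/row_subP => i; rewrite -evm_row; apply: tan.
      by rewrite Ex submxMl.
    by rewrite -(mulmxKpV sub) mulmxA uM mul0mx.
  + rewrite (eq_bigr (fun i : 'I_d => nth 0%N es i)) => [|i _]; last by rewrite nth_take.
    by rewrite (_ : size _ = cnt L A0) //; apply: cnt_eq.
- by rewrite size_takel.
Qed.
End Good.

(** * From root ideals to accuracy *)

Section Main.
Variables (R : realType) (V : vectType R).
Variables (Phi Phip I : {fset 'Hom(V, R^o)}).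
Local Notation N := (\dim {:V}).
Local Notation cols := (map (@acol R V)).

Lemma columns_rsys : root_system Phi -> exists co, rsys (cols Phi) co.
Proof.
move=> [_ Hco Hred].
have [co Hc] : exists co : 'cV[R]_N -> 'rV[R]_N, forall u, u \in cols Phi ->
    app (co u) u = 2 /\ forall w, w \in cols Phi ->
      w - app (co u) w *: u \in cols Phi /\ app (co u) w \is a Num.int.
  apply: (@seq_choice _ _ 0 _ (fun u c => app c u = 2 /\ forall w, w \in cols Phi ->
      w - app c w *: u \in cols Phi /\ app c w \is a Num.int)) => u /mapP [a aP ->].
  have [c [ac2 cref cint]] := Hco a aP; exists (crow c); split; first by rewrite /app crowE.
  move=> w /mapP [b bP ->]; rewrite /app crowE; split; last exact: cint.
  by rewrite -acolZ -acolN -acolD map_f // -/(reflection a c b) cref.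
exists co; split.
- by rewrite map_inj_uniq ?fset_uniq //; apply: acol_inj.
- by move=> u /Hc [].
- by move=> u w /Hc [_ H] /H [].
- by move=> u w /Hc [_ H] /H [].
- move=> u t /mapP [a aP ->]; rewrite -acolZ => /mapP [b bP] /acol_inj E.
  by apply: Hred aP _; rewrite E.
Qed.

Lemma ideal_accurate : root_system Phi -> positive_system Phi Phip -> root_ideal Phip I ->
  accurate (ideal_arrangement I).
Proof.
move=> HPhi [v [v0 EPhip]] [IPhip ideal].
have [co Hrs] := columns_rsys HPhi; set P := cols Phi in Hrs.
pose f : 'rV[R]_N := crow v.
have appf a : app f (acol a) = a v by rewrite /app crowE.
have f0 u : u \in P -> app f u != 0 by move=> /mapP [a aP ->]; rewrite appf v0.
have posE u : (u \in posr P f) = (u \in cols Phip).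
  rewrite mem_filter; apply/andP/mapP => [[up /mapP [a aP Eu]]|[a]].
    by exists a => //; rewrite EPhip !inE /= aP -appf -Eu.
  rewrite EPhip !inE /= => /andP [aP a0] ->; rewrite appf; split=> //.
  exact: map_f.
have posA a : (acol a \in posr P f) = (a \in Phip) by rewrite posE mem_map //; apply: acol_inj.
have simpE u : u \in simp P f -> exists2 a, a \in simple_roots Phip & u = acol a.
  rewrite mem_filter posE => /andP [nh /mapP [a aP Eu]]; exists a => //.
  rewrite !inE /= aP /=; apply: contra nh => /hasP [b bP abP]; apply/hasP.
  by exists (acol b); rewrite ?posA // Eu -acolN -acolD posA.
(* [below] decomposes a difference into positive roots, [root_le] into simple ones; [RL] bridges the
   two. *)
pose RL u := exists c : 'Hom(V, R^o) -> nat,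
  u = \sum_(a <- simple_roots Phip) acol a *+ c a.
have RL0 : RL 0 by exists (fun => 0%N); rewrite big1 // => a _; rewrite mulr0n.
have RLD u w : RL u -> RL w -> RL (u + w).
  move=> [c ->] [c' ->]; exists (fun a => (c a + c' a)%N); rewrite -big_split /=.
  by apply: eq_bigr => a _; rewrite mulrnDr.
have RLsimp u : u \in simp P f -> RL u.
  move=> /simpE [a aS ->]; exists (fun b => nat_of_bool (b == a)).
  rewrite (bigD1_seq a) ?fset_uniq //= eqxx mulr1n big1 ?addr0 // => b /negbTE ->.
  by rewrite mulr0n.
have RLsum (s : seq 'cV[R]_N) : (forall u, u \in s -> RL u) -> RL (\sum_(u <- s) u).
  elim: s => [|u s IH] H; first by rewrite big_nil.
  rewrite big_cons; apply: RLD; first by apply: H; rewrite mem_head.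
  by apply: IH => w ws; apply: H; rewrite inE ws orbT.
have RLpos u : u \in posr P f -> RL u.
  by move=> /(simp_comb Hrs) [s [sS -> _]]; apply: RLsum => w /sS /RLsimp.
have uI : uniq (cols I) by rewrite map_inj_uniq ?fset_uniq //; apply: acol_inj.
have IP : {subset cols I <= posr P f}.
  by move=> u /mapP [a aI ->]; rewrite posA; apply: (fsubsetP IPhip).
have Iideal b g : b \in cols I -> below P f g b -> g \in cols I.
  move=> /mapP [b0 b0I ->] [gP [t [tP _ Eb]]].
  move: gP; rewrite posE => /mapP [g0 g0P Eg]; rewrite Eg map_f //; apply: ideal b0I g0P _.
  have [c Ec] : RL (\sum_(u <- t) u) by apply: RLsum => u /tP /RLpos.
  exists c; apply: acol_inj; rewrite acolD acolN acol_sum Eb Eg addrC addKr Ec.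
  apply: eq_bigr => a _; elim: (c a) => [|k IH]; first by rewrite !mulr0n acol0.
  by rewrite !mulrS acolD IH.
have [L [e [LI arL [m1 [m2 [M1 [M2 sM]]]] mono Hgood]]] :=
  ideal_columns Hrs f0 uI IP Iideal.
have [Nm _ _ _] := sM; pose es := mkseq e N.
have nthE i : (i < N)%N -> nth 0%N es i = e i by move=> lt; rewrite nth_mkseq.
exists es; split.
- by rewrite size_mkseq.
- apply/(sortedP 0%N) => i; rewrite size_mkseq => lt.
  by rewrite !nthE ?(ltnW lt) // mono // leqnSn.
- apply: (@saito_exponents _ _ L _ _ (col_mx M1 M2)) => //.
  + have I0 b : b \in I -> b != 0.
      move=> bI; rewrite -acol_eq0; have := IP _ (map_f (@acol R V) bI).
      by move=> /posr_gt0; apply: contraTneq => ->; rewrite app0 ltxx.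
    split=> [a a0 /imfsetP [/= b bI E]|c].
      by rewrite (lker_rp a0 (I0 b bI) E) map_f // LI map_f.
    by rewrite LI => /mapP [b bI ->]; exists b => //; apply/imfsetP; exists b.
  + by apply: saito_ext sM => i lt; rewrite nthE // -Nm.
  + by rewrite size_mkseq.
move=> d /andP [_ dN] dc.
have Em : (m1 + m2 = d + (N - d))%N by rewrite Nm subnKC.
have [N1 [N2 sN]] := saito_split sM Em.
(* The kernels of the roots of height one already cut out the center, whose codimension is therefore
   at most [rk]; the lower bound on [d] turns this into the bound on [N - d]. *)
have rkle : (N - d <= rk P co f (cols I))%N.
  pose s := [seq b <- I | acol b \in level P co f (cols I) 1].
  have sub : (\bigcap_(b <- s) lker b <= arr_center (ideal_arrangement I))%VS.
    apply/subvP => w wS; apply/memv_bigcaps => H /imfsetP [/= b bI ->].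
    rewrite crow_lker; apply/eqP; apply: (level1_span Hrs f0 IP Iideal); last exact: map_f.
    move=> c cl; have : c \in cols I by move: cl; rewrite mem_filter => /andP [].
    move=> /mapP [b' b'I Ec]; apply/eqP; rewrite Ec -crow_lker.
    move: wS; rewrite -(big_map (@lker _ _ _) xpredT id) => /memv_bigcaps; apply.
    by apply: map_f; rewrite mem_filter -Ec cl.
  have szs : (size s <= rk P co f (cols I))%N.
    rewrite -(size_map (@acol R V)); apply: uniq_leq_size.
      by rewrite map_inj_uniq ?filter_uniq ?fset_uniq //; apply: acol_inj.
    by move=> u /mapP [b]; rewrite mem_filter => /andP [bl _] ->.
  rewrite leq_subLR; apply: leq_trans (dim_bigcap_lker s) _.
  by rewrite leq_add //; apply: leq_trans (dimvS sub) dc.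
have sN' : saito L (col_mx N1 N2) (nth 0%N es).
  by apply: saito_ext sN => i lt; rewrite nthE // -Nm Em.
apply: (good_restriction (N1 := N1) LI); first by rewrite size_mkseq.
  move=> i; have [_ HN _ _] := sN'; have := HN (lshift _ i).
  by rewrite -row_usubmx col_mxKu.
have := Hgood _ _ _ _ sN rkle; apply: good_sub => // i lt.
by rewrite nthE // (leq_trans lt).
Qed.
End Main.

Theorem theorem1p3 (R : realType) (l : nat)
    (Phi Phip I : {fset 'Hom('rV[R]_l, R^o)}) :
  root_system Phi ->
  positive_system Phi Phip ->
  root_ideal Phip I ->
  accurate (ideal_arrangement I).
Proof. exact: ideal_accurate. Qed.
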